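(* Let $x>0$ and $s>0$. Let $\mathcal L_{I|E_{t,x},q',q}(s)$ denote the Laplace transform $\mathbb E[e^{-sI}\mid E_{t,x},q,q']$ of the interference $I$ at the typical user, conditioned on there being a BS at $x$, on the event $E_{t,x}$ ($t\in\{\mathsf L,\mathsf N\}$), and on the closest blockage distances $q,q'$ (so $x<q$ when $t=\mathsf L$ and $x>q$ when $t=\mathsf N$). Then $$\mathcal L_{I|E_{\mathsf L,x},q',q}(s)=\exp\Big(-\lambda\Big(\int_q^\infty\frac{dy}{1+(s\ell_{\mathsf N}(y))^{-1}}+\int_{e_{\mathsf N|\mathsf L}(x)}^\infty\frac{\mathbf 1(y>q')\,dy}{1+(s\ell_{\mathsf N}(y))^{-1}}+\int_x^q\frac{dy}{1+(s\ell_{\mathsf L}(y))^{-1}}+\int_x^\infty\frac{\mathbf 1(y<q')\,dy}{1+(s\ell_{\mathsf L}(y))^{-1}}\Big)\Big),$$ $$\mathcal L_{I|E_{\mathsf N,x},q',q}(s)=\exp\Big(-\lambda\Big(\int_x^\infty\frac{dy}{1+(s\ell_{\mathsf N}(y))^{-1}}+\int_x^\infty\frac{\mathbf 1(y>q')\,dy}{1+(s\ell_{\mathsf N}(y))^{-1}}+\int_{e_{\mathsf L|\mathsf N}(x)}^\infty\frac{\mathbf 1(y<q')\,dy}{1+(s\ell_{\mathsf L}(y))^{-1}}\Big)\Big).$$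
   Context: 1D network. Base stations (BSs) form a homogeneous Poisson point process (PPP) $\Phi=\{X_i\}$ of density $\lambda>0$ on $\mathbb R$; the typical user is at the origin. Blockages are points of an independent homogeneous PPP of density $\mu>0$ on $\mathbb R$. Let $q$ (resp. $q'$) be the distance from the origin to the nearest blockage in $(0,\infty)$ (resp. $(-\infty,0)$); these are independent with density $\mu e^{-\mu t}$, $t\ge0$. A BS at $y$ is LoS (type $\mathsf L$) if no blockage lies between $0$ and $y$ (i.e. $0<y<q$, or $y<0$ and $|y|<q'$), and NLoS (type $\mathsf N$) otherwise. Path loss: $\ell_{\mathsf L},\ell_{\mathsf N}:[0,\infty)\to[0,\infty)$ are bounded and nonincreasing with $\ell_{\mathsf L}\ge\ell_{\mathsf N}$. A BS of type $t$ at distance $y$ gives average received power $\ell_t(y)$ and received power $H\ell_t(y)$, with fading variables $H$ i.i.d. exponential of mean $1$, independent of everything else. Exclusion radii: $e_{\mathsf L|\mathsf L}(x)=e_{\mathsf N|\mathsf N}(x)=x$, $e_{\mathsf N|\mathsf L}(x)=\min\{y\ge0:\ell_{\mathsf N}(y)\le\ell_{\mathsf L}(x)\}$, $e_{\mathsf L|\mathsf N}(x)=\min\{y\ge 0:\ell_{\mathsf L}(y)\le\ell_{\mathsf N}(x)\}$ (min read as infimum, $\infty$ if the set is empty), with $e_{\mathsf N|\mathsf L}(x)<x<e_{\mathsf L|\mathsf N}(x)$ for $x>0$. The user is served by the BS with maximum average received power: $E_{t,x}$ is the event that the BS at $x$ has type $t$ and is serving, i.e. every other BS of type $v$ is at distance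 greater than $e_{v|t}(x)$ from the origin, for $v\in\{\mathsf L,\mathsf N\}$. The interference $I$ is the sum of the received powers $H_i\ell_{s_i}(|X_i|)$ over all BSs other than the serving one, $s_i$ being the type of the BS at $X_i$. Convention: $1/(1+(s\ell)^{-1})=0$ when $\ell=0$. *)

(* Defs.v *)
From HB Require Import structures.
From mathcomp Require Import all_boot all_order all_algebra finmap.
From mathcomp Require Import all_classical all_reals all_analysis measurable_realfun.
Set Implicit Arguments.
Unset Strict Implicit.
Unset Printing Implicit Defensive.
Import Order.TTheory GRing.Theory Num.Theory.
Import numFieldNormedType.Exports.
Local Open Scope classical_set_scope.
Local Open Scope ring_scope.
Local Open Scope ereal_scope.

Section independence.
Context d (T : measurableType d) (R : realType) (P : probability T R).

Definition mutually_independent d' (S : measurableType d') (I : choiceType)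
    (Z : I -> T -> S) : Prop :=
  forall (J : {fset I}) (B : I -> set S),
    (forall i, measurable (B i)) ->
    P (\bigcap_(i in [set` J]) (Z i @^-1` B i)) =
    \prod_(i <- J) P (Z i @^-1` B i).

Definition sigma_generated_by (Z : nat -> T -> R) : set (set T) :=
  <<s [set A | exists i B, measurable B /\ A = Z i @^-1` B] >>.

Definition independent_sequences3 (X Y Z : nat -> T -> R) : Prop :=
  forall A B C, sigma_generated_by X A -> sigma_generated_by Y B ->
    sigma_generated_by Z C ->
    P (A `&` B `&` C) = P A * P B * P C.

Definition iid_exponential_mean1 (H : nat -> T -> R) : Prop :=
  (forall i B, measurable B -> P (H i @^-1` B) = exponential_prob 1%R B) /\
  mutually_independent H.

End independence.

Section point_process.
Context d (T : measurableType d) (R : realType) (P : probability T R).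

(* A point process on the line is given by a sequence of random points; a
   homogeneous Poisson process on the line almost surely has infinitely many
   points, so that it can be enumerated by the natural numbers. *)
Definition point_count (X : nat -> T -> R) (B : set R) (w : T) : \bar R :=
  \sum_(0 <= i <oo) (\1_B (X i w))%:E.

Definition homogeneous_PPP (rate : R) (X : nat -> T -> R) : Prop :=
  (forall (B : set R) (n : nat), measurable B -> lebesgue_measure B < +oo ->
     let m := (rate * fine (lebesgue_measure B))%R in
     P [set w | point_count X B w = n%:R%:E] =
     (expR (- m) * m ^+ n / n`!%:R)%:E) /\
  (forall (n : nat) (B : 'I_n -> set R), (forall i, measurable (B i)) ->
     trivIset setT B ->
     mutually_independent P (fun i => point_count X (B i))).

(* Expectation conditioned on the stationary process X (of intensity rate)
   having a point at x, i.e. under its Palm distribution: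
     E^x[F] = rate^-1 * E[sum over the points X_k in [0, 1] of F evaluated
                          after translating the process so that X_k sits at x].
   F receives the index k of the point located at x, the translated
   configuration (whose k-th point is x) and the outcome w, through which it
   can depend on random elements independent of X, which are not translated. *)
Definition palm_expectation (rate : R) (X : nat -> T -> R) (x : R)
    (F : nat -> (nat -> R) -> T -> \bar R) : \bar R :=
  (rate^-1)%:E *
  \int[P]_w \sum_(0 <= k <oo)
    ((\1_(`[0%R, 1%R]%classic : set R) (X k w))%:E *
     F k (fun j => X j w - X k w + x)%R w).

(* g(V, V') is a version of the conditional expectation of Z given the event E
   and the [0, +oo]-valued random variables V and V', under the Palm
   distribution at x: Z and g(V, V') have the same integral over
   E /\ {(V, V') in C} for every measurable C. *)
Definition is_palm_cond_expectation (rate : R) (X : nat -> T -> R) (x : R)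
    (Z : nat -> (nat -> R) -> T -> \bar R)
    (E : nat -> (nat -> R) -> T -> Prop)
    (V V' : T -> \bar R) (g : \bar R -> \bar R -> \bar R) : Prop :=
  measurable_fun [set p : \bar R * \bar R | 0 <= p.1 /\ 0 <= p.2]
    (fun p => g p.1 p.2) /\
  forall C : set (\bar R * \bar R), measurable C ->
    palm_expectation rate X x (fun k c w =>
      Z k c w * (\1_[set w' | E k c w' /\ C (V w', V' w')] w)%:E) =
    palm_expectation rate X x (fun k c w =>
      g (V w) (V' w) *
        (\1_[set w' | E k c w' /\ C (V w', V' w')] w)%:E).

End point_process.

Inductive link_type := LoS | NLoS.

Section network.
Context (R : realType).

Definition blockage_dist_pos (b : nat -> R) : \bar R :=
  ereal_inf [set (b j)%:E | j in [set j | (0 < b j)%R]].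

Definition blockage_dist_neg (b : nat -> R) : \bar R :=
  ereal_inf [set (- b j)%:E | j in [set j | (b j < 0)%R]].

Definition bs_type (q q' : \bar R) (y : R) : link_type :=
  if ((0 < y)%R && (y%:E < q)) || ((y < 0)%R && (`|y|%:E < q'))
  then LoS else NLoS.

Definition is_path_loss (l : R -> R) : Prop :=
  [/\ forall y, (0 <= y)%R -> (0 <= l y)%R,
      exists M, forall y, (0 <= y)%R -> (l y <= M)%R &
      forall y z, (0 <= y)%R -> (y <= z)%R -> (l z <= l y)%R].

Context (lL lN : R -> R).

Definition path_loss (t : link_type) : R -> R :=
  match t with LoS => lL | NLoS => lN end.

(* exclusion_radius v t x is e_{v|t}(x); it is +oo when no radius qualifies. *)
Definition exclusion_radius (v t : link_type) (x : R) : \bar R :=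
  match v, t with
  | LoS, LoS | NLoS, NLoS => x%:E
  | _, _ => ereal_inf
      [set y%:E | y in [set y | (0 <= y)%R /\
                                (path_loss v y <= path_loss t x)%R]]
  end.

(* In the next two definitions, k is the index of the BS located at x and c
   lists the locations of all the BSs. *)
Definition serving_event (t : link_type) (x : R) (q q' : \bar R)
    (k : nat) (c : nat -> R) : Prop :=
  bs_type q q' (c k) = t /\
  forall j, j != k ->
    exclusion_radius (bs_type q q' (c j)) t x < `|c j|%:E.

Definition interference (q q' : \bar R) (h : nat -> R)
    (k : nat) (c : nat -> R) : \bar R :=
  \sum_(0 <= j <oo | j != k)
    (h j * path_loss (bs_type q q' (c j)) `|c j|)%:E.

(* 1 / (1 + (s l)^-1), with value 0 when l = 0 *)
Definition laplace_kernel (s l : R) : R :=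
  if l == 0%R then 0%R else ((1 + (s * l)^-1)^-1)%R.

Definition laplace_LoS (lambda s x : R) (q q' : \bar R) : \bar R :=
  expeR (- (lambda%:E * (
    \int[lebesgue_measure]_(y in [set y : R | q < y%:E])
      (laplace_kernel s (lN y))%:E
  + \int[lebesgue_measure]_(y in [set y : R | exclusion_radius NLoS LoS x < y%:E])
      ((q' < y%:E)%E%:R * laplace_kernel s (lN y))%:E
  + \int[lebesgue_measure]_(y in [set y : R | (x < y)%R /\ y%:E < q])
      (laplace_kernel s (lL y))%:E
  + \int[lebesgue_measure]_(y in [set y : R | (x < y)%R])
      ((y%:E < q')%E%:R * laplace_kernel s (lL y))%:E))).

Definition laplace_NLoS (lambda s x : R) (q q' : \bar R) : \bar R :=
  expeR (- (lambda%:E * (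
    \int[lebesgue_measure]_(y in [set y : R | (x < y)%R])
      (laplace_kernel s (lN y))%:E
  + \int[lebesgue_measure]_(y in [set y : R | (x < y)%R])
      ((q' < y%:E)%E%:R * laplace_kernel s (lN y))%:E
  + \int[lebesgue_measure]_(y in [set y : R | exclusion_radius LoS NLoS x < y%:E])
      ((y%:E < q')%E%:R * laplace_kernel s (lL y))%:E))).

End network.

Section conditional_laplace.
Context d (T : measurableType d) (R : realType) (P : probability T R).

(* g is (a version of) (q, q') |-> E[exp (- s I) | BS at x, E_{t,x}, q, q'],
   where X are the BSs, Y the blockages, and H the fading variables. *)
Definition is_cond_laplace_interference (lambda : R) (X Y H : nat -> T -> R)
    (lL lN : R -> R) (t : link_type) (x s : R)
    (g : \bar R -> \bar R -> \bar R) : Prop :=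
  let q w := blockage_dist_pos (fun j => Y j w) in
  let q' w := blockage_dist_neg (fun j => Y j w) in
  is_palm_cond_expectation P lambda X x
    (fun k c w =>
       expeR (- (s%:E * interference lL lN (q w) (q' w) (fun j => H j w) k c)))
    (fun k c w => serving_event lL lN t x (q w) (q' w) k c)
    q q' g.

End conditional_laplace.

(* Main.v *)
(** By the Mecke formula, the Palm expectation of
    [exp (- sum_(j != k) phi (X_j - X_k + x))] over the points [X_k] of [0, 1]
    is [lambda exp (- lambda \int (1 - exp (- phi)))].  For kernels constant on
    the cells of a grid this is a direct computation with independent Poisson
    counts.  Both sides are Lipschitz in the kernel for the L1 distance, because
    the second factorial moment measure of the process is [lambda^2] times the
    area; this extends the formula to continuous, then bounded measurable
    kernels, and monotone limits reach the [0, +oo]-valued ones.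
    By independence one may fix the blockages and integrate out the fading
    first, which turns each interferer at [y] into the factor [1 / (1 + s l(y))].
    The serving event says that no other point lies in the exclusion zone, that
    is, it multiplies each point there by [exp (- oo)].  Hence the Laplace
    transform on the serving event and the probability of that event are two
    instances of the formula above, with exponents equal outside the exclusion
    zone to [ln (1 + s l)] and [0], and their quotient is the claimed
    exponential. *)
Require Import Defs.
From HB Require Import structures.
From mathcomp Require Import all_boot all_order all_algebra finmap.
From mathcomp Require Import all_classical all_reals all_analysis measurable_realfun.
From mathcomp Require Import ring lra.
Set Implicit Arguments.
Unset Strict Implicit.
Unset Printing Implicit Defensive.
Import Order.TTheory GRing.Theory Num.Theory.
Import numFieldNormedType.Exports.
Local Open Scope classical_set_scope.
Local Open Scope ring_scope.
Local Open Scope ereal_scope.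

(** * Extended exponential, series and integrals *)

(** [homogeneous_PPP] speaks only of counts in fixed sets, whereas the Palm expectation re-centres
    the configuration at each of its own points, so that the kernel seen by the other points moves
    with a random tagged point. A grid kernel sees the tagged point only through its cell, which
    brings everything back to counts. The tagged point would then be counted in its own cell; the
    step kernels therefore vanish on diagonal cells. Shrinking these cells costs nothing in the
    limit: the second factorial moment measure has a density, so it does not charge the diagonal,
    and the same fact takes care of points with distinct indices and equal positions. The L1 bounds
    need finite area, so kernels are cut to a window [[-K, K)] which only the last monotone limit
    removes. Conditioning is tested by integrals over sets of pairs [(q, q')]. The last step is thus
    an identity between products for each fixed pair, without any division, and it keeps its meaning
    where the serving event has probability zero. *)

Section expeR_complements.
Context {R : realType}.
Implicit Types a b e : \bar R.

Lemma expeRN_le1 a : 0 <= a -> expeR (- a) <= 1.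
Proof. by move=> a0; rewrite -expeR0 lee_expeR oppe_le0. Qed.

(** From [exp (- a) >= exp (- b) exp (- e) >= exp (- b) (1 - e)] and [exp (- b) <= 1]. The one-sided
    form with an explicit error [e] makes sense when [a] and [b] are both infinite. *)
Lemma expeRN_lipschitz a b e : 0 <= a -> 0 <= b -> 0 <= e ->
  a <= b + e -> expeR (- b) <= expeR (- a) + e.
Proof.
move=> + + + abe; move: abe.
case: b => [b| |]//; last by move=> _ _ _ ? /=; rewrite adde_ge0 ?expeR_ge0.
case: e => [e| |]//; last first.
  by move=> _ _ _ _ /=; rewrite addey ?leey// -ltNye (lt_le_trans _ (expeR_ge0 _)).
case: a => [a| |]//=; rewrite !lee_fin => abe a0 b0 e0.
have h1 : (expR (- b) * expR (- e) <= expR (- a))%R.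
  by rewrite -expRD ler_expR; lra.
have h2 : (1 - e <= expR (- e))%R by have := expR_ge1Dx (- e)%R.
have h3 : (expR (- b) <= 1)%R by rewrite -expR0 ler_expR; lra.
have := expR_gt0 (- b)%R; nra.
Qed.

Lemma measurable_expeR : measurable_fun [set: \bar R] expeR.
Proof.
apply: (measurability (@ErealGenInftyO.G R)) => [|/= _ [_] [r] -> <-].
  exact: ErealGenInftyO.measurableE.
rewrite setTI.
have [r0|r0] := ltP 0%R r; last first.
  rewrite (_ : _ @^-1` _ = set0)//; apply/seteqP; split => // x /=.
  by rewrite in_itv/= ltNge (le_trans _ (expeR_ge0 _))// lee_fin.
have -> : r%:E = expeR (ln r)%:E by rewrite /= lnK.
rewrite (_ : _ @^-1` _ = `]-oo, (ln r)%:E[%classic); first exact: emeasurable_itv.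
by apply/funext => x; rewrite /preimage /= !in_itv/= -(lte_expeR x (ln r)%:E).
Qed.

(** The limit [+oo] is included on purpose: truncated kernels increase to [+oo] on the exclusion
    zone. *)
Lemma cvg_expeRN (u : nat -> \bar R) (l : \bar R) : 0 <= l ->
  u @ \oo --> l -> expeR (- u n) @[n --> \oo] --> expeR (- l).
Proof.
move=> l0 ul; case: l l0 ul => [l| |]//= _.
  move=> /fine_cvgP[fu ul].
  apply/fine_cvgP; split.
    by apply: filterS fu => n; case: (u n).
  have : (expR (- fine (u n)))%R @[n --> \oo] --> expR (- l)%R.
    apply: continuous_cvg; first exact: continuous_expR.
    exact: cvgN.
  apply: cvg_trans; apply: near_eq_cvg.
  by apply: filterS fu => n; rewrite /=; case: (u n).
move=> /cvgeyPge uy; apply/fine_cvgP; split.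
  by apply: filterS (uy 0%R) => n; case: (u n).
apply/cvgrPdist_le => /= e e0.
apply: filterS (uy (- ln e)%R) => n; rewrite sub0r normrN.
case: (u n) => [r| |]//=; last by rewrite normr0 => _; exact: ltW.
rewrite lee_fin => er; rewrite ger0_norm ?expR_ge0//.
by rewrite -[leRHS]lnK// ler_expR; lra.
Qed.

End expeR_complements.

Section nneseries_complements.
Context {R : realType}.

Lemma nneseries_expR (y : R) : (0 <= y)%R ->
  \sum_(0 <= n <oo) (y ^+ n / n`!%:R)%:E = (expR y)%:E.
Proof.
move=> y0; apply/cvg_lim => //.
rewrite (_ : (fun n => _) = EFin \o series (exp_coeff y)); last first.
  by apply/funext => n /=; rewrite sumEFin.
apply: cvg_EFin; last exact: is_cvg_series_exp_coeff.
by apply: nearW.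
Qed.

(** Monotone convergence for the counting measure, the terms outside [P] being replaced by 0. *)
Lemma nneseries_monotone_cvg (f : nat -> nat -> \bar R) (g : nat -> \bar R) (P : pred nat) :
  (forall n k, 0 <= f n k) -> (forall k, {homo f^~ k : m n / (m <= n)%N >-> m <= n}) ->
  (forall k, f n k @[n --> \oo] --> g k) ->
  \sum_(0 <= k <oo | P k) f n k @[n --> \oo] --> \sum_(0 <= k <oo | P k) g k.
Proof.
move=> f0 ndf fg.
have g0 k : 0 <= g k.
  by rewrite -(cvg_lim _ (fg k))//; apply: lime_ge; [exact: cvgP (fg k)|exact: nearW].
pose f' n k := if P k then f n k else 0.
pose g' k := if P k then g k else 0.
rewrite (_ : (fun n => _) = fun n => \int[counting]_k f' n k); last first.
  apply/funext => n; rewrite ge0_integral_count// ?eseries_mkcond//.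
  by move=> k; rewrite /f'; case: ifP.
rewrite [X in _ --> X](_ : _ = \int[counting]_k g' k); last first.
  rewrite ge0_integral_count// ?eseries_mkcond//.
  by move=> k; rewrite /g'; case: ifP.
rewrite [X in integral _ _ X](_ : _ = fun k => limn (f'^~ k)); last first.
  apply/funext => k; rewrite /g' /f'; case: ifP => _; last by rewrite lim_cst.
  by rewrite (cvg_lim _ (fg k)).
apply: cvg_monotone_convergence => //.
- by move=> n k _; rewrite /f'; case: ifP.
- by move=> k _ m n mn; rewrite /f'; case: ifP => // _; exact: ndf.
Qed.

(** Reading the series as an integral against the counting measure admits the factor [c = +oo]. *)
Lemma nneseriesMl (f : nat -> \bar R) (P : pred nat) (c : \bar R) :
  0 <= c -> (forall k, 0 <= f k) ->
  \sum_(0 <= k <oo | P k) (c * f k) = c * \sum_(0 <= k <oo | P k) f k.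
Proof.
move=> c0 f0; rewrite eseries_mkcond [in RHS]eseries_mkcond.
have g0 k : 0 <= if P k then f k else 0 by case: (P k).
rewrite -(ge0_integral_count g0) -ge0_integralZl// ge0_integral_count; last first.
  by move=> k; rewrite mule_ge0.
by apply: eq_eseriesr => k _; case: (P k); rewrite ?mule0.
Qed.

(** Up to the factor [exp (- y)], this is the identity [E[N g(N)] = y E[g(N + 1)]] for a Poisson
    variable [N] of mean [y]; applied repeatedly it gives the moments. *)
Lemma nneseries_factorial_shift (g : nat -> R) (y : R) : (0 <= y)%R ->
  (forall n, 0 <= g n)%R ->
  \sum_(0 <= n <oo) (n%:R * g n * (y ^+ n / n`!%:R))%:E =
  y%:E * \sum_(0 <= n <oo) (g n.+1 * (y ^+ n / n`!%:R))%:E.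
Proof.
move=> y0 g0.
have t0 n : (0 <= y ^+ n / n`!%:R)%R by rewrite divr_ge0// exprn_ge0.
rewrite nneseries_recl//; last first.
  by move=> k _; rewrite lee_fin mulr_ge0// mulr_ge0.
rewrite !mul0r add0e -nneseries_addn; last first.
  by move=> k; rewrite lee_fin mulr_ge0// mulr_ge0.
rewrite -nneseriesZl; last by move=> k _; rewrite lee_fin mulr_ge0.
apply: eq_eseriesr => k _; rewrite addn1 -EFinM; congr EFin.
rewrite factS exprS natrM; field.
by rewrite pnatr_eq0 -lt0n fact_gt0/= addrC natr1 pnatr_eq0.
Qed.

(** Multiplication is discontinuous at [(0, +oo)]. Monotonicity saves the case [c = +oo]: either [u]
    is identically 0, or it is eventually positive and the products are eventually [+oo]. *)
Lemma nondecreasing_cvgeMr (u : nat -> \bar R) (l c : \bar R) :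
  (forall n, 0 <= u n) -> {homo u : m n / (m <= n)%N >-> m <= n} -> 0 <= c ->
  u @ \oo --> l -> u n * c @[n --> \oo] --> l * c.
Proof.
move=> u0 ndu c0 ul.
have ule n : u n <= l.
  by rewrite -(cvg_lim _ ul)//; apply: lime_ge; [exact: cvgP ul|exists n => // m; exact: ndu].
case: c c0 => [c| |]// c0; first exact: cvgeZr.
have [l0|l0] := eqVneq l 0.
  have -> : u = fun=> 0 by apply/funext => n; apply/eqP; rewrite eq_le u0 -l0 ule.
  by rewrite l0; exact: cvg_cst.
have [n un0] : exists n, 0 < u n.
  apply: contrapT => /forallNP un; move/eqP: l0; apply.
  apply: (cvg_unique _ ul) => //.
  suff -> : u = fun=> 0 by exact: cvg_cst.
  apply/funext => n; apply/eqP; rewrite eq_le u0 andbT leNgt; apply/negP/un.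
rewrite gt0_muley; last by rewrite lt0e l0 (le_trans (u0 0%N)).
apply: cvg_near_cst; exists n => // m /= nm; rewrite gt0_muley//.
exact: lt_le_trans (ndu _ _ nm).
Qed.

End nneseries_complements.

Section integral_complements.
Context d (T : measurableType d) {R : realType} (mu : {measure set T -> \bar R}).

Import HBNNSimple.

(** The integral of a nonnegative function is a supremum over the simple functions below it. Cutting
    such a function to the complement of [N] keeps its integral and brings it below [g]. *)
Lemma ge0_le_integral_off_null (N : set T) (f g : T -> \bar R) :
  measurable N -> mu N = 0 -> (forall w, 0 <= f w) -> (forall w, 0 <= g w) ->
  (forall w, ~ N w -> f w <= g w) -> \int[mu]_w f w <= \int[mu]_w g w.
Proof.
move=> mN N0 f0 g0 fg; rewrite !ge0_integralTE//.
apply: ge_ereal_sup => _ [h /= hf <-].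
have mNC : measurable (~` N) by exact: measurableC.
apply: ereal_sup_ubound; exists (proj_nnsfun h mNC) => /=.
  move=> w; rewrite mindicE; case: (pselect (N w)) => Nw.
    by rewrite memNset ?mulr0// => /(_ Nw).
  by rewrite mem_set// mulr1 (le_trans (hf w))// fg.
rewrite -[RHS]integralT_nnsfun (ge0_negligible_integral mN)//; last first.
- by move=> w _; rewrite lee_fin.
- exact/measurable_EFinP.
by rewrite setTD integral_nnsfun// mrestrict.
Qed.

Lemma ge0_eq_integral_off_null (N : set T) (f g : T -> \bar R) :
  measurable N -> mu N = 0 -> (forall w, 0 <= f w) -> (forall w, 0 <= g w) ->
  (forall w, ~ N w -> f w = g w) -> \int[mu]_w f w = \int[mu]_w g w.
Proof.
move=> mN N0 f0 g0 fg; apply/eqP; rewrite eq_le; apply/andP; split.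
  by apply: (ge0_le_integral_off_null mN) => // w /fg ->.
by apply: (ge0_le_integral_off_null mN) => // w /fg ->.
Qed.

(** An identity for indicators passes to simple functions by linearity and to [f] by monotone
    convergence. It serves both independence, with [g] the product of the remaining factors, and
    laws with a density, with [phi] the identity and [g] the density. *)
Lemma ge0_integral_weighted d' (S : measurableType d') (nu : {measure set S -> \bar R})
    (phi : T -> S) (g : T -> \bar R) (c : \bar R) (f : S -> \bar R) :
  measurable_fun setT phi -> measurable_fun setT g -> (forall w, 0 <= g w) -> 0 <= c ->
  (forall C, measurable C -> \int[mu]_w ((\1_C (phi w))%:E * g w) = nu C * c) ->
  measurable_fun setT f -> (forall y, 0 <= f y) ->
  \int[mu]_w (f (phi w) * g w) = (\int[nu]_y f y) * c.
Proof.
move=> mphi mg g0 c0 H mf f0.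
pose h := nnsfun_approx measurableT mf.
have cvh y : (h n y)%:E @[n --> \oo] --> f y by apply: cvg_nnsfun_approx.
have ndh y : {homo (fun n => (h n y)%:E) : m n / (m <= n)%N >-> m <= n}.
  by move=> m n mn; rewrite lee_fin; exact/lefP/nd_nnsfun_approx.
have mh n : measurable_fun setT (fun w => (h n (phi w))%:E).
  exact/measurable_EFinP/measurableT_comp.
transitivity (limn (fun n => \int[mu]_w ((h n (phi w))%:E * g w))).
  rewrite -monotone_convergence//.
  - apply: eq_integral => w _; apply/esym/cvg_lim => //.
    apply: (@nondecreasing_cvgeMr _ (fun n => (h n (phi w))%:E)) => //.
    by move=> n; rewrite lee_fin.
  - by move=> n; exact: emeasurable_funM.
  - by move=> n w _; rewrite mule_ge0// lee_fin.
  - by move=> w _ m n mn; rewrite lee_wpmul2r// ndh.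
rewrite (_ : \int[nu]_y f y = limn (fun n => \int[nu]_y (h n y)%:E)); last first.
  rewrite -monotone_convergence//.
  - by apply: eq_integral => w _; apply/esym/cvg_lim.
  - by move=> n; exact/measurable_EFinP.
  - by move=> n w _; rewrite lee_fin.
have ndI : {homo (fun n => \int[nu]_y (h n y)%:E) : m n / (m <= n)%N >-> m <= n}.
  move=> m n mn; apply: ge0_le_integral => //.
  - by move=> w _; rewrite lee_fin.
  - exact/measurable_EFinP.
  - exact/measurable_EFinP.
  - by move=> w _; exact: ndh.
have I0 n : 0 <= \int[nu]_y (h n y)%:E by apply: integral_ge0 => w _; rewrite lee_fin.
apply/cvg_lim => //; rewrite [X in X @ _ --> _](_ : _ =
    fun n => \int[nu]_y (h n y)%:E * c).
  by apply: nondecreasing_cvgeMr => //; exact: ereal_nondecreasing_is_cvgn.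
apply/funext => n.
have mk k : measurable (h n @^-1` [set k]) by exact: measurable_funPTI.
have nn k y : 0 <= (k * \1_(h n @^-1` [set k]) y)%:E.
  by rewrite EFinM; exact: nnfun_muleindic_ge0.
have mi k : measurable_fun setT (fun y => (k * \1_(h n @^-1` [set k]) y)%:E).
  by apply/measurable_EFinP/measurable_funM => //; exact: measurable_indic.
have miphi k : measurable_fun setT (fun w => (k * \1_(h n @^-1` [set k]) (phi w))%:E).
  by exact: (measurableT_comp (mi k)).
under eq_integral.
  move=> w _; rewrite fimfunE -fsumEFin// ge0_mule_fsuml//.
  over.
rewrite [LHS]ge0_integral_fsum//; last 2 first.
- by move=> k; apply: emeasurable_funM.
- by move=> k w _; rewrite mule_ge0//.
under [X in _ = X * c]eq_integral do rewrite fimfunE -fsumEFin//.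
rewrite [X in _ = X * c]ge0_integral_fsum// ge0_mule_fsuml; last first.
  by move=> k; apply: integral_ge0.
apply: eq_fsbigr => k /[!inE] -[y _ ky].
have k0 : (0 <= k)%R by rewrite -ky.
under eq_integral do rewrite EFinM -muleA.
rewrite ge0_integralZl//; last 2 first.
- by apply: emeasurable_funM => //; apply/measurable_EFinP/measurableT_comp => //; exact: measurable_indic.
- by move=> w _; rewrite mule_ge0// lee_fin.
rewrite H// integralZl_indic_nnsfun// integral_indic// setIT muleA//.
Qed.

End integral_complements.

(** * Moments of Poisson counts *)

Section independence.
Context d (T : measurableType d) (R : realType) (P : probability T R).
Context d' (S : measurableType d') (I : choiceType) (Z : I -> T -> S).
Hypothesis mZ : forall i, measurable_fun setT (Z i).
Hypothesis indZ : mutually_independent P Z.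

Lemma emeasurable_prod (J : seq I) (h : I -> T -> \bar R) :
  (forall i, measurable_fun setT (h i)) ->
  measurable_fun setT (fun w => \prod_(i <- J) h i w).
Proof.
move=> mh; elim: J => [|i J IH]; first by under eq_fun do (rewrite big_nil); exact: measurable_cst.
by under eq_fun do rewrite big_cons; exact: emeasurable_funM.
Qed.

Lemma prode_ge0_seq (J : seq I) (h : I -> \bar R) :
  (forall i, 0 <= h i) -> 0 <= \prod_(i <- J) h i.
Proof. by move=> h0; elim/big_ind : _ => // x y; exact: mule_ge0. Qed.

(** The indices of [J1] carry functions, those of [J2] only indicators. The induction on [J1] trades
    one function for an indicator at a time by [ge0_integral_weighted], until the definition of
    independence applies. *)
Let expectation_prod_indic (J1 J2 : seq I) (f : I -> S -> \bar R) (B : I -> set S) :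
  uniq (J1 ++ J2) -> (forall i, measurable_fun setT (f i)) -> (forall i y, 0 <= f i y) ->
  (forall i, measurable (B i)) ->
  \int[P]_w ((\prod_(i <- J1) f i (Z i w)) * \prod_(i <- J2) (\1_(B i) (Z i w))%:E) =
  (\prod_(i <- J1) \int[P]_w f i (Z i w)) * \prod_(i <- J2) P (Z i @^-1` B i).
Proof.
elim: J1 J2 B => [|i J1 IH] J2 B.
  move=> uJ mf f0 mB; rewrite big_nil mul1e.
  under eq_integral do rewrite big_nil mul1e.
  have pJ : perm_eq [fset j in J2]%fset J2.
    by apply: uniq_perm => // j; rewrite !inE.
  rewrite -(perm_big _ pJ)/= -indZ//.
  have mI : measurable (\bigcap_(j in [set` [fset j in J2]%fset]) Z j @^-1` B j).
    apply: fin_bigcap_measurable => // j _.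
    by rewrite -[X in measurable X]setTI; exact: mZ.
  rewrite -[X in P X]setIT -integral_indic//; apply: eq_integral => w _.
  rewrite [in RHS]indicE; have [/set_mem wI|/negP wI] := boolP (w \in _).
    rewrite big_seq big1// => j jJ; rewrite indicE mem_set//.
    by apply: wI; rewrite /= !inE.
  have [j jJ Bj] : exists2 j, j \in J2 & ~ B j (Z j w).
    apply: contrapT => h; apply: wI; apply/mem_set => j /=; rewrite !inE => jJ.
    by apply: contrapT => Bj; apply: h; exists j.
  by rewrite (big_rem j)//= indicE memNset// mul0e.
rewrite cat_cons => uJ mf f0 mB; rewrite !big_cons.
have miZ j D : measurable D -> measurable_fun setT (fun w => (\1_D (Z j w) : R)%:E).
  by move=> mD; apply/measurable_EFinP/measurableT_comp => //; exact: measurable_indic.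
have mfZ j : measurable_fun setT (fun w => f j (Z j w)) by exact: measurableT_comp.
under eq_integral do rewrite big_cons -muleA.
have -> : \int[P]_w f i (Z i w) = \int[pushforward P (Z i)]_y f i y.
  by rewrite ge0_integral_pushforward//.
rewrite -muleA.
apply: ge0_integral_weighted => //.
- apply: emeasurable_funM; first exact: (@emeasurable_prod J1 (fun j w => f j (Z j w))).
  by apply: (@emeasurable_prod J2 (fun j w => (\1_(B j) (Z j w))%:E)) => j; exact: miZ.
- by move=> w; rewrite mule_ge0// prode_ge0_seq// => j; rewrite lee_fin.
- rewrite mule_ge0//; apply: prode_ge0_seq => // j.
  by apply: integral_ge0 => w _.
move=> C mC.
(* The test set [C] becomes the indicator at [i]. Since [i] does not occur in [J2], the other
   indicators are unchanged. *)
pose B' j := if j == i then C else B j.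
have iJ : i \notin J2 by move: uJ => /= /andP[]; rewrite mem_cat negb_or => /andP[].
have B'E (F : I -> set S -> \bar R) : \prod_(j <- J2) F j (B j) = \prod_(j <- J2) F j (B' j).
  rewrite big_seq [RHS]big_seq; apply: eq_bigr => j jJ; rewrite /B' ifN//.
  by apply: contraNneq iJ => <-.
transitivity (\int[P]_w ((\prod_(j <- J1) f j (Z j w)) *
    \prod_(j <- i :: J2) (\1_(B' j) (Z j w))%:E)).
  apply: eq_integral => w _; rewrite big_cons /B' eqxx muleCA; congr (_ * _).
  by rewrite (B'E (fun j D => (\1_D (Z j w))%:E)).
rewrite IH//; last 2 first.
- by rewrite -(cat1s i J2) uniq_catCA.
- by move=> j; rewrite /B'; case: ifP.
rewrite big_cons {1}/B' eqxx muleCA; congr (_ * (_ * _)).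
by rewrite (B'E (fun j D => P (Z j @^-1` D))).
Qed.

Lemma expectation_prod (J : seq I) (f : I -> S -> \bar R) :
  uniq J -> (forall i, measurable_fun setT (f i)) -> (forall i y, 0 <= f i y) ->
  \int[P]_w (\prod_(i <- J) f i (Z i w)) = \prod_(i <- J) \int[P]_w f i (Z i w).
Proof.
move=> uJ mf f0.
have := @expectation_prod_indic J [::] f (fun=> setT).
rewrite cats0 big_nil mule1 => <-//.
by apply: eq_integral => w _; rewrite big_nil mule1.
Qed.

End independence.

Section discrete_law.
Context d (T : measurableType d) (R : realType) (P : probability T R).

(** The weights sum to one, so [N] avoids all values other than natural numbers, in particular
    [+oo], outside a null set. *)
Lemma integral_discrete (N : T -> \bar R) (p : nat -> R) (f : \bar R -> \bar R) :
  measurable_fun setT N -> (forall n, 0 <= p n)%R ->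
  (forall n, P [set w | N w = n%:R%:E] = (p n)%:E) -> \sum_(0 <= n <oo) (p n)%:E = 1 ->
  measurable_fun setT f -> (forall a, 0 <= f a) ->
  \int[P]_w f (N w) = \sum_(0 <= n <oo) (f n%:R%:E * (p n)%:E).
Proof.
move=> mN p0 Pp p1 mf f0.
pose A n := [set w | N w = n%:R%:E].
have mA n : measurable (A n).
  by rewrite -[A n]setTI; exact: (mN measurableT [set n%:R%:E]).
have tA : trivIset setT A.
  apply/trivIsetP => i j _ _ ij; apply/seteqP; split => // w [/=].
  by rewrite /A/= => -> [] /eqP; rewrite eqr_nat (negbTE ij).
have mU : measurable (\bigcup_n A n) by exact: bigcupT_measurable.
have PU : P (\bigcup_n A n) = 1.
  rewrite measure_bigcup//= eseries_mkcond -p1; apply: eq_eseriesr => n _.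
  by rewrite in_setT Pp.  
have PC : P (~` \bigcup_n A n) = 0.
  by rewrite probability_setC// PU subee.
have mfN : measurable_fun setT (f \o N) by exact: measurableT_comp.
rewrite (ge0_negligible_integral (measurableC mU))//.
rewrite setTD setCK ge0_integral_bigcup//; last exact: measurable_funTS.
apply: eq_eseriesr => n _.
rewrite (eq_integral (fun=> f n%:R%:E)) => [|w /[!inE] ->//].
by rewrite -Pp; exact: (integral_cst P (mA n)).
Qed.


Variables (N : T -> \bar R) (m : R).
Hypotheses (mN : measurable_fun setT N) (N0 : forall w, 0 <= N w) (m0 : (0 <= m)%R).
Hypothesis poissonN : forall n, P [set w | N w = n%:R%:E] = (expR (- m) * m ^+ n / n`!%:R)%:E.

Let integral_poisson (f : \bar R -> \bar R) :
  measurable_fun setT f -> (forall a, 0 <= f a) ->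
  \int[P]_w f (N w) =
  (expR (- m))%:E * \sum_(0 <= n <oo) (f n%:R%:E * (m ^+ n / n`!%:R)%:E).
Proof.
move=> mf f0.
have t0 n : (0 <= m ^+ n / n`!%:R)%R by rewrite divr_ge0// exprn_ge0.
rewrite (@integral_discrete _ (fun n => expR (- m) * m ^+ n / n`!%:R)%R)//.
- rewrite -nneseriesZl; last by move=> n _; rewrite mule_ge0// lee_fin.
  by apply: eq_eseriesr => n _; rewrite muleCA -EFinM mulrA.
- by move=> n; rewrite -mulrA mulr_ge0// expR_ge0.
under eq_eseriesr do rewrite -mulrA EFinM.
rewrite nneseriesZl; last by move=> n _; rewrite lee_fin.
by rewrite nneseries_expR// -EFinM -expRD addNr expR0.
Qed.

Lemma expectation_poisson : \int[P]_w N w = m%:E.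
Proof.
(* [integral_poisson] wants a function that is nonnegative on the whole of [\bar R], which the
   absolute value provides. *)
transitivity (\int[P]_w `|N w|); first by apply: eq_integral => w _; rewrite gee0_abs.
rewrite integral_poisson//.
have h n : `|n%:R%:E| * (m ^+ n / n`!%:R)%:E = (n%:R * 1 * (m ^+ n / n`!%:R))%:E :> \bar R.
  by rewrite mulr1 EFinM gee0_abs// lee_fin.
under eq_eseriesr do rewrite h.
rewrite (@nneseries_factorial_shift _ (fun=> 1%R))//.
under eq_eseriesr do rewrite mul1r.
by rewrite nneseries_expR// -!EFinM mulrCA -expRD addNr expR0 mulr1.
Qed.

Lemma expectation_poisson_sqr : \int[P]_w (N w * N w) = (m ^+ 2 + m)%:E.
Proof.
transitivity (\int[P]_w (`|N w| * `|N w|)).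
  by apply: eq_integral => w _; rewrite gee0_abs.
rewrite (@integral_poisson (fun a => `|a| * `|a|)); last 2 first.
- exact: emeasurable_funM.
- by move=> a; rewrite mule_ge0.
have h n : `|n%:R%:E| * `|n%:R%:E| * (m ^+ n / n`!%:R)%:E =
    (n%:R * n%:R * (m ^+ n / n`!%:R))%:E :> \bar R.
  by rewrite !EFinM gee0_abs// lee_fin.
under eq_eseriesr do rewrite h.
have t0 n : (0 <= m ^+ n / n`!%:R)%R by rewrite divr_ge0// exprn_ge0.
rewrite nneseries_factorial_shift//.
have h' n : (n.+1%:R * (m ^+ n / n`!%:R))%:E =
    (n%:R * 1 * (m ^+ n / n`!%:R))%:E + (m ^+ n / n`!%:R)%:E :> \bar R.
  by rewrite -EFinD -natr1; congr EFin; ring.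
under eq_eseriesr do rewrite h'.
rewrite nneseriesD; last 2 first.
- by move=> n _ _; rewrite lee_fin mulr_ge0// mulr1.
- by move=> n _ _; rewrite lee_fin.
rewrite (@nneseries_factorial_shift _ (fun=> 1%R))//.
under eq_eseriesr do rewrite mul1r.
rewrite nneseries_expR// -(EFinM m (expR m)) -EFinD -(EFinM m) -EFinM; congr EFin.
rewrite (_ : _ * _ = expR (- m) * expR m * (m ^+ 2 + m))%R; last by ring.
by rewrite -expRD addNr expR0 mul1r.
Qed.

Lemma laplace_poisson (a : R) : (0 <= a)%R ->
  \int[P]_w expeR (- (a%:E * N w)) = (expR (- (m * (1 - expR (- a)))))%:E.
Proof.
move=> a0.
transitivity (\int[P]_w expeR (- (a%:E * `|N w|))).
  by apply: eq_integral => w _; rewrite gee0_abs.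
rewrite (@integral_poisson (fun b => expeR (- (a%:E * `|b|)))); last 2 first.
- apply: measurableT_comp; first exact: measurable_expeR.
  by apply: measurableT_comp => //; exact: measurable_funeM.
- by move=> b; exact: expeR_ge0.
have h n : expeR (- (a%:E * `|n%:R%:E|)) * (m ^+ n / n`!%:R)%:E =
    ((m * expR (- a)) ^+ n / n`!%:R)%:E :> \bar R.
  rewrite gee0_abs ?lee_fin//= -EFinM; congr EFin.
  by rewrite exprMn -expRM_natl mulrN mulrC [(a * _)%R]mulrC mulrAC.
under eq_eseriesr do rewrite h.
rewrite nneseries_expR; last by rewrite mulr_ge0// expR_ge0.
by rewrite -EFinM -expRD; congr (expR _)%:E; ring.
Qed.

End discrete_law.

Section poisson_counts.
Context d (T : measurableType d) (R : realType) (P : probability T R).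
Variables (lambda : R) (X : nat -> {RV P >-> R}).
Hypotheses (lambda_gt0 : (0 < lambda)%R) (PPP_X : homogeneous_PPP P lambda X).

Local Notation leb := (@lebesgue_measure R).
Local Notation N B := (point_count X B).

Lemma measurable_RV_indic (B : set R) k : measurable B ->
  measurable_fun setT (fun w => (\1_B (X k w) : R)%:E).
Proof.
move=> mB; apply/measurable_EFinP/measurableT_comp => //; exact: measurable_indic.
Qed.

Lemma measurable_point_count (B : set R) : measurable B -> measurable_fun setT (N B).
Proof.
move=> mB; apply: ge0_emeasurable_sum => [k w _ _|k _]; first by rewrite lee_fin.
exact: measurable_RV_indic.
Qed.

Lemma point_count_ge0 (B : set R) w : 0 <= N B w.
Proof. by apply: nneseries_ge0 => k _ _; rewrite lee_fin. Qed.

Lemma point_countU (A B : set R) w : A `&` B = set0 ->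
  N (A `|` B) w = N A w + N B w.
Proof.
move=> AB; rewrite /point_count -nneseriesD => [|k _ _|k _ _]; rewrite ?lee_fin//.
apply: eq_eseriesr => k _; rewrite -EFinD; congr EFin.
rewrite !indicE in_setU; have [/set_mem XA|_]//= := boolP (_ \in A); last by rewrite add0r.
by rewrite memNset ?addr0// => XB; have : (A `&` B) (X k w) by []; rewrite AB.
Qed.

Let mean B : R := (lambda * fine (leb B))%R.

Let mean_ge0 B : (0 <= mean B)%R.
Proof. exact: mulr_ge0 (ltW lambda_gt0) (fine_ge0 (measure_ge0 _ _)). Qed.

Let meanE B : leb B < +oo -> (mean B)%:E = lambda%:E * leb B.
Proof. by move=> Boo; rewrite EFinM fineK// ge0_fin_numE. Qed.

Lemma expectation_point_count (B : set R) : measurable B -> leb B < +oo ->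
  \int[P]_w N B w = lambda%:E * leb B.
Proof.
move=> mB Boo; rewrite -meanE//; apply: expectation_poisson => //.
- exact: measurable_point_count.
- exact: point_count_ge0.
- by move=> n; exact: (PPP_X.1 _ n mB Boo).
Qed.

Lemma expectation_point_count_sqr (B : set R) : measurable B -> leb B < +oo ->
  \int[P]_w (N B w * N B w) = (mean B ^+ 2 + mean B)%:E.
Proof.
move=> mB Boo; apply: expectation_poisson_sqr => //.
- exact: measurable_point_count.
- exact: point_count_ge0.
- by move=> n; exact: (PPP_X.1 _ n mB Boo).
Qed.

Lemma laplace_point_count (B : set R) (a : R) : measurable B -> leb B < +oo -> (0 <= a)%R ->
  \int[P]_w expeR (- (a%:E * N B w)) = (expR (- (mean B * (1 - expR (- a)))))%:E.
Proof.
move=> mB Boo; apply: laplace_poisson => //.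
- exact: measurable_point_count.
- exact: point_count_ge0.
- by move=> n; exact: (PPP_X.1 _ n mB Boo).
Qed.

Lemma expectation_prod_point_count n (B : 'I_n -> set R) (f : 'I_n -> \bar R -> \bar R) :
  (forall i, measurable (B i)) -> trivIset setT B ->
  (forall i, measurable_fun setT (f i)) -> (forall i a, 0 <= f i a) ->
  \int[P]_w (\prod_(i < n) f i (N (B i) w)) = \prod_(i < n) \int[P]_w f i (N (B i) w).
Proof.
move=> mB tB mf f0.
apply: (@expectation_prod _ _ _ P _ _ _ (fun i => N (B i))) => //.
- by move=> i; exact: measurable_point_count.
- exact: PPP_X.2.
- exact: index_enum_uniq.
Qed.

Lemma expectation_mul_point_count_disjoint (A B : set R) :
  measurable A -> measurable B -> A `&` B = set0 ->
  \int[P]_w (N A w * N B w) = (\int[P]_w N A w) * \int[P]_w N B w.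
Proof.
move=> mA mB AB.
pose D (i : 'I_2) := if i == ord0 then A else B.
have mD i : measurable (D i) by rewrite /D; case: ifP.
have tD : trivIset setT D.
  apply/trivIsetP => i j _ _; rewrite /D.
  case: (unliftP ord0 i) => [i' ->|->]; case: (unliftP ord0 j) => [j' ->|->] //=.
  - by rewrite !ord1.
  - by rewrite setIC.
have := @expectation_prod_point_count 2 D (fun=> abse) mD tD.
rewrite !big_ord_recl big_ord0 mule1 /D/=.
under eq_integral do rewrite !big_ord_recl big_ord0 mule1 /D/=.
under eq_integral do rewrite !gee0_abs ?point_count_ge0//.
have absN C : \int[P]_w `|N C w| = \int[P]_w N C w.
  by apply: eq_integral => w _; rewrite gee0_abs ?point_count_ge0.
by rewrite !absN; apply.
Qed.

(** Split [A] and [B] along [C = A \cap B]. Counts of disjoint pieces are independent, so their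
    products give products of means; only the square of the count of [C] has the additional term
    [lambda |C|], from the Poisson second moment [m^2 + m]. *)
Lemma expectation_mul_point_count (A B : set R) : measurable A -> measurable B ->
  leb A < +oo -> leb B < +oo ->
  \int[P]_w (N A w * N B w) = (lambda ^+ 2)%:E * (leb A * leb B) + lambda%:E * leb (A `&` B).
Proof.
move=> mA mB Aoo Boo.
pose C := A `&` B; pose A' := A `\` B; pose B' := B `\` A.
have mC : measurable C by exact: measurableI.
have mA' : measurable A' by exact: measurableD.
have mB' : measurable B' by exact: measurableD.
have sub_oo (D E : set R) : measurable D -> measurable E -> D `<=` E -> leb E < +oo -> leb D < +oo.
  by move=> mD mE DE; apply: le_lt_trans; rewrite le_measure// inE.
have Coo : leb C < +oo by apply: (sub_oo C A) => //; exact: subIsetl.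
have A'oo : leb A' < +oo by apply: (sub_oo A' A) => //; exact: subDsetl.
have B'oo : leb B' < +oo by apply: (sub_oo B' B) => //; exact: subDsetl.
have A'C : A' `&` C = set0 by apply/seteqP; split => // y [[]] ? ? [].
have B'C : C `&` B' = set0 by apply/seteqP; split => // y [[]] ? ? [].
have A'B' : A' `&` B' = set0 by apply/seteqP; split => // y [[]] ? ? [].
have A'UC : A' `|` C = A by rewrite setUC /C /A' setUIDK.
have CUB' : C `|` B' = B by rewrite /C /B' setIC setUIDK.
have N0 := point_count_ge0.
have lebA : leb A = leb A' + leb C by rewrite -[in LHS]A'UC measureU.
have lebB : leb B = leb C + leb B' by rewrite -[in LHS]CUB' measureU.
have NAB w : N A w * N B w = (N A' w * N C w + N A' w * N B' w) + (N C w * N C w + N C w * N B' w).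
  rewrite -[in LHS]A'UC -[in LHS]CUB' !point_countU// ge0_muleDl ?N0 ?adde_ge0//.
  by rewrite !ge0_muleDr.
have mN D : measurable D -> measurable_fun setT (N D) by exact: measurable_point_count.
under eq_integral do rewrite NAB.
rewrite !ge0_integralD//; last first.
all: try by move=> w _; rewrite ?adde_ge0 ?mule_ge0.
all: try by repeat first [exact: mN|apply: emeasurable_funD|apply: emeasurable_funM].
rewrite (expectation_mul_point_count_disjoint mA' mC A'C) (expectation_mul_point_count_disjoint mA' mB' A'B').
rewrite (expectation_mul_point_count_disjoint mC mB' B'C).
rewrite expectation_point_count_sqr// !expectation_point_count// -!meanE// lebA lebB.
have fD (D : set R) : leb D < +oo -> leb D = (fine (leb D))%:E.
  by move=> Doo; rewrite fineK// ge0_fin_numE.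
rewrite (fD _ Coo) (fD _ A'oo) (fD _ B'oo) /mean.
by apply: (congr1 (@EFin R)); ring.
Qed.

End poisson_counts.

(** * Second factorial moment measure *)

Section pair_measure.
Context d (T : measurableType d) (R : realType) (P : probability T R).
Variables (lambda : R) (X : nat -> {RV P >-> R}).
Hypotheses (lambda_gt0 : (0 < lambda)%R) (PPP_X : homogeneous_PPP P lambda X).

Local Notation leb := (@lebesgue_measure R).
Local Notation N B := (point_count X B).
Local Notation RR := (measurableTypeR R * measurableTypeR R)%type.

Let pairX k j (w : T) : RR := (X k w, X j w).

Let measurable_pairX k j : measurable_fun setT (pairX k j).
Proof.
rewrite /pairX; apply: measurable_fun_pair.
exact: (measurable_funPT (X k)).
exact: (measurable_funPT (X j)).
Qed.

Let pairX_mixin k j := isMeasurableFun.Build _ _ _ _ _ (measurable_pairX k j).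
Let pairX_mfun k j : {mfun T >-> RR} := HB.pack (pairX k j) (pairX_mixin k j).

(** The law of the pair [(X_k, X_j)], erased when [j = k]. Summing over [k] and [j] yields the
    second factorial moment measure [M], which is a measure by construction. *)
Let m_ k j : {measure set RR -> \bar R} :=
  if j == k then (mzero : {measure set RR -> \bar R}) else distribution P (pairX_mfun k j).

Let M : {measure set RR -> \bar R} := mseries (fun k => mseries (m_ k) 0) 0.

Lemma measurable_pair_sum (h : RR -> \bar R) k :
  measurable_fun setT h -> (forall p, 0 <= h p) ->
  measurable_fun setT (fun w => \sum_(0 <= j <oo | j != k) h (X k w, X j w)).
Proof.
move=> mh h0; apply: ge0_emeasurable_sum => // j _.
exact: (measurableT_comp mh (measurable_pairX k j)).
Qed.

Let integral_M (h : RR -> \bar R) : measurable_fun setT h -> (forall p, 0 <= h p) ->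
  \int[M]_p h p =
  \int[P]_w \sum_(0 <= k <oo) \sum_(0 <= j <oo | j != k) h (X k w, X j w).
Proof.
move=> mh h0.
rewrite integral_nneseries//; last 2 first.
- by move=> k; exact: measurable_pair_sum.
- by move=> k w _; apply: nneseries_ge0.
rewrite ge0_integral_measure_series//; apply: eq_eseriesr => k _.
under [RHS]eq_integral do rewrite eseries_mkcond.
rewrite integral_nneseries//; last 2 first.
- move=> j; case: (j != k) => //; exact: (measurableT_comp mh (measurable_pairX k j)).
- by move=> j w _; case: (j != k).
rewrite ge0_integral_measure_series//; apply: eq_eseriesr => j _.
rewrite /m_; case: (j == k) => /=; first by rewrite integral_measure_zero integral0.
by rewrite ge0_integral_pushforward.
Qed.

(** The diagonal terms missing from the double sum add up to the count of [A \cap B], whose mean is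
    exactly the extra term of [expectation_mul_point_count]. Being finite, it can be subtracted on
    both sides. *)
Let M_rect (A B : set R) : measurable A -> measurable B -> leb A < +oo -> leb B < +oo ->
  M (A `*` B) = (lambda ^+ 2)%:E * (leb A * leb B).
Proof.
move=> mA mB Aoo Boo.
have mAB : measurable (A `*` B : set RR) by exact: measurableX.
rewrite -[M _]/(M (A `*` B)) -[A `*` B]setIT -integral_indic//.
have h0 (p : RR) : 0 <= (\1_(A `*` B) p : R)%:E by rewrite lee_fin.
have mh : measurable_fun setT (fun p : RR => (\1_(A `*` B) p : R)%:E).
  by apply/measurable_EFinP; exact: measurable_indic.
rewrite integral_M//.
have I0 : 0 <= \int[P]_w N (A `&` B) w.
  by apply: integral_ge0 => w _; exact: point_count_ge0.
have ABoo : leb (A `&` B) < +oo.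
  by apply: le_lt_trans Aoo; rewrite le_measure ?inE//; exact: measurableI.
have fAB : lambda%:E * leb (A `&` B) \is a fin_num.
  by rewrite fin_numM// ge0_fin_numE.
have E w : \sum_(0 <= k <oo) \sum_(0 <= j <oo | j != k) (\1_(A `*` B) (X k w, X j w) : R)%:E
    + N (A `&` B) w = N A w * N B w.
  rewrite -nneseriesD; last 2 first.
  - by move=> k _ _; apply: nneseries_ge0.
  - by move=> k _ _; rewrite lee_fin.
  rewrite [RHS]muleC -nneseriesMl ?point_count_ge0//.
  apply: eq_eseriesr => k _; rewrite muleC.
  rewrite /point_count (@nneseriesD1 _ _ k xpredT)//.
  rewrite ge0_muleDr ?lee_fin//; last exact: nneseries_ge0.
  rewrite addeC; congr (_ + _).
    by rewrite -EFinM indicI.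
  rewrite -nneseriesZl; last by move=> j _; rewrite lee_fin.
  apply: eq_eseriesr => j _.
  rewrite -EFinM; congr EFin.
  rewrite !indicE -natrM mulnb; congr (_ %:R)%R; congr nat_of_bool.
  apply/idP/andP => [/set_mem[]/= ? ?|[/set_mem ? /set_mem ?]].
    by split; exact/mem_set.
  by apply/mem_set; split.
have fI : \int[P]_w N (A `&` B) w \is a fin_num.
  by rewrite (expectation_point_count lambda_gt0 PPP_X)//; exact: measurableI.
rewrite -[LHS](addeK _ fI) -[RHS](addeK _ fI); congr (_ - _).
rewrite -ge0_integralD//; last 4 first.
- by move=> w _; apply: nneseries_ge0 => k _ _; apply: nneseries_ge0.
- by apply: ge0_emeasurable_sum => [k w _ _|k _]; [exact: nneseries_ge0|exact: (@measurable_pair_sum _ k mh h0)].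
- by move=> w _; exact: point_count_ge0.
- by apply: measurable_point_count; exact: measurableI.
under eq_integral do rewrite E.
rewrite (expectation_mul_point_count lambda_gt0 PPP_X)//.
by rewrite (expectation_point_count lambda_gt0 PPP_X)//; exact: measurableI.
Qed.

(** Both measures agree on rectangles of finite area. Restricted to the window [W], they are
    compared with the product of two finite measures, which is determined by rectangles; dividing
    [M] by [lambda^2] makes it such a product exactly. *)
Let M_restr (W : set R) (D : set RR) : measurable W -> leb W < +oo -> measurable D ->
  M (D `&` W `*` W) = (lambda ^+ 2)%:E * (leb \x leb) (D `&` W `*` W).
Proof.
move=> mW Woo mD.
have mWW : measurable (W `*` W : set RR) by exact: measurableX.
have l0 : (0 <= lambda ^- 2)%R by rewrite invr_ge0 sqr_ge0.
have mW' : measurable (W : set (measurableTypeR R)) := mW.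
have Woo' : (leb : {measure set (measurableTypeR R) -> \bar R}) W < +oo := Woo.
pose lW : {finite_measure set (measurableTypeR R) -> \bar R} := mfrestr mW' Woo'.
have sub_oo (A : set R) : measurable A -> leb (A `&` W) < +oo.
  by move=> mA; apply: le_lt_trans Woo; rewrite le_measure ?inE//; exact: measurableI.
have h1 : (lW \x lW) D = mscale (NngNum l0) (mrestr M mWW) D.
  apply: product_measure_unique => // A B mA mB.
  transitivity ((lambda ^- 2)%:E * M (A `*` B `&` W `*` W)) => //.
  rewrite -setXI M_rect; last 4 first.
  - exact: measurableI.
  - exact: measurableI.
  - exact: sub_oo.
  - exact: sub_oo.
  by rewrite muleA -EFinM mulVf ?mul1e// expf_neq0// gt_eqF.
have h2 : (lW \x lW) D = mrestr (leb \x leb) mWW D.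
  apply: product_measure_unique => // A B mA mB.
  transitivity ((leb \x leb) (A `*` B `&` W `*` W)) => //.
  by rewrite -setXI product_measure1E//; exact: measurableI.
move: h1; rewrite h2 /mscale/= /mrestr => ->.
by rewrite muleA -EFinM mulfV ?mul1e// expf_neq0// gt_eqF.
Qed.

Lemma expectation_pair_sum (W : set R) (h : RR -> \bar R) :
  measurable W -> leb W < +oo -> measurable_fun setT h -> (forall p, 0 <= h p) ->
  (forall p, ~ (W `*` W) p -> h p = 0) ->
  \int[P]_w \sum_(0 <= k <oo) \sum_(0 <= j <oo | j != k) h (X k w, X j w) =
  (lambda ^+ 2)%:E * \int[leb \x leb]_p h p.
Proof.
move=> mW Woo mh h0 hW.
have mWW : measurable (W `*` W : set RR) by exact: measurableX.
have hE (mu : {measure set RR -> \bar R}) : \int[mu]_p h p = \int[mu]_(p in W `*` W) h p.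
  rewrite [RHS]integral_mkcond; apply: eq_integral => p _.
  by rewrite patchE; case: ifPn => // /negP Wp; apply: hW => WWp; apply: Wp; rewrite inE.
have l0 : (0 <= lambda ^+ 2)%R by rewrite sqr_ge0.
rewrite -integral_M// hE (eq_measure_integral (mscale (NngNum l0) (leb \x leb))).
  by rewrite ge0_integral_mscale// ?hE//; exact: measurable_funTS.
by move=> D mD DW; rewrite -[D](setIidl DW) M_restr.
Qed.

End pair_measure.

(** * Mecke formula for the Laplace functional *)

(** The kernel takes the tagged point and another point separately, although only kernels of their
    difference matter in the end: step kernels on a grid and cut-offs to a window are not
    translation invariant. *)
Definition palm_laplace d (T : measurableType d) (R : realType) (P : probability T R)
    (X : nat -> T -> R) (A : set R) (f : R * R -> \bar R) : \bar R :=
  \int[P]_w \sum_(0 <= k <oo)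
    ((\1_A (X k w))%:E * expeR (- \sum_(0 <= j <oo | j != k) f (X k w, X j w))).

Definition poisson_palm_laplace (R : realType) (lambda : R) (A : set R)
    (f : R * R -> \bar R) : \bar R :=
  lambda%:E * \int[lebesgue_measure]_(z in A)
    expeR (- (lambda%:E * \int[lebesgue_measure]_y (1 - expeR (- f (z, y))))).

Lemma expeR_sum (R : realType) (I : Type) (r : seq I) (Q : pred I) (u : I -> \bar R) :
  (forall i, Q i -> 0 <= u i) ->
  expeR (- \sum_(i <- r | Q i) u i) = \prod_(i <- r | Q i) expeR (- u i).
Proof.
move=> u0.
(* Nonnegativity of the partial sums travels along the induction; it rules out the undefined sum of
   opposite infinities in [oppeD]. *)
suff [] : 0 <= \sum_(i <- r | Q i) u i /\
    expeR (- \sum_(i <- r | Q i) u i) = \prod_(i <- r | Q i) expeR (- u i) by [].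
apply: (big_rec2 (fun x y => 0 <= y /\ expeR (- y) = x)).
  by rewrite oppe0 expeR0.
move=> i y1 y2 Qi [y20 <-]; split; first by rewrite adde_ge0// u0.
by rewrite oppeD ?expeRD// ge0_adde_def// inE// u0.
Qed.

Lemma measurable_lebesgue_indic (R : realType) (D B : set R) : measurable B ->
  measurable_fun (D : set (measurableTypeR R)) (fun y : measurableTypeR R => (\1_B y : R)%:E).
Proof.
move=> mB; have : measurable_fun D (\1_B : R -> R) by exact: measurable_indic.
by move/measurable_EFinP.
Qed.

Lemma integral_lebesgue_indic (R : realType) (D B : set R) : measurable D -> measurable B ->
  \int[@lebesgue_measure R]_(y in D) (\1_B y)%:E = lebesgue_measure (B `&` D).
Proof. by move=> mD mB; rewrite integral_indic. Qed.

(** * Mecke formula for step kernels *)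

Section step_functions.
Context d (T : measurableType d) (R : realType) (P : probability T R).
Variables (lambda : R) (X : nat -> {RV P >-> R}).
Hypotheses (lambda_gt0 : (0 < lambda)%R) (PPP_X : homogeneous_PPP P lambda X).

Local Notation leb := (@lebesgue_measure R).
Local Notation N B := (point_count X B).

Variables (n : nat) (J : 'I_n -> set R) (a : 'I_n -> 'I_n -> R) (A : set R).
Hypotheses (mJ : forall i, measurable (J i)) (Joo : forall i, leb (J i) < +oo).
Hypotheses (tJ : trivIset setT J) (a0 : forall i l, (0 <= a i l)%R).
(* Vanishing on diagonal cells makes the omission of [j = k] harmless. *)
Hypotheses (aii : forall i, a i i = 0%R) (mA : measurable A).
Hypothesis AJ : forall z, A z -> exists i, J i z.
Variable f : R * R -> \bar R.
Hypothesis fE : forall i z y, J i z -> f (z, y) = (\sum_(l < n) a i l * \1_(J l) y)%:E.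

Let J_inj i l y : J i y -> J l y -> i = l.
Proof. by move=> iy ly; apply: (tJ _ _) => //; exists y. Qed.

Let sum_indic i l y : J l y -> (\sum_(l' < n) a i l' * \1_(J l') y = a i l)%R.
Proof.
move=> ly; rewrite (bigD1 l)//= indicE mem_set// mulr1 big1 ?addr0// => l' l'l.
by rewrite indicE memNset ?mulr0// => l'y; move/eqP: l'l; apply; exact: J_inj l'y ly.
Qed.

Let G i w := expeR (- \sum_(l < n) (a i l)%:E * N (J l) w).

Let ae0 i l w : 0 <= (a i l)%:E * N (J l) w.
Proof. by rewrite mule_ge0 ?lee_fin// point_count_ge0. Qed.

Let exponentE i k w : J i (X k w) ->
  \sum_(0 <= j <oo | j != k) f (X k w, X j w) = \sum_(l < n) (a i l)%:E * N (J l) w.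
Proof.
move=> ik; under eq_eseriesr do rewrite (fE _ ik).
have t0 j : (0 <= \sum_(l < n) a i l * \1_(J l) (X j w))%R.
  by apply: sumr_ge0 => l _; rewrite mulr_ge0.
transitivity (\sum_(0 <= j <oo) (\sum_(l < n) a i l * \1_(J l) (X j w))%:E).
  rewrite [RHS](@nneseriesD1 _ _ k xpredT)//; last by move=> j _; rewrite lee_fin.
  by rewrite (sum_indic _ ik) aii add0e.
under eq_eseriesr do rewrite -sumEFin.
rewrite nneseries_sum; last by move=> l j _; rewrite lee_fin mulr_ge0.
apply: eq_bigr => l _; rewrite /point_count -nneseriesMl ?lee_fin//.
Qed.

(** Once the cell of the tagged point is known, the exponent depends on the counts alone, so
    grouping the points of [A] by cells leaves a finite sum of functions of counts. *)
Let pathwise w :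
  \sum_(0 <= k <oo) ((\1_A (X k w))%:E * expeR (- \sum_(0 <= j <oo | j != k) f (X k w, X j w))) =
  \sum_(i < n) N (A `&` J i) w * G i w.
Proof.
transitivity (\sum_(0 <= k <oo) \sum_(i < n) (\1_(A `&` J i) (X k w))%:E * G i w).
  apply: eq_eseriesr => k _.
  have [/set_mem Ak|/negP Ak] := boolP (X k w \in A); last first.
    rewrite indicE memNset ?mul0e; last by move=> ?; apply: Ak; rewrite inE.
    rewrite big1// => i _; rewrite indicE memNset ?mul0e// => -[? _].
    by apply: Ak; rewrite inE.
  have [i ik] := AJ Ak.
  rewrite (bigD1 i)//= indicE mem_set// mul1e indicE mem_set// mul1e.
  rewrite big1 ?adde0 => [|l li]; last first.
    rewrite indicE memNset ?mul0e// => -[_ lk]; move/eqP: li; apply.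
    exact: J_inj lk ik.
  by rewrite (exponentE ik).
rewrite nneseries_sum; last by move=> i k _; rewrite mule_ge0 ?lee_fin// expeR_ge0.
apply: eq_bigr => i _; rewrite [RHS]muleC -nneseriesMl ?expeR_ge0//.
by apply: eq_eseriesr => k _; rewrite muleC.
Qed.

Let mN (B : set R) : measurable B -> measurable_fun setT (N B).
Proof. exact: measurable_point_count. Qed.

Let mAJ i : measurable (A `&` J i).
Proof. exact: measurableI. Qed.

Let AJoo i : leb (A `&` J i) < +oo.
Proof. apply: (le_lt_trans _ (Joo i)); apply: le_measure; rewrite ?inE.
- exact: mAJ.
- exact: mJ.
- exact: subIsetr. Qed.

Let term i : \int[P]_w (N (A `&` J i) w * G i w) =
  lambda%:E * leb (A `&` J i) *
  expeR (- (lambda%:E * \sum_(l < n) (1 - expR (- a i l))%:E * leb (J l))).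
Proof.
(* As [a i i = 0], the exponential does not involve the cell [i]. Replacing that cell by
   [A \cap J i] keeps the family disjoint, so the count and the exponentials of the other counts are
   independent. *)
pose B l := if l == i then A `&` J i else J l.
pose F l (b : \bar R) := if l == i then `|b| else expeR (- ((a i l)%:E * `|b|)).
have mB l : measurable (B l) by rewrite /B; case: ifP.
have BJ l : B l `<=` J l by rewrite /B; case: eqP => [->|_] y //= [].
have tB : trivIset setT B.
  apply/trivIsetP => l l' _ _ ll'; apply/seteqP; split => // y [/BJ ly /BJ l'y].
  by move/eqP: ll'; apply; exact: J_inj ly l'y.
have mF l : measurable_fun setT (F l).
  rewrite /F; case: (l == i) => /=; first exact: abse_measurable.
  apply: measurableT_comp; first exact: measurable_expeR.
  by apply: measurableT_comp => //; exact: measurable_funeM.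
have F0 l b : 0 <= F l b by rewrite /F; case: (l == i) => //; exact: expeR_ge0.
have Fi b : F i b = `|b| by rewrite /F eqxx.
have Bi : B i = A `&` J i by rewrite /B eqxx.
have Fl l b : l != i -> F l b = expeR (- ((a i l)%:E * `|b|)) by rewrite /F => /negbTE ->.
have Bl l : l != i -> B l = J l by rewrite /B => /negbTE ->.
transitivity (\int[P]_w \prod_(l < n) F l (N (B l) w)).
  apply: eq_integral => w _; rewrite [RHS](bigD1 i)//= Fi Bi.
  rewrite gee0_abs ?point_count_ge0//; congr (_ * _).
  rewrite /G expeR_sum// (bigD1 i)//= aii mul0e oppe0 expeR0 mul1e.
  by apply: eq_bigr => l li; rewrite Fl// Bl// gee0_abs// point_count_ge0.
rewrite (expectation_prod_point_count PPP_X mB tB mF F0) [LHS](bigD1 i)//= Bi.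
congr (_ * _).
  transitivity (\int[P]_w N (A `&` J i) w).
    by apply: eq_integral => w _; rewrite Fi gee0_abs ?point_count_ge0.
  exact: (expectation_point_count lambda_gt0 PPP_X).
have e0 l : (0 <= 1 - expR (- a i l))%R by rewrite subr_ge0 -expR0 ler_expR oppr_le0.
rewrite ge0_sume_distrr; last by move=> l _; rewrite mule_ge0// lee_fin.
rewrite expeR_sum; last by move=> l _; rewrite !mule_ge0 ?lee_fin// ltW.
rewrite [RHS](bigD1 i)//= aii oppr0 expR0 subrr mul0e mule0 oppe0 expeR0 mul1e.
apply: eq_bigr => l li; rewrite Bl//.
under eq_integral do rewrite Fl// gee0_abs ?point_count_ge0//.
rewrite (laplace_point_count lambda_gt0 PPP_X)//.
rewrite -[in RHS](@fineK _ (leb (J l))) ?ge0_fin_numE//.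
by rewrite -!EFinM -EFinN /=; congr (expR _)%:E; ring.
Qed.

Lemma palm_laplace_step : palm_laplace P X A f = poisson_palm_laplace lambda A f.
Proof.
rewrite /palm_laplace; under eq_integral do rewrite pathwise.
have mG i : measurable_fun setT (G i).
  apply: measurableT_comp; first exact: measurable_expeR.
  apply: measurableT_comp => //; apply: emeasurable_sum => l.
  by apply: measurable_funeM; exact: mN.
rewrite ge0_integral_sum//; last 2 first.
- by move=> i; apply: emeasurable_funM => //; exact: mN.
- by move=> i w _; rewrite mule_ge0// ?point_count_ge0// expeR_ge0.
under eq_bigr do rewrite term -muleA.
rewrite -ge0_sume_distrr; last by move=> i _; rewrite mule_ge0// expeR_ge0.
congr (_ * _).
(* At most one cell contains [y], so [1 - exp (- f)] is again a step function, with [exp] applied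
   cell by cell. *)
have inner i z : J i z -> \int[leb]_y (1 - expeR (- f (z, y))) =
    \sum_(l < n) (1 - expR (- a i l))%:E * leb (J l).
  move=> iz.
  have e0 l : (0 <= 1 - expR (- a i l))%R by rewrite subr_ge0 -expR0 ler_expR oppr_le0.
  have m1 l : measurable_fun setT (fun y : R => ((1 - expR (- a i l)) * \1_(J l) y)%:E).
    by apply/measurable_EFinP/measurable_funM => //; exact: measurable_indic.
  transitivity (\int[leb]_y \sum_(l < n) ((1 - expR (- a i l)) * \1_(J l) y)%:E).
    apply: eq_integral => y _; rewrite (fE _ iz) sumEFin.
    transitivity ((1 - expR (- \sum_(l < n) a i l * \1_(J l) y))%:E) => //; congr EFin.
    have [[l ly]|nJ] := pselect (exists l, J l y).
      rewrite (sum_indic _ ly) (bigD1 l)//= indicE mem_set// mulr1 big1 ?addr0// => l' l'l.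
      by rewrite indicE memNset ?mulr0// => l'y; move/eqP: l'l; apply; exact: J_inj l'y ly.
    have n0 l : \1_(J l) y = 0%R :> R by rewrite indicE memNset// => ly; apply: nJ; exists l.
    rewrite [X in expR (- X)]big1 ?big1 ?oppr0 ?expR0 ?subrr// => l _; by rewrite n0 mulr0.
  rewrite ge0_integral_sum//; last by move=> l y _; rewrite lee_fin mulr_ge0.
  apply: eq_bigr => l _; under eq_integral do rewrite EFinM.
  rewrite ge0_integralZl//; last 2 first.
  - exact: measurable_lebesgue_indic.
  - by rewrite lee_fin.
  by rewrite integral_lebesgue_indic// setIT.
pose c i := expeR (- (lambda%:E * \sum_(l < n) (1 - expR (- a i l))%:E * leb (J l))).
have c0 i : 0 <= c i by exact: expeR_ge0.
transitivity (\int[leb]_(z in A) \sum_(i < n) (c i * (\1_(J i) z)%:E)); last first.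
  apply: eq_integral => z /set_mem Az; have [i iz] := AJ Az.
  rewrite (bigD1 i)//= indicE mem_set// mule1 big1 ?adde0 ?(inner i)// => l li.
  by rewrite indicE memNset ?mule0// => lz; move/eqP: li; apply; exact: J_inj lz iz.
have mi i : measurable_fun (A : set (measurableTypeR R)) (fun z : measurableTypeR R => (\1_(J i) z : R)%:E).
  exact: measurable_lebesgue_indic.
rewrite ge0_integral_sum//; last 2 first.
- by move=> i; apply: measurable_funeM; exact: mi.
- by move=> i z _; rewrite mule_ge0// lee_fin.
apply: eq_bigr => i _; rewrite ge0_integralZl//.
by rewrite muleC setIC integral_lebesgue_indic.
Qed.

End step_functions.

(** * Stability of both sides under changes of the kernel *)

Section onem_expeR.
Context {R : realType}.
Implicit Types a b e : \bar R.

Lemma expeRN_fin_num a : 0 <= a -> expeR (- a) \is a fin_num.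
Proof. by move=> a0; rewrite ge0_fin_numE ?expeR_ge0// (le_lt_trans (expeRN_le1 a0)) ?ltry. Qed.

Lemma onem_expeRN_ge0 a : 0 <= a -> 0 <= 1 - expeR (- a).
Proof. by move=> a0; rewrite sube_ge0 ?expeRN_le1// expeRN_fin_num. Qed.

Lemma onem_expeRN_lipschitz a b e : 0 <= a -> 0 <= b -> 0 <= e ->
  a <= b + e -> 1 - expeR (- a) <= 1 - expeR (- b) + e.
Proof.
move=> a0 b0 e0 abe; have := expeRN_lipschitz a0 b0 e0 abe.
rewrite -(fineK (expeRN_fin_num a0)) -(fineK (expeRN_fin_num b0)).
case: e e0 {abe} => [e| |]// _; last by move=> _; rewrite addey// leey.
rewrite -EFinD -!EFinB -EFinD !lee_fin; lra.
Qed.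

Lemma measurable_onem_expeRN d (T : measurableType d) (f : T -> \bar R) :
  measurable_fun setT f -> measurable_fun setT (fun w => 1 - expeR (- f w)).
Proof.
move=> mf; apply: emeasurable_funB => //.
by apply: measurableT_comp; [exact: measurable_expeR|exact: measurableT_comp].
Qed.

End onem_expeR.

Section lipschitz.
Context d (T : measurableType d) (R : realType) (P : probability T R).
Variables (lambda : R) (X : nat -> {RV P >-> R}).
Hypotheses (lambda_gt0 : (0 < lambda)%R) (PPP_X : homogeneous_PPP P lambda X).

Local Notation leb := (@lebesgue_measure R).
Local Notation RR := (measurableTypeR R * measurableTypeR R)%type.

Lemma palm_exponent_measurable (f : RR -> \bar R) k : measurable_fun setT f ->
  (forall p, 0 <= f p) ->
  measurable_fun setT (fun w => expeR (- \sum_(0 <= j <oo | j != k) f (X k w, X j w))).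
Proof.
move=> mf f0; apply: measurableT_comp; first exact: measurable_expeR.
by apply: measurableT_comp => //; exact: measurable_pair_sum.
Qed.

Lemma palm_term_measurable (A : set R) (f : RR -> \bar R) k : measurable A ->
  measurable_fun setT f -> (forall p, 0 <= f p) ->
  measurable_fun setT (fun w => (\1_A (X k w))%:E *
    expeR (- \sum_(0 <= j <oo | j != k) f (X k w, X j w))).
Proof.
move=> mA mf f0; apply: emeasurable_funM; first exact: measurable_RV_indic.
exact: palm_exponent_measurable.
Qed.

Lemma poisson_inner_measurable (f : RR -> \bar R) : measurable_fun setT f ->
  (forall p, 0 <= f p) ->
  measurable_fun setT (fun z => \int[leb]_y (1 - expeR (- f (z, y)))).
Proof.
move=> mf f0.
apply: (@measurable_fun_fubini_tonelli_F _ _ _ _ _ leb (fun p => 1 - expeR (- f p))).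
  exact: measurable_onem_expeRN.
by move=> p; exact: onem_expeRN_ge0.
Qed.

(* [h] plays the role of [|f - g|], which is not available in [\bar R]. *)
Variables (A W : set R) (f g h : RR -> \bar R).
Hypotheses (mA : measurable A) (mW : measurable W) (Woo : leb W < +oo).
Hypotheses (mf : measurable_fun setT f) (mg : measurable_fun setT g).
Hypotheses (mh : measurable_fun setT h).
Hypotheses (f0 : forall p, 0 <= f p) (g0 : forall p, 0 <= g p) (h0 : forall p, 0 <= h p).
Hypothesis hW : forall p, ~ (W `*` W) p -> h p = 0.
Hypothesis fgh : forall z y, A z -> f (z, y) <= g (z, y) + h (z, y).

Lemma palm_laplace_lipschitz :
  palm_laplace P X A g <= palm_laplace P X A f + (lambda ^+ 2)%:E * \int[leb \x leb]_p h p.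
Proof.
have s0 (u : RR -> \bar R) k w : (forall p, 0 <= u p) ->
    0 <= \sum_(0 <= j <oo | j != k) u (X k w, X j w) by move=> u0; exact: nneseries_ge0.
have t0 (u : RR -> \bar R) k w : 0 <= (\1_A (X k w))%:E *
    expeR (- \sum_(0 <= j <oo | j != k) u (X k w, X j w)).
  by rewrite mule_ge0 ?lee_fin// expeR_ge0.
rewrite -(expectation_pair_sum lambda_gt0 PPP_X mW)// -ge0_integralD//; last 4 first.
- by move=> w _; apply: nneseries_ge0 => k _ _; exact: t0.
- by apply: ge0_emeasurable_sum => // k _; exact: palm_term_measurable.
- by move=> w _; apply: nneseries_ge0 => k _ _; exact: s0.
- by apply: ge0_emeasurable_sum => [k w _ _|k _]; [exact: s0|exact: measurable_pair_sum].
apply: ge0_le_integral => //.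
- by move=> w _; apply: nneseries_ge0 => k _ _; exact: t0.
- by apply: ge0_emeasurable_sum => // k _; exact: palm_term_measurable.
- apply: emeasurable_funD.
  by apply: ge0_emeasurable_sum => // k _; exact: palm_term_measurable.
  by apply: ge0_emeasurable_sum => [k w _ _|k _]; [exact: s0|exact: measurable_pair_sum].
move=> w _; rewrite -nneseriesD; last 2 first.
- by move=> k _ _; exact: t0.
- by move=> k _ _; exact: s0.
apply: lee_nneseries => [k _ _|k _]; first exact: t0.
rewrite indicE; have [/set_mem Ak|_] := boolP (_ \in A); last first.
  by rewrite !mul0e add0e s0.
rewrite !mul1e; apply: expeRN_lipschitz; [exact: s0|exact: s0|exact: s0|].
rewrite -nneseriesD => [|j _ _|j _ _]//.
by apply: lee_nneseries => // j _; exact: fgh.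
Qed.

(** Here the Lipschitz bound is used twice, for the outer exponential and for the inner
    [1 - exp (- f)]. One factor [lambda] stands before the outer integral and one before the inner,
    which yields the same constant [lambda^2] as on the Palm side. *)
Lemma poisson_palm_laplace_lipschitz :
  poisson_palm_laplace lambda A g <=
  poisson_palm_laplace lambda A f + (lambda ^+ 2)%:E * \int[leb \x leb]_p h p.
Proof.
have l0 : 0 <= lambda%:E by rewrite lee_fin ltW.
have i0 (u : RR -> \bar R) z : (forall p, 0 <= u p) ->
    0 <= lambda%:E * \int[leb]_y (1 - expeR (- u (z, y))).
  by move=> u0; rewrite mule_ge0// integral_ge0// => y _ /=; exact: onem_expeRN_ge0.
have mE (u : RR -> \bar R) : measurable_fun setT u -> (forall p, 0 <= u p) ->
    measurable_fun A (fun z => expeR (- (lambda%:E * \int[leb]_y (1 - expeR (- u (z, y)))))).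
  move=> mu u0; apply: measurable_funTS; apply: measurableT_comp; first exact: measurable_expeR.
  apply: measurableT_comp => //; apply: measurable_funeM; exact: poisson_inner_measurable.
have mH : measurable_fun setT (fun z => \int[leb]_y h (z, y)).
  exact: (@measurable_fun_fubini_tonelli_F _ _ _ _ _ leb h).
have H0 z : 0 <= \int[leb]_y h (z, y) by exact: integral_ge0.
rewrite /poisson_palm_laplace expr2 EFinM -muleA -ge0_muleDr; last 2 first.
- by apply: integral_ge0 => z _; exact: expeR_ge0.
- by rewrite mule_ge0// integral_ge0.
apply: lee_wpmul2l => //; rewrite fubini_tonelli1//.
apply: (@le_trans _ _ (\int[leb]_(z in A)
   (expeR (- (lambda%:E * \int[leb]_y (1 - expeR (- f (z, y))))) + lambda%:E * \int[leb]_y h (z, y)))).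
  apply: ge0_le_integral => //.
  - by move=> z _; exact: expeR_ge0.
  - exact: mE.
  - apply: emeasurable_funD; first exact: mE.
    by apply: measurable_funeM; exact: measurable_funTS.
  move=> z Az; apply: expeRN_lipschitz; [exact: i0|exact: i0|exact: mule_ge0|].
  rewrite -ge0_muleDr ?integral_ge0//; last 1 first.
  - by move=> y _ /=; exact: onem_expeRN_ge0.
  apply: lee_wpmul2l => //.
  have m1 (u : RR -> \bar R) : measurable_fun setT u ->
      measurable_fun setT (fun y => 1 - expeR (- u (z, y))).
    by move=> mu; apply: measurable_onem_expeRN; exact: (measurable_fun_pair2 z mu).
  have m2 : measurable_fun setT (fun y => h (z, y)) by exact: (measurable_fun_pair2 z mh).
  rewrite -ge0_integralD//; last 2 first.
  - by move=> y _ /=; exact: onem_expeRN_ge0.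
  - exact: m1.
  apply: ge0_le_integral => //.
  - by move=> y _ /=; exact: onem_expeRN_ge0.
  - exact: m1.
  - by apply: emeasurable_funD => //; exact: m1.
  by move=> y _; apply: onem_expeRN_lipschitz => //; exact: fgh.
rewrite ge0_integralD//; last 4 first.
- by move=> z _; exact: expeR_ge0.
- exact: mE.
- by move=> z _; rewrite mule_ge0.
- by apply: measurable_funeM; exact: measurable_funTS.
apply: leeD2l; rewrite ge0_integralZl//; last exact: measurable_funTS.
by apply: lee_wpmul2l => //; apply: ge0_subset_integral.
Qed.

End lipschitz.

Lemma measurable_indic_comp d (T : measurableType d) (R : realType) (B : set R) (u : T -> R) :
  measurable B -> measurable_fun setT u -> measurable_fun setT (fun w => \1_B (u w) : R).
Proof. by move=> mB mu; apply: measurableT_comp => //; exact: measurable_indic. Qed.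

(** * Continuous kernels through grids *)

Section grid.
Context (R : realType).
Variables (K m : nat).

(** The cells have length [1 / (m + 1)] and are numbered from [- K]; the first [2 K (m + 1)] of them
    tile [[- K, K)]. *)
Definition grid_cell (l : nat) : set R :=
  `[- K%:R + l%:R / m.+1%:R, - K%:R + l.+1%:R / m.+1%:R[%classic%R.

Lemma grid_cell_inj i l y : grid_cell i y -> grid_cell l y -> i = l.
Proof.
suff h : forall i l, (i < l)%N -> grid_cell i y -> grid_cell l y -> False.
  move=> iy ly; case: (ltngtP i l) => // il.
    by have := h _ _ il iy ly.
  by have := h _ _ il ly iy.
move=> {}i {}l il; rewrite /grid_cell/= !in_itv/= => /andP[_ h1] /andP[h2 _].
have := le_lt_trans h2 h1; rewrite ltrD2l ltr_pM2r ?invr_gt0// ltr_nat ltnS.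
by rewrite leqNgt il.
Qed.

Lemma grid_cellP y : `[- K%:R, K%:R[%classic%R y ->
  exists2 l, (l < 2 * K * m.+1)%N & grid_cell l y.
Proof.
rewrite /= in_itv/= => /andP[Ky yK].
have m0 : (0 < m.+1%:R :> R)%R by [].
have u0 : (0 <= m.+1%:R * (y + K%:R))%R by rewrite mulr_ge0//; lra.
set t := Num.truncn (m.+1%:R * (y + K%:R))%R; exists t.
  rewrite ltnNge /t truncn_ge_nat// -ltNge !natrM [ltRHS]mulrC ltr_pM2l//.
  by rewrite mulr2n; lra.
have := truncn_itv u0; rewrite -/t => /andP[h1 h2].
rewrite mulrC -ler_pdivrMr// in h1; rewrite mulrC -ltr_pdivlMr// in h2.
rewrite /grid_cell/= in_itv/= -lerBrDl opprK h1/=.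
by rewrite addrC -ltrBlDr opprK.
Qed.

Lemma grid_cell_sub l y : (l < 2 * K * m.+1)%N -> grid_cell l y ->
  `[- K%:R, K%:R[%classic%R y.
Proof.
rewrite /grid_cell/= !in_itv/= => lK /andP[h1 h2]; apply/andP; split.
  by apply: le_trans h1; rewrite lerDl divr_ge0.
apply: (lt_le_trans h2); rewrite -lerBrDl ler_pdivrMr// opprK.
by rewrite -natrD -natrM ler_nat addnn -mul2n.
Qed.

Lemma grid_cell_dist i l z y : grid_cell i z -> grid_cell l y ->
  (`|(l%:R - i%:R) / m.+1%:R - (y - z)| < m.+1%:R^-1 :> R)%R.
Proof.
rewrite /grid_cell/= !in_itv/=; set c := (m.+1%:R^-1)%R.
rewrite -[i.+1%:R]natr1 -[l.+1%:R]natr1 !mulrDl !mul1r mulNr.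
move: (i%:R * c)%R (l%:R * c)%R (K%:R)%R => u v k; move: {+}c => {}c /andP[h1 h2] /andP[h3 h4].
by rewrite ltr_norml; apply/andP; split; lra.
Qed.

End grid.
Arguments grid_cell : clear implicits.

Section L1_closure.
Context d (T : measurableType d) (R : realType) (P : probability T R).
Variables (lambda : R) (X : nat -> {RV P >-> R}).
Hypotheses (lambda_gt0 : (0 < lambda)%R) (PPP_X : homogeneous_PPP P lambda X).

Local Notation leb := (@lebesgue_measure R).
Local Notation RR := (measurableTypeR R * measurableTypeR R)%type.

Variables (A W : set R).
Hypotheses (mA : measurable A) (mW : measurable W) (Woo : leb W < +oo).

Lemma palm_laplace_L1_closed (f : RR -> \bar R) :
  measurable_fun setT f -> (forall p, 0 <= f p) ->
  (forall e : R, (0 < e)%R -> exists g h : RR -> \bar R,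
    [/\ measurable_fun setT g, measurable_fun setT h, forall p, 0 <= g p & forall p, 0 <= h p] /\
    [/\ forall p, ~ (W `*` W) p -> h p = 0,
        forall z y, A z -> f (z, y) <= g (z, y) + h (z, y),
        forall z y, A z -> g (z, y) <= f (z, y) + h (z, y),
        palm_laplace P X A g = poisson_palm_laplace lambda A g &
        \int[leb \x leb]_p h p <= e%:E]) ->
  palm_laplace P X A f = poisson_palm_laplace lambda A f.
Proof.
move=> mf f0 approx.
have l2 : (0 < lambda ^+ 2)%R by rewrite exprn_gt0.
apply/eqP; rewrite eq_le; apply/andP; split; apply/lee_addgt0Pr => e e0.
(* Passing from [f] to [g] on one side of the formula and back from [g] to [f] on the other costs
   [lambda^2] times the integral of [h] each time, hence half of [e] for each. *)
all: have e'0 : (0 < e / 2 / lambda ^+ 2)%R by rewrite !divr_gt0.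
all: have [g [h [[mg mh g0 h0] [hW fgh gfh Eg he]]]] := approx _ e'0.
all: have e2E : (lambda ^+ 2)%:E * (e / 2 / lambda ^+ 2)%:E = (e / 2)%:E :> \bar R
  by rewrite -EFinM mulrC divfK// gt_eqF.
all: have he2 : (lambda ^+ 2)%:E * \int[leb \x leb]_p h p <= (e / 2)%:E
  by rewrite -e2E; apply: lee_wpmul2l => //; rewrite lee_fin ltW.
all: have -> : e%:E = (e / 2)%:E + (e / 2)%:E by rewrite -EFinD -splitr.
all: rewrite addeA.
- apply: (le_trans (palm_laplace_lipschitz lambda_gt0 PPP_X mA mW Woo mg mf mh g0 f0 h0 hW gfh)).
  apply: leeD => //; rewrite Eg.
  apply: (le_trans (poisson_palm_laplace_lipschitz lambda_gt0 mA mf mg mh f0 g0 h0 fgh)).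
  exact: leeD.
- apply: (le_trans (poisson_palm_laplace_lipschitz lambda_gt0 mA mg mf mh g0 f0 h0 gfh)).
  apply: leeD => //; rewrite -Eg.
  apply: (le_trans (palm_laplace_lipschitz lambda_gt0 PPP_X mA mW Woo mf mg mh f0 g0 h0 hW fgh)).
  exact: leeD.
Qed.

End L1_closure.

Section continuous_shift.
Context d (T : measurableType d) (R : realType) (P : probability T R).
Variables (lambda : R) (X : nat -> {RV P >-> R}).
Hypotheses (lambda_gt0 : (0 < lambda)%R) (PPP_X : homogeneous_PPP P lambda X).

Local Notation leb := (@lebesgue_measure R).
Local Notation RR := (measurableTypeR R * measurableTypeR R)%type.

Lemma measurable_diagonal : measurable [set p : RR | p.1 = p.2].
Proof.
have -> : [set p : RR | p.1 = p.2] = [set: RR] `&` (fun p : RR => p.1 == p.2) @^-1` [set true].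
  by rewrite setTI; apply/seteqP; split => p /= /eqP.
exact: (@measurable_fun_eqr _ RR R setT fst snd).
Qed.

(* Discarding the diagonal cells is harmless: errors need only converge off
   the diagonal. *)
Lemma lebesgue_diagonal : (leb \x leb) [set p : RR | p.1 = p.2] = 0.
Proof.
rewrite /product_measure1/= integral0_eq// => z _ /=.
rewrite (_ : xsection _ _ = [set z]) ?lebesgue_measure_set1//.
by apply/seteqP; split => y; rewrite /xsection/= inE.
Qed.

Variables (psi : R -> R) (x : R) (K : nat) (A : set R).
Hypotheses (psi_cont : continuous psi) (psi_ge0 : forall t, (0 <= psi t)%R).
Local Notation W := (`[(- K%:R)%R, (K%:R)%R[%classic : set R).
Hypotheses (mA : measurable A) (AW : A `<=` W).

Let cells m := (2 * K * m.+1)%N.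

(** The shift kernel evaluated at the left endpoints of the two cells, with the zero diagonal that
    [palm_laplace_step] demands. *)
Let a m (i l : 'I_(cells m)) : R :=
  if i == l then 0%R else psi ((l%:R - i%:R) / m.+1%:R + x)%R.

Let G m (p : RR) : R :=
  (\sum_(i < cells m) (\sum_(l < cells m) a i l * \1_(grid_cell R K m l) p.2) *
     \1_(grid_cell R K m i) p.1)%R.

Let a_ge0 m (i l : 'I_(cells m)) : (0 <= a i l)%R.
Proof. by rewrite /a; case: ifP. Qed.

Let sum_cell m (b : 'I_(cells m) -> R) (l : 'I_(cells m)) y : grid_cell R K m l y ->
  (\sum_(i < cells m) b i * \1_(grid_cell R K m i) y = b l)%R.
Proof.
move=> ly; rewrite (bigD1 l)//= indicE mem_set// mulr1 big1 ?addr0// => i il.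
rewrite indicE memNset ?mulr0// => iy; move/eqP: il; apply; apply: val_inj.
exact: grid_cell_inj iy ly.
Qed.

Let measurable_cell m l : measurable (grid_cell R K m l).
Proof. exact: measurable_itv. Qed.

Let G_ge0 m p : (0 <= G m p)%R.
Proof.
apply: sumr_ge0 => i _; rewrite mulr_ge0//; apply: sumr_ge0 => l _.
by rewrite mulr_ge0.
Qed.

Let measurable_G m : measurable_fun setT (G m).
Proof.
have m1 l : measurable_fun setT (fun p : RR => \1_(grid_cell R K m l) p.1 : R).
  by apply: (@measurable_indic_comp _ RR R _ fst).
have m2 l : measurable_fun setT (fun p : RR => \1_(grid_cell R K m l) p.2 : R).
  by apply: (@measurable_indic_comp _ RR R _ snd).
apply: measurable_sum => i; apply: measurable_funM => //.
by apply: measurable_sum => l; exact: measurable_funM.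
Qed.

Let Woo : leb W < +oo.
Proof. by rewrite lebesgue_measure_itv/=; case: ifP => //; rewrite ltry. Qed.

Let G_out m z y : ~ W y -> G m (z, y) = 0%R.
Proof.
move=> Wy; rewrite /G big1// => i _; rewrite big1 ?mul0r// => l _.
by rewrite indicE memNset ?mulr0// => /grid_cell_sub h; apply: Wy; exact: h.
Qed.

Let palm_G m : palm_laplace P X A (EFin \o G m) = poisson_palm_laplace lambda A (EFin \o G m).
Proof.
apply: (@palm_laplace_step _ _ _ _ _ _ lambda_gt0 PPP_X (cells m)
   (fun l => grid_cell R K m l) (@a m)) => //.
- move=> l; rewrite lebesgue_measure_itv/=; case: ifP => // _.
  by rewrite -EFinD ltry.
- apply/trivIsetP => i l _ _ il; apply/seteqP; split => // y [iy ly].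
  move/eqP: il; apply; apply: val_inj; exact: grid_cell_inj iy ly.
- by move=> i; rewrite /a eqxx.
- move=> z /AW /(grid_cellP m)[l lK lz]; exists (Ordinal lK) => //.
- move=> i z y iz /=; congr EFin.
  by rewrite /G/= (sum_cell (fun i => \sum_(l < cells m) a i l * \1_(grid_cell R K m l) y)%R iz).
Qed.

(** For [y] and [z] in the window, [y - z] lies within [2 K] of 0, and the difference of left
    endpoints is off by less than one mesh, at most 1. Hence the radius [2 K + 1], valid for all
    meshes at once. *)
Let bound : exists2 C : R, (0 <= C)%R &
  forall t, (x - (2 * K%:R + 1) <= t <= x + (2 * K%:R + 1))%R -> (psi t <= C)%R.
Proof.
have le : (x - (2 * K%:R + 1) <= x + (2 * K%:R + 1))%R.
  have : (0 <= K%:R :> R)%R by []; lra.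
have [c _ hc] := EVT_max le (continuous_subspaceT psi_cont).
by exists (psi c) => // t tI; apply: hc; rewrite in_itv.
Qed.

Let F (p : RR) : R := psi (p.2 - p.1 + x)%R.

Let measurable_F : measurable_fun setT F.
Proof.
have mpsi : measurable_fun setT psi by exact: continuous_measurable_fun.
apply: (measurableT_comp mpsi); apply: measurable_funD => //; exact: measurable_funB.
Qed.

Let err m (p : RR) : \bar R := `|F p - G m p|%:E.

Let G_cell m (z y : R) : W z -> W y -> exists i l : 'I_(cells m),
  [/\ grid_cell R K m i z, grid_cell R K m l y & G m (z, y) = a i l].
Proof.
move=> /(grid_cellP m)[i iK iz] /(grid_cellP m)[l lK ly].
exists (Ordinal iK), (Ordinal lK); split => //.
rewrite /G/= (@sum_cell m (fun i => \sum_(l < cells m) a i l * \1_(grid_cell R K m l) y)%R (Ordinal iK) z iz).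
exact: (@sum_cell m (fun l => a (Ordinal iK) l) (Ordinal lK) y ly).
Qed.

Let cvg_err (z y : R) : W z -> W y -> z != y -> err m (z, y) @[m --> \oo] --> 0.
Proof.
move=> Wz Wy zy; apply/fine_cvgP; split; first exact: nearW.
apply/cvgrPdist_le => e e0 /=.
have /cvgrPdist_le/(_ _ e0)/nbhs_ballP[r /= r0 hr] := @psi_cont (y - z + x)%R.
(* A mesh below [|y - z|] separates the cells of [z] and [y], so the artificial zero of the diagonal
   is not seen; a mesh below [r] lets continuity of [psi] act. *)
have d0 : (0 < Num.min r `|y - z|)%R.
  by rewrite lt_min r0 normr_gt0 subr_eq0 eq_sym.
apply: filterS (near_infty_natSinv_lt (PosNum d0)) => m /=.
rewrite lt_min => /andP[mr mzy].
have [i [l [iz ly ->]]] := G_cell m Wz Wy.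
have dil := grid_cell_dist iz ly.
rewrite sub0r normrN normr_id /F/= /a ifN; last first.
  apply: contraTneq mzy => il; move: dil; rewrite il subrr mul0r sub0r normrN.
  by rewrite -leNgt => /ltW.
apply: hr; rewrite /ball/= (le_lt_trans _ mr)//.
rewrite distrC (le_trans _ (ltW dil))// le_eqVlt; apply/orP; left; apply/eqP.
by congr (`| _ |)%R; ring.
Qed.

Let err_bound : exists C : R, forall (z y : R) m, W z -> W y -> err m (z, y) <= C%:E.
Proof.
have [C C0 hC] := bound; exists (C + C)%R => z y m Wz Wy.
have [i [l [iz ly Gil]]] := G_cell m Wz Wy.
have dil := grid_cell_dist iz ly.
move: Wz Wy; rewrite /= !in_itv/= => /andP[z1 z2] /andP[y1 y2].
rewrite lee_fin (le_trans (ler_normB _ _))// lerD//.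
  rewrite ger0_norm ?psi_ge0// hC//=; apply/andP; split; lra.
rewrite Gil ger0_norm ?a_ge0// /a; case: ifP => // _; rewrite hC//.
have m1 : (m.+1%:R^-1 <= 1 :> R)%R by rewrite invf_le1// ler1n.
suff aux (k u c : R) : (- k <= z -> z < k -> - k <= y -> y < k -> `|u - (y - z)| < c -> c <= 1 ->
    x - (2 * k + 1) <= u + x <= x + (2 * k + 1))%R by exact: (aux K%:R _ _ z1 z2 y1 y2 dil m1).
by rewrite ltr_norml => ? ? ? ? /andP[? ?] ?; apply/andP; split; lra.
Qed.

Lemma palm_laplace_continuous_shift :
  palm_laplace P X A (fun p => (psi (p.2 - p.1 + x) * \1_W p.2)%:E) =
  poisson_palm_laplace lambda A (fun p => (psi (p.2 - p.1 + x) * \1_W p.2)%:E).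
Proof.
have mW : measurable (W : set (measurableTypeR R)) by exact: measurable_itv.
have mWW : measurable (W `*` W : set RR) by exact: measurableX.
have merr m : measurable_fun setT (err m).
  apply/measurable_EFinP; apply: measurableT_comp => //; exact: measurable_funB.
have cvgI : \int[leb \x leb]_(p in W `*` W) err m p @[m --> \oo] --> 0.
  have [C hC] := err_bound.
  have := @dominated_convergence _ _ _ (leb \x leb) (W `*` W) mWW err (cst 0) (cst C%:E).
  case=> //.
  - by move=> m; exact: measurable_funTS.
  - exists [set p : RR | p.1 = p.2]; split.
    + exact: measurable_diagonal.
    + exact: lebesgue_diagonal.
    + move=> [z y] /= hp; apply: contrapT => /eqP pd; apply: hp => -[Wz Wy]; exact: cvg_err.
  - apply: (@measurable_bounded_integrable _ _ _ (leb \x leb) (cst C)) => //.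
    + suff : (leb \x leb) (W `*` W) < +oo by [].
      by rewrite product_measure1E// lte_mul_pinfty ?ge0_fin_numE.
    + by exists `|C|%R; split => // M CM p _ /=; rewrite ltW.
  - by apply: aeW => -[z y] m [Wz Wy]; rewrite gee0_abs ?hC// lee_fin.
  - by move=> _ _; rewrite integral0.
apply: (@palm_laplace_L1_closed _ _ _ _ _ _ lambda_gt0 PPP_X A W mA mW Woo).
- apply/measurable_EFinP/measurable_funM => //.
  by apply: (@measurable_indic_comp _ RR R _ snd).
- by move=> p; rewrite lee_fin mulr_ge0.
move=> e e0.
have [m he] : exists m, \int[leb \x leb]_(p in W `*` W) err m p <= e%:E.
  move/fine_cvgP : cvgI => [[N1 _ fin]].
  move/cvgrPdist_le => /(_ _ e0)[N2 _ hN]; exists (maxn N1 N2).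
  have fI := fin (maxn N1 N2) (leq_maxl _ _).
  have := hN (maxn N1 N2) (leq_maxr _ _); rewrite /= sub0r normrN => he.
  by rewrite -(fineK fI) lee_fin (le_trans (ler_norm _)).
(* For [z] in [A], which lies in [W], and [y] outside [W], both kernels vanish, so the error may be
   cut to the window. *)
exists (EFin \o G m), (err m \_ (W `*` W)).
have h0 p : 0 <= (err m \_ (W `*` W)) p.
  by rewrite patchE; case: ifP => // _; rewrite lee_fin.
split; split.
- exact/measurable_EFinP.
- by apply/(measurable_restrictT _ _).1 => //; exact: measurable_funTS.
- by move=> p; rewrite lee_fin.
- exact: h0.
- by move=> p Wp; rewrite patchE memNset.
- move=> z y /AW Az /=; have [Wy|Wy] := pselect (W y).
    rewrite patchE mem_set// indicE mem_set// mulr1 -EFinD lee_fin /F/=.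
    have := ler_norm (psi (y - z + x) - G m (z, y))%R; lra.
  by rewrite [\1_W y]indicE memNset// mulr0 adde_ge0// lee_fin.
- move=> z y /AW Az /=; have [Wy|Wy] := pselect (W y).
    rewrite patchE mem_set// indicE mem_set// mulr1 -EFinD lee_fin /F/=.
    have := ler_norm (G m (z, y) - psi (y - z + x))%R; rewrite distrC; lra.
  by rewrite G_out// adde_ge0// lee_fin mulr_ge0.
- exact: palm_G.
- by rewrite -integral_mkcond.
Qed.

End continuous_shift.

(** * Translation invariance and bounded measurable kernels *)

Section lebesgue_shift.
Context (R : realType) (c : R).
Local Notation leb := (@lebesgue_measure R).
Local Notation mR := (measurableTypeR R).

Let shift (y : mR) : mR := (y + c)%R.

Let measurable_shift : measurable_fun setT shift.
Proof.
have : measurable_fun setT (fun y : R => y + c)%R by exact: measurable_funD.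
by [].
Qed.

Let shift_mixin := isMeasurableFun.Build _ _ _ _ _ measurable_shift.
Let shift_mfun : {mfun mR >-> mR} := HB.pack shift shift_mixin.

Let lebesgue_measure_shift (A : set mR) : measurable A -> pushforward leb shift_mfun A = leb A.
Proof.
move=> mA; apply/esym/lebesgue_measure_unique => //= _ [[a b]] _ <-.
rewrite /pushforward (_ : _ @^-1` _ = `](a - c)%R, (b - c)%R]%classic); last first.
  by apply/seteqP; split => y /=; rewrite !in_itv/= /shift ltrBlDr lerBrDr.
rewrite !lebesgue_measure_itv/= !lte_fin ltrD2r.
by case: ifP => // _; congr EFin; ring.
Qed.

Lemma ge0_integral_lebesgue_shift (f : mR -> \bar R) :
  measurable_fun setT f -> (forall y, 0 <= f y) ->
  \int[leb]_y f (y + c)%R = \int[leb]_y f y.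
Proof.
move=> mf f0.
rewrite [RHS](eq_measure_integral (pushforward leb shift_mfun)).
  by rewrite ge0_integral_pushforward.
by move=> A mA _; exact/esym/lebesgue_measure_shift.
Qed.

Lemma ge0_integral_lebesgueN (f : mR -> \bar R) :
  measurable_fun setT f -> (forall y, 0 <= f y) ->
  \int[leb]_y f (- y)%R = \int[leb]_y f y.
Proof.
move=> mf f0.
rewrite [RHS](eq_measure_integral (pushforward leb (-%R : _ -> mR))).
  by rewrite ge0_integral_pushforward.
by move=> A mA _; exact/esym/lebesgue_measureN.
Qed.

End lebesgue_shift.

Section bounded_shift.
Context d (T : measurableType d) (R : realType) (P : probability T R).
Variables (lambda : R) (X : nat -> {RV P >-> R}).
Hypotheses (lambda_gt0 : (0 < lambda)%R) (PPP_X : homogeneous_PPP P lambda X).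

Local Notation leb := (@lebesgue_measure R).
Local Notation RR := (measurableTypeR R * measurableTypeR R)%type.

Variables (phi : R -> R) (x : R) (K : nat) (A : set R) (C : R).
Hypotheses (mphi : measurable_fun setT phi) (phi_ge0 : forall t, (0 <= phi t)%R).
Hypothesis phi_le : forall t, (phi t <= C)%R.
Local Notation W := (`[(- K%:R)%R, (K%:R)%R[%classic : set R).
Hypotheses (mA : measurable A) (AW : A `<=` W).

Lemma measurable_shift_indic (u : R -> R) (B : set R) : measurable B -> measurable_fun setT u ->
  measurable_fun setT (fun p : RR => (u (p.2 - p.1 + x) * \1_B p.2)%:E).
Proof.
move=> mB mu; apply/measurable_EFinP/measurable_funM.
  by apply: (measurableT_comp mu); apply: measurable_funD => //; exact: measurable_funB.
by apply: (@measurable_indic_comp _ RR R _ snd).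
Qed.

Lemma palm_laplace_bounded_shift :
  palm_laplace P X A (fun p => (phi (p.2 - p.1 + x) * \1_W p.2)%:E) =
  poisson_palm_laplace lambda A (fun p => (phi (p.2 - p.1 + x) * \1_W p.2)%:E).
Proof.
have mW : measurable W by exact: measurable_itv.
have Woo : leb W < +oo by rewrite lebesgue_measure_itv/=; case: ifP => //; rewrite ltry.
(* [E] contains every [y - z + x] with [y] and [z] in [W], so an approximation of [phi] on [E]
   controls the kernel on the whole window. *)
pose E : set R := `[(x - (2 * K%:R + 1))%R, (x + (2 * K%:R + 1))%R]%classic.
have mE : measurable E by exact: measurable_itv.
have Eoo : leb E < +oo by rewrite lebesgue_measure_itv/=; case: ifP => //; rewrite ltry.
have iphi : leb.-integrable E (EFin \o phi).
  apply: measurable_bounded_integrable => //; first exact: measurable_funTS.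
  exists C; split; first by rewrite num_real.
  by move=> M CM t _ /=; rewrite ger0_norm// (le_trans (phi_le t))// ltW.
have [psi [psi_cont _ cvg_psi]] := approximation_continuous_integrable mE Eoo iphi.
apply: (@palm_laplace_L1_closed _ _ _ _ _ _ lambda_gt0 PPP_X A W mA mW Woo).
- exact: measurable_shift_indic.
- by move=> p; rewrite lee_fin mulr_ge0.
move=> e e0.
have cvgI : (leb W * \int[leb]_(t in E) `|(phi t - psi n t)%:E|) @[n --> \oo] --> 0.
  by rewrite -(mule0 (leb W)); apply: cvgeZl => //; rewrite ge0_fin_numE.
have [n he] : exists n, leb W * \int[leb]_(t in E) `|(phi t - psi n t)%:E| <= e%:E.
  move/fine_cvgP : cvgI => [[N1 _ fin]].
  move/cvgrPdist_le => /(_ _ e0)[N2 _ hN]; exists (maxn N1 N2).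
  have fI := fin (maxn N1 N2) (leq_maxl _ _).
  have := hN (maxn N1 N2) (leq_maxr _ _); rewrite /= sub0r normrN => he.
  by rewrite -(fineK fI) lee_fin (le_trans (ler_norm _)).
(* The continuous approximant may be negative. Its positive part is still continuous and no farther
   from [phi], which is nonnegative. *)
pose psi' t := Num.max (psi n t) 0%R.
have psi'_cont : continuous psi'.
  by move=> t; apply: continuous_max => //; [exact: psi_cont|exact: cst_continuous].
have psi'_ge0 t : (0 <= psi' t)%R by rewrite le_max lexx orbT.
have mpsi' : measurable_fun setT psi' by exact: continuous_measurable_fun.
have psi'_le t : (`|phi t - psi' t| <= `|phi t - psi n t|)%R.
  rewrite /psi'; case: (leP (psi n t) 0%R) => // p0.
  by have := phi_ge0 t => h; rewrite subr0 !ger0_norm//; lra.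
pose h p : \bar R := (`|phi (p.2 - p.1 + x) - psi' (p.2 - p.1 + x)| * \1_(W `*` W) p)%:E.
have mh : measurable_fun setT (h : RR -> \bar R).
  apply/measurable_EFinP/measurable_funM.
    apply: measurableT_comp => //; apply: measurable_funB.
      by apply: (measurableT_comp mphi); apply: measurable_funD => //; exact: measurable_funB.
    by apply: (measurableT_comp mpsi'); apply: measurable_funD => //; exact: measurable_funB.
  by apply: measurable_indic; exact: measurableX.
exists (fun p => (psi' (p.2 - p.1 + x) * \1_W p.2)%:E), h.
have h0 p : 0 <= h p by rewrite lee_fin mulr_ge0.
split; split.
- exact: measurable_shift_indic.
- exact: mh.
- by move=> p; rewrite lee_fin mulr_ge0.
- exact: h0.
- by move=> p Wp; rewrite /h indicE memNset// mulr0.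
- move=> z y /AW Az; rewrite -EFinD lee_fin /=; have [Wy|Wy] := pselect (W y).
    rewrite !indicE mem_set// mem_set// !mulr1.
    have := ler_norm (phi (y - z + x) - psi' (y - z + x))%R; lra.
  by rewrite [\1_W y]indicE memNset// !mulr0 add0r mulr_ge0.
- move=> z y /AW Az; rewrite -EFinD lee_fin /=; have [Wy|Wy] := pselect (W y).
    rewrite !indicE mem_set// mem_set// !mulr1.
    have := ler_norm (psi' (y - z + x) - phi (y - z + x))%R; rewrite distrC; lra.
  by rewrite [\1_W y]indicE memNset// !mulr0 add0r mulr_ge0.
- exact: (palm_laplace_continuous_shift lambda_gt0 PPP_X).
rewrite fubini_tonelli1//; apply: le_trans he.
pose u t : \bar R := `|(phi t - psi n t)%:E| * (\1_E t)%:E.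
have mu : measurable_fun setT u.
  apply: emeasurable_funM; last exact/measurable_EFinP/measurable_indic.
  apply: measurableT_comp => //; apply/measurable_EFinP/measurable_funB => //.
  exact: continuous_measurable_fun.
have u0 t : 0 <= u t by rewrite mule_ge0// lee_fin.
have -> : \int[leb]_(t in E) `|(phi t - psi n t)%:E| = \int[leb]_t u t.
  rewrite [LHS]integral_mkcond; apply: eq_integral => t _; rewrite patchE /u indicE.
  by case: ifP; rewrite ?mule1 ?mule0.
have I0 : 0 <= \int[leb]_t u t by exact: integral_ge0.
(* After translating [y] by [x - z], the inner integral of [h] is bounded by the integral of [u]
   whatever [z] is; integrating this constant over [W] gives the factor [leb W]. *)
rewrite muleC -(integral_cst leb mW (\int[leb]_t u t)) [leRHS]integral_mkcond.
apply: ge0_le_integral => //.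
- by move=> z _; apply: integral_ge0 => y _; exact: h0.
- exact: (@measurable_fun_fubini_tonelli_F _ _ _ _ _ leb h).
- by apply/(measurable_restrictT _ _).1.
move=> z _; rewrite patchE; case: ifPn => [/set_mem Wz|/negP Wz]; last first.
  rewrite /fubini_F integral0_eq// => y _; rewrite /h indicE memNset ?mulr0// => -[/= Wz' _].
  by apply: Wz; rewrite inE.
rewrite /cst -(ge0_integral_lebesgue_shift (x - z) mu u0).
apply: ge0_le_integral => //.
- exact: (measurable_fun_pair2 z mh).
- apply: (measurableT_comp mu).
  have : measurable_fun setT (fun y : R => y + (x - z))%R by exact: measurable_funD.
  by [].
move=> y _; rewrite /h /u indicE; have [/set_mem[/= _ Wy]|_] := boolP ((z, y) \in _); last first.
  by rewrite mulr0 mule_ge0// lee_fin.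
rewrite [\1_E _]indicE mem_set.
  by rewrite mulr1 mule1 lee_fin (_ : y + (x - z) = y - z + x)%R ?psi'_le//; ring.
move: Wz Wy; rewrite /E /= !in_itv/= => /andP[z1 z2] /andP[y1 y2]; apply/andP; split; lra.
Qed.

End bounded_shift.

(** * Monotone limits of kernels *)

Section mecke.
Context d (T : measurableType d) (R : realType) (P : probability T R).
Variables (lambda : R) (X : nat -> {RV P >-> R}).
Hypotheses (lambda_gt0 : (0 < lambda)%R) (PPP_X : homogeneous_PPP P lambda X).

Local Notation leb := (@lebesgue_measure R).
Local Notation RR := (measurableTypeR R * measurableTypeR R)%type.

Section complement.
Variable A : set R.
Hypotheses (mA : measurable A) (Aoo : leb A < +oo).

(* Both sides decrease as the kernel increases; their complements increase,
   so that monotone convergence applies. *)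
Let palm_laplaceC (f : RR -> \bar R) := \int[P]_w \sum_(0 <= k <oo)
  ((\1_A (X k w))%:E * (1 - expeR (- \sum_(0 <= j <oo | j != k) f (X k w, X j w)))).

Let poisson_palm_laplaceC (f : RR -> \bar R) := lambda%:E * \int[leb]_(z in A)
  (1 - expeR (- (lambda%:E * \int[leb]_y (1 - expeR (- f (z, y)))))).

Let sum_ge0 (f : RR -> \bar R) k w : (forall p, 0 <= f p) ->
  0 <= \sum_(0 <= j <oo | j != k) f (X k w, X j w).
Proof. by move=> f0; exact: nneseries_ge0. Qed.

Let inner_ge0 (f : RR -> \bar R) z : (forall p, 0 <= f p) ->
  0 <= lambda%:E * \int[leb]_y (1 - expeR (- f (z, y))).
Proof.
move=> f0; apply: mule_ge0; [by rewrite lee_fin ltW|apply: integral_ge0 => y _].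
exact: onem_expeRN_ge0.
Qed.

Let expeRNK (a : \bar R) : 0 <= a -> expeR (- a) + (1 - expeR (- a)) = 1.
Proof. by move=> a0; rewrite addeC subeK// expeRN_fin_num. Qed.

Let palm_laplaceE (f : RR -> \bar R) : measurable_fun setT f -> (forall p, 0 <= f p) ->
  palm_laplace P X A f + palm_laplaceC f = lambda%:E * leb A.
Proof.
move=> mf f0; rewrite -(expectation_point_count lambda_gt0 PPP_X)// -ge0_integralD//; last 4 first.
- by move=> w _; apply: nneseries_ge0 => k _ _; rewrite mule_ge0 ?lee_fin ?expeR_ge0.
- apply: ge0_emeasurable_sum => [k w _ _|k _]; first by rewrite mule_ge0 ?lee_fin ?expeR_ge0.
  exact: palm_term_measurable.
- move=> w _; apply: nneseries_ge0 => k _ _; rewrite mule_ge0 ?lee_fin//.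
  by apply: onem_expeRN_ge0; exact: sum_ge0.
- apply: ge0_emeasurable_sum => [k w _ _|k _].
    by rewrite mule_ge0 ?lee_fin// onem_expeRN_ge0// sum_ge0.
  apply: emeasurable_funM; first exact: measurable_RV_indic.
  by apply: measurable_onem_expeRN; exact: measurable_pair_sum.
apply: eq_integral => w _; rewrite -nneseriesD; last 2 first.
- by move=> k _ _; rewrite mule_ge0 ?lee_fin ?expeR_ge0.
- by move=> k _ _; rewrite mule_ge0 ?lee_fin// onem_expeRN_ge0// sum_ge0.
apply: eq_eseriesr => k _.
rewrite -ge0_muleDr ?expeR_ge0//; last by rewrite onem_expeRN_ge0// sum_ge0.
by rewrite expeRNK ?mule1// sum_ge0.
Qed.

Let mouter (f : RR -> \bar R) : measurable_fun setT f -> (forall p, 0 <= f p) ->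
  measurable_fun setT (fun z => lambda%:E * \int[leb]_y (1 - expeR (- f (z, y)))).
Proof. by move=> mf f0; apply: measurable_funeM; exact: poisson_inner_measurable. Qed.

Let poisson_palm_laplaceE (f : RR -> \bar R) : measurable_fun setT f -> (forall p, 0 <= f p) ->
  poisson_palm_laplace lambda A f + poisson_palm_laplaceC f = lambda%:E * leb A.
Proof.
move=> mf f0; rewrite -ge0_muleDr; last 2 first.
- by apply: integral_ge0 => z _; exact: expeR_ge0.
- by apply: integral_ge0 => z _; apply: onem_expeRN_ge0; exact: inner_ge0.
congr (_ * _); rewrite -ge0_integralD//; last 4 first.
- by move=> z _; exact: expeR_ge0.
- apply: measurable_funTS; apply: measurableT_comp; first exact: measurable_expeR.
  by apply: measurableT_comp => //; exact: mouter.
- by move=> z _; apply: onem_expeRN_ge0; exact: inner_ge0.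
- by apply: measurable_funTS; apply: measurable_onem_expeRN; exact: mouter.
under eq_integral do rewrite expeRNK ?inner_ge0//.
by rewrite integral_cst// mul1e.
Qed.

Let cvg_onem_expeRN (u : nat -> \bar R) (l : \bar R) : 0 <= l ->
  u @ \oo --> l -> 1 - expeR (- u n) @[n --> \oo] --> 1 - expeR (- l).
Proof.
move=> l0 ul; apply: cvgeB; first by rewrite fin_num_adde_defr.
  exact: cvg_cst.
exact: cvg_expeRN.
Qed.

Let onem_expeRN_nd (a b : \bar R) : a <= b -> 1 - expeR (- a) <= 1 - expeR (- b).
Proof. by move=> ab; rewrite leeB// lee_expeR leeN2. Qed.

Lemma palm_laplace_nondecreasing_cvg (f_ : nat -> RR -> \bar R) (f : RR -> \bar R) :
  (forall n, measurable_fun setT (f_ n)) -> (forall n p, 0 <= f_ n p) ->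
  (forall p, {homo f_^~ p : m n / (m <= n)%N >-> m <= n}) ->
  (forall p, f_ n p @[n --> \oo] --> f p) ->
  (forall n, palm_laplace P X A (f_ n) = poisson_palm_laplace lambda A (f_ n)) ->
  palm_laplace P X A f = poisson_palm_laplace lambda A f.
Proof.
move=> mf_ f_0 ndf_ f_f f_E.
have mf : measurable_fun setT f.
  by apply: (emeasurable_fun_cvg f_) => // p _; exact: f_f.
have f0 p : 0 <= f p.
  by rewrite -(cvg_lim _ (f_f p))//; apply: lime_ge; [exact: cvgP (f_f p)|exact: nearW].
have lA : lambda%:E * leb A \is a fin_num by rewrite fin_numM// ge0_fin_numE.
have palmC0 (g : RR -> \bar R) : (forall p, 0 <= g p) -> 0 <= palm_laplaceC g.
  move=> g0; apply: integral_ge0 => w _; apply: nneseries_ge0 => k _ _.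
  by rewrite mule_ge0 ?lee_fin// onem_expeRN_ge0// sum_ge0.
have poissonC0 (g : RR -> \bar R) : (forall p, 0 <= g p) -> 0 <= poisson_palm_laplaceC g.
  move=> g0; apply: mule_ge0; [by rewrite lee_fin ltW|apply: integral_ge0 => z _].
  by apply: onem_expeRN_ge0; exact: inner_ge0.
have palm0 (g : RR -> \bar R) : (forall p, 0 <= g p) -> 0 <= palm_laplace P X A g.
  move=> g0; apply: integral_ge0 => w _; apply: nneseries_ge0 => k _ _.
  by rewrite mule_ge0 ?lee_fin// expeR_ge0.
have poisson0 (g : RR -> \bar R) : (forall p, 0 <= g p) -> 0 <= poisson_palm_laplace lambda A g.
  move=> g0; apply: mule_ge0; [by rewrite lee_fin ltW|apply: integral_ge0 => z _; exact: expeR_ge0].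
(* On each side, the functional and its complement add up to [lambda |A|], which is finite. Equality
   therefore passes from the functionals to the complements for each [f_ n], and back again for the
   limit [f]. *)
have cancel (a b c e : \bar R) : 0 <= a -> 0 <= b -> 0 <= c -> 0 <= e ->
    a + b = lambda%:E * leb A -> c + e = lambda%:E * leb A -> a = c -> b = e.
  move=> a0 b0 c0 e0 ab ce ac.
  have fa : a \is a fin_num.
    by rewrite ge0_fin_numE// (@le_lt_trans _ _ (a + b))// ?leeDl// ab ltey_eq lA.
  rewrite -[LHS](addeK _ fa) -[RHS](addeK _ fa); congr (_ - _).
  by rewrite addeC ab [RHS]addeC ac ce.
have E_ n : palm_laplaceC (f_ n) = poisson_palm_laplaceC (f_ n).
  apply: (cancel _ _ _ _ (palm0 _ (f_0 n)) (palmC0 _ (f_0 n)) (poisson0 _ (f_0 n))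
     (poissonC0 _ (f_0 n)) (palm_laplaceE (mf_ n) (f_0 n)) (poisson_palm_laplaceE (mf_ n) (f_0 n))).
  exact: f_E.
have cvg1 : palm_laplaceC (f_ n) @[n --> \oo] --> palm_laplaceC f.
  pose F n w := \sum_(0 <= k <oo) ((\1_A (X k w))%:E *
    (1 - expeR (- \sum_(0 <= j <oo | j != k) f_ n (X k w, X j w)))).
  have F0 n k w : 0 <= (\1_A (X k w))%:E *
    (1 - expeR (- \sum_(0 <= j <oo | j != k) f_ n (X k w, X j w))).
    by rewrite mule_ge0 ?lee_fin// onem_expeRN_ge0// sum_ge0.
  have ndF k w : {homo (fun n => (\1_A (X k w))%:E *
      (1 - expeR (- \sum_(0 <= j <oo | j != k) f_ n (X k w, X j w)))) :
      m n / (m <= n)%N >-> m <= n}.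
    move=> m n mn; apply: lee_wpmul2l; first by rewrite lee_fin.
    by apply: onem_expeRN_nd; apply: lee_nneseries => // j _; exact: ndf_.
  rewrite [X in _ --> X](_ : _ = \int[P]_w limn (F ^~ w)); last first.
    apply: eq_integral => w _; apply/esym/cvg_lim => //.
    apply: nneseries_monotone_cvg => // k.
    apply: cvgeZl => //; apply: cvg_onem_expeRN; first exact: sum_ge0.
    by apply: nneseries_monotone_cvg.
  apply: cvg_monotone_convergence => //.
  - move=> n; apply: ge0_emeasurable_sum => // k _.
    apply: emeasurable_funM; first exact: measurable_RV_indic.
    by apply: measurable_onem_expeRN; exact: measurable_pair_sum.
  - by move=> n w _; apply: nneseries_ge0.
  - by move=> w _ m n mn; apply: lee_nneseries => // k _; exact: ndF.
have cvg2 : poisson_palm_laplaceC (f_ n) @[n --> \oo] --> poisson_palm_laplaceC f.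
  apply: cvgeZl => //.
  have nd1 z : {homo (fun n => lambda%:E * \int[leb]_y (1 - expeR (- f_ n (z, y)))) :
      m n / (m <= n)%N >-> m <= n}.
    move=> m n mn; apply: lee_wpmul2l; first by rewrite lee_fin ltW.
    apply: ge0_le_integral => //.
    - by move=> y _; exact: onem_expeRN_ge0.
    - by apply: measurable_onem_expeRN; exact: (measurable_fun_pair2 z (mf_ m)).
    - by apply: measurable_onem_expeRN; exact: (measurable_fun_pair2 z (mf_ n)).
    - by move=> y _; apply: onem_expeRN_nd; exact: ndf_.
  rewrite [X in _ --> X](_ : _ = \int[leb]_(z in A) limn (fun n =>
      1 - expeR (- (lambda%:E * \int[leb]_y (1 - expeR (- f_ n (z, y))))))); last first.
    apply: eq_integral => z _; apply/esym/cvg_lim => //.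
    apply: cvg_onem_expeRN; first exact: inner_ge0.
    apply: cvgeZl => //.
    rewrite [X in _ --> X](_ : _ = \int[leb]_y limn (fun n => 1 - expeR (- f_ n (z, y)))); last first.
      apply: eq_integral => y _; apply/esym/cvg_lim => //; exact: cvg_onem_expeRN.
    apply: cvg_monotone_convergence => //.
    - by move=> n; apply: measurable_onem_expeRN; exact: (measurable_fun_pair2 z (mf_ n)).
    - by move=> n y _; exact: onem_expeRN_ge0.
    - by move=> y _ m n mn; apply: onem_expeRN_nd; exact: ndf_.
  apply: cvg_monotone_convergence => //.
  - by move=> n; apply: measurable_funTS; apply: measurable_onem_expeRN; exact: mouter.
  - by move=> n z _; apply: onem_expeRN_ge0; exact: inner_ge0.
  - by move=> z _ m n mn; apply: onem_expeRN_nd; exact: nd1.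
have E : palm_laplaceC f = poisson_palm_laplaceC f.
  apply: (cvg_unique _ cvg1) => //.
  by rewrite (_ : (fun n => _) = fun n => poisson_palm_laplaceC (f_ n)) //; apply/funext.
apply: (cancel _ _ _ _ (palmC0 _ f0) (palm0 _ f0) (poissonC0 _ f0) (poisson0 _ f0)) => //.
- by rewrite addeC palm_laplaceE.
- by rewrite addeC poisson_palm_laplaceE.
Qed.

End complement.
End mecke.

(** * Truncation and kernels with values in [0, +oo] *)

Section truncation.
Context (R : realType).

(** The same number [n + 2] serves as cap and as half-width of the window. The window is open on the
    right and has to contain the point 1 of [[0, 1]] already for [n = 0], hence 2 rather than 1. *)
Definition etrunc (n : nat) (a : \bar R) : R := fine (mine a n.+2%:R%:E).

Lemma etruncK n a : 0 <= a -> (etrunc n a)%:E = mine a n.+2%:R%:E.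
Proof.
move=> a0; rewrite /etrunc fineK// ge0_fin_numE; last by rewrite le_min a0 lee_fin ler0n.
by rewrite gt_min ltry orbT.
Qed.

Lemma etrunc_ge0 n a : 0 <= a -> (0 <= etrunc n a)%R.
Proof. by move=> a0; rewrite -lee_fin etruncK// le_min a0 lee_fin ler0n. Qed.

Lemma etrunc_le n a : 0 <= a -> (etrunc n a <= n.+2%:R)%R.
Proof. by move=> a0; rewrite -lee_fin etruncK// ge_min lexx orbT. Qed.

Lemma etrunc_nd a : 0 <= a -> {homo etrunc^~ a : m n / (m <= n)%N >-> (m <= n)%R}.
Proof.
move=> a0 m n mn; rewrite -lee_fin !etruncK// le_min2// lee_fin ler_nat !ltnS//.
Qed.

Lemma measurable_etrunc n : measurable_fun setT (etrunc n).
Proof.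
by apply: measurableT_comp; [exact: fine_measurable|exact: measurable_mine].
Qed.

Lemma cvg_etrunc_window (a : \bar R) (y : R) : 0 <= a ->
  (etrunc n a * \1_(`[(- n.+2%:R)%R, (n.+2%:R)%R[%classic) y)%:E @[n --> \oo] --> a.
Proof.
move=> a0.
have yW : \forall n \near \oo, \1_(`[(- n.+2%:R)%R, (n.+2%:R)%R[%classic) y = 1%R :> R.
  exists (Num.truncn `|y|).+1 => // n /= yn; rewrite indicE mem_set//= in_itv/=.
  have : (`|y| < n.+2%:R)%R.
    rewrite (lt_le_trans (truncnS_gt _))// ler_nat; apply: leq_trans yn _.
    by rewrite -addn2 leq_addr.
  by rewrite ltr_norml => /andP[/ltW -> ->].
case: a a0 => [r| |]//= r0.
  apply: cvg_near_cst.
  have rn : \forall n \near \oo, (r <= n.+2%:R)%R.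
    exists (Num.truncn r).+1 => // n /= rn.
    rewrite (le_trans (ltW (truncnS_gt _)))// ler_nat; apply: leq_trans rn _.
    by rewrite -addn2 leq_addr.
  near=> n; rewrite (near yW n)// mulr1 etruncK// min_l// lee_fin.
  exact: (near rn n).
apply/cvgeyPge => M.
have rn : \forall n \near \oo, (M <= n.+2%:R)%R.
  exists (Num.truncn M).+1 => // n /= rn.
  rewrite (le_trans (ltW (truncnS_gt _)))// ler_nat; apply: leq_trans rn _.
  by rewrite -addn2 leq_addr.
near=> n; rewrite (near yW n)// mulr1 etruncK// min_r ?leey// lee_fin.
exact: (near rn n).
Unshelve. all: by end_near. Qed.

End truncation.

Section mecke_shift.
Context d (T : measurableType d) (R : realType) (P : probability T R).
Variables (lambda : R) (X : nat -> {RV P >-> R}).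
Hypotheses (lambda_gt0 : (0 < lambda)%R) (PPP_X : homogeneous_PPP P lambda X).

Local Notation leb := (@lebesgue_measure R).
Local Notation RR := (measurableTypeR R * measurableTypeR R)%type.

Lemma palm_laplace_shift (phi : R -> \bar R) (x : R) :
  measurable_fun setT phi -> (forall t, 0 <= phi t) ->
  palm_laplace P X `[0%R, 1%R]%classic (fun p => phi (p.2 - p.1 + x)%R) =
  lambda%:E * expeR (- (lambda%:E * \int[leb]_y (1 - expeR (- phi y)))).
Proof.
move=> mphi phi0.
pose W n : set R := `[(- n.+2%:R)%R, (n.+2%:R)%R[%classic.
pose phi_ n t := etrunc n (phi t).
pose f_ n (p : RR) := (phi_ n (p.2 - p.1 + x) * \1_(W n) p.2)%:E.
have mphi_ n : measurable_fun setT (phi_ n).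
  by apply: (measurableT_comp _ mphi); exact: measurable_etrunc.
have phi_0 n t : (0 <= phi_ n t)%R by exact: etrunc_ge0.
have I01 : leb `[0%R, 1%R]%classic = 1.
  by rewrite lebesgue_measure_itv/= lte_fin ltr01 oppr0 adde0.
have mI : measurable (`[0%R, 1%R]%classic : set R) by exact: measurable_itv.
rewrite (palm_laplace_nondecreasing_cvg lambda_gt0 PPP_X mI _ (f_ := f_)).
- rewrite /poisson_palm_laplace; congr (_ * _).
  (* By translation invariance the inner integral is the same for every tagged position [z], and
     [[0, 1]] has length one. *)
  rewrite (eq_integral (fun=> expeR (- (lambda%:E * \int[leb]_y (1 - expeR (- phi y)))))).
    transitivity (expeR (- (lambda%:E * \int[leb]_y (1 - expeR (- phi y)))) *
      leb `[0%R, 1%R]%classic); last by rewrite I01 mule1.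
    exact: (integral_cst leb mI).
  move=> z _ /=; congr (expeR (- (_ * _))).
  rewrite -(@ge0_integral_lebesgue_shift _ (x - z) (fun y => 1 - expeR (- phi y))).
  + by apply: eq_integral => y _; congr (1 - expeR (- phi _)); ring.
  + exact: measurable_onem_expeRN.
  + by move=> y; exact: onem_expeRN_ge0.
- by rewrite I01 ltry.
- by move=> n; apply: measurable_shift_indic => //; exact: measurable_itv.
- by move=> n p; rewrite lee_fin mulr_ge0.
- move=> p m n mn; rewrite lee_fin ler_pM//; first exact: etrunc_nd.
  rewrite !indicE ler_nat; case: (boolP (p.2 \in W m)) => // /set_mem pm.
  rewrite mem_set//; move: pm; rewrite /W/= !in_itv/= => /andP[h1 h2].
  have mn' : (m.+2%:R <= n.+2%:R :> R)%R by rewrite ler_nat !ltnS.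
  by rewrite (lt_le_trans h2)// (le_trans _ h1)// lerN2.
- by move=> p; exact: cvg_etrunc_window.
move=> n; apply: (palm_laplace_bounded_shift lambda_gt0 PPP_X _ (C := n.+2%:R)) => //.
- by move=> t; exact: etrunc_le.
- move=> t /=; rewrite !in_itv/= => /andP[t0 t1]; apply/andP; split.
    by rewrite (le_trans _ t0)// oppr_le0.
  by rewrite (le_lt_trans t1)// ltr1n.
Qed.

End mecke_shift.

(** * Integrating over independent sequences *)

Section independent_pair.
Context d (T : measurableType d) (R : realType) (P : probability T R).
Context d1 d2 (S1 : measurableType d1) (S2 : measurableType d2).

Lemma finite_measure_eq_rect (m1 m2 : {measure set (S1 * S2) -> \bar R}) :
  m1 setT < +oo ->
  (forall A B, measurable A -> measurable B -> m1 (A `*` B) = m2 (A `*` B)) ->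
  forall D, measurable D -> m1 D = m2 D.
Proof.
move=> m1oo m12 D mD.
pose C : set (set (S1 * S2)) :=
  [set C | exists A, measurable A /\ exists B, measurable B /\ C = A `*` B].
apply: (measure_unique C (fun=> setT)) => //.
- rewrite measurable_prod_measurableType //; congr (<<s _ >>).
  rewrite predeqE; split => [[A mA [B mB <-]]|[A [mA [B [mB ->]]]]].
    by exists A; split => //; exists B.
  by exists A => //; exists B.
- move=> _ _ [A1 [mA1 [A2 [mA2 ->]]]] [B1 [mB1 [B2 [mB2 ->]]]].
  rewrite -setXI; exists (A1 `&` B1); split; first exact: measurableI.
  by exists (A2 `&` B2); split => //; exact: measurableI.
- by move=> _; exists setT; split => //; exists setT; rewrite setXTT.
- by rewrite bigcup_const.
- by move=> _ [A [mA [B [mB ->]]]]; exact: m12.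
Qed.

(** Independence says that the joint law agrees with the product of the laws on rectangles, hence
    everywhere; the rest is Tonelli. *)
Lemma independent_pair_integral (U : {mfun T >-> S1}) (V : {mfun T >-> S2})
    (F : S1 * S2 -> \bar R) :
  (forall A B, measurable A -> measurable B ->
    P (U @^-1` A `&` V @^-1` B) = P (U @^-1` A) * P (V @^-1` B)) ->
  measurable_fun setT F -> (forall p, 0 <= F p) ->
  \int[P]_w F (U w, V w) = \int[P]_w \int[P]_w' F (U w, V w').
Proof.
move=> UV mF F0.
have mUV : measurable_fun setT (fun w => (U w, V w)) by exact: measurable_fun_pair.
pose UVm := @isMeasurableFun.Build _ _ _ _ _ mUV.
pose UV_mfun : {mfun T >-> (S1 * S2)%type} := HB.pack (fun w => (U w, V w)) UVm.
transitivity (\int[distribution P UV_mfun]_p F p).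
  by rewrite ge0_integral_pushforward.
rewrite (eq_measure_integral (distribution P U \x distribution P V)); last first.
  move=> D mD _; exact/esym/product_measure_unique.
rewrite fubini_tonelli1// /fubini_F.
rewrite ge0_integral_pushforward//=; last 2 first.
- exact: (@measurable_fun_fubini_tonelli_F _ _ _ _ _ (distribution P V) F).
- by move=> u _; apply: integral_ge0.
apply: eq_integral => w _.
by rewrite ge0_integral_pushforward//; exact: (measurable_fun_pair2 (U w) mF).
Qed.

End independent_pair.

Section sequence_space.
Context (R : realType).

(** Generators of the product sigma-algebra. They make a whole sequence of variables one random
    element, whose generated sigma-algebra matches [sigma_generated_by]. *)
Definition coordinate_sets : set (set (nat -> R)) :=
  [set A | exists i B, measurable B /\ A = (fun c : nat -> R => c i) @^-1` B].

Definition seq_space := g_sigma_algebraType coordinate_sets.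

Lemma measurable_coordinate i : measurable_fun setT (fun c : seq_space => c i : R).
Proof.
move=> _ B mB; rewrite setTI; apply: sub_sigma_algebra.
by exists i, B.
Qed.

Context d (T : measurableType d) (P : probability T R).

Lemma measurable_seq (X : nat -> T -> R) : (forall i, measurable_fun setT (X i)) ->
  measurable_fun setT (fun w => (fun i => X i w) : seq_space).
Proof.
move=> mX; apply: (@measurability _ _ _ seq_space setT _ coordinate_sets) => // _ [_ [i [B [mB ->]]] <-].
exact: mX.
Qed.

Lemma sigma_generated_by_preimage (X : nat -> T -> R) (A : set seq_space) : measurable A ->
  sigma_generated_by X ((fun w i => X i w) @^-1` A).
Proof.
move=> mA.
pose G : set (set T) := [set A | exists i B, measurable B /\ A = X i @^-1` B].
have mX : measurable_fun [set: g_sigma_algebraType G] (fun w => (fun i => X i w) : seq_space).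
  apply: (@measurability _ _ _ seq_space setT _ coordinate_sets) => // _ [_ [i [B [mB ->]]] <-].
  by rewrite setTI; apply: sub_sigma_algebra; exists i, B.
by have := mX measurableT A mA; rewrite setTI.
Qed.

End sequence_space.

Section independent_sequences.
Context d (T : measurableType d) (R : realType) (P : probability T R).
Variables X Y H : nat -> {RV P >-> R}.
Hypothesis indep_XYH : independent_sequences3 P X Y H.
Local Notation S := (seq_space R).

Let seq_of (Z : nat -> {RV P >-> R}) (w : T) : S := fun i => Z i w.

Let measurable_seq_of Z : measurable_fun setT (seq_of Z).
Proof. by apply: measurable_seq => i; exact: measurable_funPT. Qed.

Let mixin Z := @isMeasurableFun.Build _ _ _ _ _ (measurable_seq_of Z).
Let seq_mfun Z : {mfun T >-> S} := HB.pack (seq_of Z) (mixin Z).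

Let measurable_pair_seq : measurable_fun setT (fun w => (seq_of X w, seq_of H w)).
Proof. exact: measurable_fun_pair. Qed.

Let pair_mixin := @isMeasurableFun.Build _ _ _ _ _ measurable_pair_seq.
Let pair_mfun : {mfun T >-> (S * S)%type} :=
  HB.pack (fun w => (seq_of X w, seq_of H w)) pair_mixin.

Let indep3 (A B C : set S) : measurable A -> measurable B -> measurable C ->
  P (seq_of X @^-1` A `&` seq_of Y @^-1` B `&` seq_of H @^-1` C) =
  P (seq_of X @^-1` A) * P (seq_of Y @^-1` B) * P (seq_of H @^-1` C).
Proof.
move=> mA mB mC; apply: indep_XYH; exact: sigma_generated_by_preimage.
Qed.

Let indep_XH (A C : set S) : measurable A -> measurable C ->
  P (seq_of X @^-1` A `&` seq_of H @^-1` C) = P (seq_of X @^-1` A) * P (seq_of H @^-1` C).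
Proof.
move=> mA mC; have := indep3 mA measurableT mC.
by rewrite !preimage_setT setIT probability_setT mule1.
Qed.

(** For fixed [B], both sides are finite measures in [D]: the law of [(X, H)] under [P] restricted
    to [Y] in [B], and a multiple of its law under [P]. They agree on rectangles by the threefold
    independence. *)
Let indep_Y_XH (B : set S) (D : set (S * S)) : measurable B -> measurable D ->
  P (seq_of Y @^-1` B `&` pair_mfun @^-1` D) = P (seq_of Y @^-1` B) * P (pair_mfun @^-1` D).
Proof.
move=> mB mD.
have mYB : measurable (seq_of Y @^-1` B) by rewrite -[X in measurable X]setTI; exact: measurable_seq_of.
have fB : P (seq_of Y @^-1` B) \is a fin_num by exact: fin_num_measure.
have c0 : (0 <= fine (P (seq_of Y @^-1` B)))%R by rewrite fine_ge0.
pose pushf : {measure set (S * S) -> \bar R} := pushforward (mrestr P mYB) pair_mfun.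
pose m1 := pushf (measurable_funPT pair_mfun).
pose m2 : {measure set (S * S) -> \bar R} := mscale (NngNum c0) (distribution P pair_mfun).
have E : m1 D = m2 D.
  apply: finite_measure_eq_rect => //.
    rewrite /m1/= /pushforward /mrestr preimage_setT setTI.
    by rewrite (le_lt_trans (probability_le1 P mYB))// ltry.
  move=> A C mA mC.
  transitivity (P ((seq_of X @^-1` A `&` seq_of H @^-1` C) `&` seq_of Y @^-1` B)) => //.
  transitivity ((fine (P (seq_of Y @^-1` B)))%:E * P (seq_of X @^-1` A `&` seq_of H @^-1` C)) => //.
  by rewrite indep_XH// setIAC indep3// fineK// muleAC muleC muleA.
move: E; rewrite /m1 /m2/= /mscale/= /pushforward /mrestr fineK// => E.
by rewrite setIC E.
Qed.

Lemma independent_sequences_integral (F : S * (S * S) -> \bar R) :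
  measurable_fun setT F -> (forall p, 0 <= F p) ->
  \int[P]_w F (fun i => Y i w, (fun i => X i w, fun i => H i w)) =
  \int[P]_w2 \int[P]_w1 \int[P]_w3 F (fun i => Y i w2, (fun i => X i w1, fun i => H i w3)).
Proof.
move=> mF F0.
transitivity (\int[P]_w \int[P]_w' F (seq_of Y w, (seq_of X w', seq_of H w'))).
  by apply: (@independent_pair_integral _ _ _ P _ _ _ _ (seq_mfun Y) pair_mfun F).
apply: eq_integral => w2 _.
apply: (@independent_pair_integral _ _ _ P _ _ _ _ (seq_mfun X) (seq_mfun H)
  (fun p => F (seq_of Y w2, p))) => //.
exact: (measurable_fun_pair2 (seq_of Y w2) mF).
Qed.

End independent_sequences.

(** * Exponential fading *)

Section exponential_fading.
Context d (T : measurableType d) (R : realType) (P : probability T R).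
Variable H : nat -> {RV P >-> R}.
Hypothesis exp_H : iid_exponential_mean1 P H.
Local Notation leb := (@lebesgue_measure R).

Lemma exponential_lt0_null : exists N : set T,
  [/\ measurable N, P N = 0 & forall w, ~ N w -> forall j, (0 <= H j w)%R].
Proof.
pose N j := H j @^-1` (`]-oo, 0%R[%classic : set R).
have mN j : measurable (N j).
  by rewrite -[N j]setTI; apply: (measurable_funPT (H j)) => //; exact: measurable_itv.
have N0 j : P (N j) = 0.
  rewrite (exp_H.1 j)//.
  rewrite /exponential_prob integral0_eq// => y; rewrite /= in_itv/= => y0.
  by rewrite lt0_exponential_pdf.
exists (\bigcup_j N j); split; first exact: bigcupT_measurable.
- apply/eqP; rewrite -measure_le0.
  have := measure_sigma_subadditive P mN (bigcupT_measurable _ mN) (@subset_refl _ _).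
  by move=> /le_trans; apply; rewrite eseries0// => j _ _; exact: N0.
- move=> w Nw j; rewrite leNgt; apply/negP => h; apply: Nw; exists j => //.
Qed.

Lemma laplace_exponential (j : nat) (a : R) : (0 <= a)%R ->
  \int[P]_w expeR (- (a * Num.max (H j w) 0)%:E) = ((1 + a)^-1)%:E.
Proof.
move=> a0.
have a1 : (0 < 1 + a)%R by rewrite ltr_pwDl.
pose f (y : R) : \bar R := expeR (- (a * Num.max y 0)%:E).
have mf : measurable_fun setT f.
  apply: measurableT_comp; first exact: measurable_expeR.
  apply: measurableT_comp => //; apply/measurable_EFinP; apply: measurable_funM => //.
  exact: measurable_maxr.
have f0 y : 0 <= f y by exact: expeR_ge0.
transitivity (\int[distribution P (H j)]_y f y); first by rewrite ge0_integral_pushforward.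
have mpdf r : measurable_fun setT (fun y : R => (exponential_pdf r y)%:E : \bar R).
  by apply/measurable_EFinP; exact: measurable_exponential_pdf.
have pdf0 y : 0 <= (exponential_pdf (1%R : R) y)%:E.
  by rewrite lee_fin exponential_pdf_ge0.
have E := @ge0_integral_weighted _ _ _ leb _ _ (distribution P (H j)) idfun
  (fun y => (exponential_pdf 1%R y)%:E) 1 f.
rewrite -[LHS]mule1 -E//; last 3 first.
- exact: measurable_id.
- exact: mpdf.
- move=> C mC; rewrite mule1.
  transitivity (exponential_prob 1%R C); last exact/esym/(exp_H.1 j C mC).
  rewrite [RHS]integral_mkcond; apply: eq_integral => y _; rewrite patchE indicE.
  by case: ifP => _; rewrite ?mul1e ?mul0e.
(* Exponential tilting: [exp (- a y)] times the density of rate 1 is [1 / (1 + a)] times the density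
   of rate [1 + a]. *)
transitivity (\int[leb]_y (((1 + a)^-1)%:E * (exponential_pdf (1 + a) y)%:E)).
  apply: eq_integral => y _; rewrite /f /=; have [y0|y0] := ltP y 0%R.
    by rewrite !lt0_exponential_pdf// !mule0.
  rewrite !exponential_pdfE// -!EFinM; congr EFin.
  by rewrite mul1r -expRD mulrA mulVf ?gt_eqF// mul1r; congr expR; ring.
rewrite ge0_integralZl//; last 3 first.
- exact: mpdf.
- by move=> y _; rewrite lee_fin exponential_pdf_ge0// ltW.
- by rewrite lee_fin invr_ge0 ltW.
by rewrite integral_exponential_pdf// mule1.
Qed.

(** Partial sums factor by independence, and dominated convergence with bound 1 reaches the series.
    Writing each factor as the exponential of a logarithm puts the result back into the form of a
    Laplace functional of the points. *)
Lemma laplace_exponential_series (s : R) (l : nat -> R) (Q : pred nat) :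
  (0 <= s)%R -> (forall j, 0 <= l j)%R ->
  \int[P]_w expeR (- (s%:E * \sum_(0 <= j <oo | Q j) (Num.max (H j w) 0 * l j)%:E)) =
  expeR (- \sum_(0 <= j <oo | Q j) (ln (1 + s * l j))%:E).
Proof.
move=> s0 l0.
have sl0 j : (0 <= s * l j)%R by rewrite mulr_ge0.
have H0 j w : (0 <= Num.max (H j w) 0 * l j)%R by rewrite mulr_ge0// le_max lexx orbT.
have ln0 j : (0 <= ln (1 + s * l j))%R by rewrite ln_ge0// lerDl.
pose U n w : \bar R := s%:E * \sum_(0 <= j < n | Q j) (Num.max (H j w) 0 * l j)%:E.
have mHj j : measurable_fun setT (fun w => (Num.max (H j w) 0 * l j)%:E).
  by apply/measurable_EFinP; apply: measurable_funM => //; exact: measurable_maxr.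
have U0 n w : 0 <= U n w by rewrite mule_ge0 ?lee_fin// sume_ge0// => j _; rewrite lee_fin.
have mU n : measurable_fun setT (U n).
  apply: measurable_funeM; rewrite [X in measurable_fun _ X](_ : _ = fun w =>
    \sum_(j <- [seq j <- index_iota 0 n | Q j]) (Num.max (H j w) 0 * l j)%:E); last first.
    by apply/funext => w; rewrite big_filter.
  exact: emeasurable_sum.
have E n : \int[P]_w expeR (- U n w) = expeR (- \sum_(0 <= j < n | Q j) (ln (1 + s * l j))%:E).
  rewrite expeR_sum => [|j _]; last by rewrite lee_fin.
  pose f j (y : R) : \bar R := expeR (- (s * l j * Num.max y 0)%:E).
  have mf j : measurable_fun setT (f j).
    apply: measurableT_comp; first exact: measurable_expeR.
    apply: measurableT_comp => //; apply/measurable_EFinP; apply: measurable_funM => //.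
    exact: measurable_maxr.
  have f0 j y : 0 <= f j y by exact: expeR_ge0.
  rewrite -[RHS]big_filter.
  transitivity (\int[P]_w \prod_(j <- [seq j <- index_iota 0 n | Q j]) f j (H j w)).
    apply: eq_integral => w _; rewrite /U ge0_sume_distrr; last by move=> j _; rewrite lee_fin.
    rewrite expeR_sum => [|j _]; last by rewrite mule_ge0 ?lee_fin.
    rewrite big_filter; apply: eq_bigr => j _; rewrite /f -EFinM; congr (expeR (- _%:E)).
    by rewrite mulrCA [LHS]mulrC.
  rewrite (@expectation_prod _ _ _ P _ _ _ (fun j => H j)) //; last 2 first.
  - exact: exp_H.2.
  - by rewrite filter_uniq// iota_uniq.
  apply: eq_bigr => j _; rewrite laplace_exponential//= expRN lnK// posrE ltr_pwDl//.
have cvg1 : \int[P]_w expeR (- U n w) @[n --> \oo] -->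
    \int[P]_w expeR (- (s%:E * \sum_(0 <= j <oo | Q j) (Num.max (H j w) 0 * l j)%:E)).
  have cvU w : expeR (- U n w) @[n --> \oo] -->
      expeR (- (s%:E * \sum_(0 <= j <oo | Q j) (Num.max (H j w) 0 * l j)%:E)).
    apply: cvg_expeRN.
      by rewrite mule_ge0 ?lee_fin// nneseries_ge0// => j _ _; rewrite lee_fin.
    apply: cvgeZl => //; apply: is_cvg_nneseries => j _ _; by rewrite lee_fin.
  have mE n : measurable_fun setT (fun w => expeR (- U n w)).
    by apply: measurableT_comp; [exact: measurable_expeR|exact: measurableT_comp].
  have [] := @dominated_convergence _ _ _ P setT measurableT (fun n w => expeR (- U n w))
    (fun w => expeR (- (s%:E * \sum_(0 <= j <oo | Q j) (Num.max (H j w) 0 * l j)%:E))) (cst 1) => //.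
  - by apply: (emeasurable_fun_cvg (fun n w => expeR (- U n w))) => // w _; exact: cvU.
  - by apply: aeW => w _; exact: cvU.
  - exact: (@finite_measure_integrable_cst _ _ _ P setT 1%R).
  - by apply: aeW => w n _; rewrite gee0_abs ?expeR_ge0// expeRN_le1.
apply: (cvg_unique _ cvg1) => //.
rewrite (_ : (fun n => _) = fun n => expeR (- \sum_(0 <= j < n | Q j) (ln (1 + s * l j))%:E)).
  apply: cvg_expeRN; first by rewrite nneseries_ge0// => j _ _; rewrite lee_fin.
  by apply: is_cvg_nneseries => j _ _; rewrite lee_fin.
by apply/funext => n; exact: E.
Qed.

End exponential_fading.

(** * Blockages, path loss and exclusion *)

Section network_measurability.
Context (R : realType).

Definition is_los (q q' : \bar R) (y : R) : bool :=
  ((0 < y)%R && (y%:E < q)) || ((y < 0)%R && (`|y|%:E < q')).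

Lemma bs_typeE q q' y : bs_type q q' y = if is_los q q' y then LoS else NLoS.
Proof. by []. Qed.

(** A path loss is controlled only on [[0, +oo)]. Clamping its argument at 0 gives a function that
    is nonincreasing on the whole line, hence measurable. *)
Lemma is_path_loss_measurable (l : R -> R) d (T : measurableType d) (V : T -> R) :
  is_path_loss l -> measurable_fun setT V -> measurable_fun setT (fun w => l (Num.max (V w) 0)%R).
Proof.
move=> [l0 _ lni] mV.
suff ml : measurable_fun setT (fun y : R => l (Num.max y 0)%R) by exact: (measurableT_comp ml mV).
apply: nonincreasing_measurable => // y z yz; apply: lni; first by rewrite le_max lexx orbT.
by rewrite ge_max !le_max yz lexx orbT.
Qed.

Lemma is_path_loss_measurable_norm (l : R -> R) d (T : measurableType d) (V : T -> R) :
  is_path_loss l -> measurable_fun setT V -> measurable_fun setT (fun w => l `|V w|%R).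
Proof.
move=> pl mV.
have -> : (fun w => l `|V w|%R) = (fun w => l (Num.max `|V w| 0)%R).
  by apply/funext => w; rewrite max_l.
by apply: is_path_loss_measurable => //; exact: measurableT_comp.
Qed.

Section joint.
Context d (T : measurableType d) (q q' : T -> \bar R) (V : T -> R).
Hypotheses (mq : measurable_fun setT q) (mq' : measurable_fun setT q').
Hypothesis mV : measurable_fun setT V.

Lemma measurable_is_los : measurable_fun setT (fun w => is_los (q w) (q' w) (V w)).
Proof.
apply: measurable_or; apply: measurable_and.
- exact: measurable_fun_ltr.
- by apply: measurable_fun_lte => //; exact/measurable_EFinP.
- exact: measurable_fun_ltr.
- by apply: measurable_fun_lte => //; apply/measurable_EFinP; exact: measurableT_comp.
Qed.

Variables (lL lN : R -> R).
Hypotheses (plL : is_path_loss lL) (plN : is_path_loss lN).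

Lemma measurable_path_loss_bs_type :
  measurable_fun setT (fun w => path_loss lL lN (bs_type (q w) (q' w) (V w)) `|V w|%R).
Proof.
have -> : (fun w => path_loss lL lN (bs_type (q w) (q' w) (V w)) `|V w|%R) =
    (fun w => if is_los (q w) (q' w) (V w) then lL `|V w|%R else lN `|V w|%R).
  by apply/funext => w; rewrite bs_typeE; case: ifP.
apply: measurable_fun_ifT; first exact: measurable_is_los.
- exact: is_path_loss_measurable_norm.
- exact: is_path_loss_measurable_norm.
Qed.

Lemma measurable_exclusion (t : link_type) (x : R) : measurable_fun setT (fun w =>
  exclusion_radius lL lN (bs_type (q w) (q' w) (V w)) t x < `|V w|%:E).
Proof.
have -> : (fun w => exclusion_radius lL lN (bs_type (q w) (q' w) (V w)) t x < `|V w|%:E) =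
    (fun w => if is_los (q w) (q' w) (V w) then exclusion_radius lL lN LoS t x < `|V w|%:E
              else exclusion_radius lL lN NLoS t x < `|V w|%:E).
  by apply/funext => w; rewrite bs_typeE; case: ifP.
have mV' : measurable_fun setT (fun w => `|V w|%:E).
  by apply/measurable_EFinP; exact: measurableT_comp.
apply: measurable_fun_ifT; first exact: measurable_is_los.
- exact: measurable_fun_lte.
- exact: measurable_fun_lte.
Qed.

End joint.

(** The infimum over a set of indices depending on [b] becomes one over all indices, the value [+oo]
    standing for the discarded ones. In this form measurability in [b] is that of a countable
    infimum. *)
Lemma blockage_dist_posE (b : nat -> R) : blockage_dist_pos b =
  einfs (fun j => if (0 < b j)%R then (b j)%:E else +oo) 0%N.
Proof.
apply/eqP; rewrite eq_le; apply/andP; split.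
  apply: le_ereal_inf_tmp => _ [j _ <-]; case: ifPn => [bj|_]; last by rewrite leey.
  by apply: ereal_inf_lbound; exists j.
apply: le_ereal_inf_tmp => _ [j /= bj <-].
by apply: ereal_inf_lbound; exists j => //; rewrite bj.
Qed.

Lemma blockage_dist_negE (b : nat -> R) : blockage_dist_neg b =
  einfs (fun j => if (b j < 0)%R then (- b j)%:E else +oo) 0%N.
Proof.
apply/eqP; rewrite eq_le; apply/andP; split.
  apply: le_ereal_inf_tmp => _ [j _ <-]; case: ifPn => [bj|_]; last by rewrite leey.
  by apply: ereal_inf_lbound; exists j.
apply: le_ereal_inf_tmp => _ [j /= bj <-].
by apply: ereal_inf_lbound; exists j => //; rewrite bj.
Qed.

Lemma blockage_dist_pos_ge0 (b : nat -> R) : 0 <= blockage_dist_pos b.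
Proof. by apply: le_ereal_inf_tmp => _ [j /= bj <-]; rewrite lee_fin ltW. Qed.

Lemma blockage_dist_neg_ge0 (b : nat -> R) : 0 <= blockage_dist_neg b.
Proof. by apply: le_ereal_inf_tmp => _ [j /= bj <-]; rewrite lee_fin oppr_ge0 ltW. Qed.

Lemma measurable_blockage_dist_pos :
  measurable_fun setT (fun b : seq_space R => blockage_dist_pos b).
Proof.
rewrite (_ : (fun b : seq_space R => _) = fun b => einfs
  (fun j => if (0 < b j)%R then (b j)%:E else +oo) 0%N); last first.
  by apply/funext => b; exact: blockage_dist_posE.
apply: (@measurable_fun_einfs _ (seq_space R) R setT
  (fun j (b : seq_space R) => if (0 < b j)%R then (b j)%:E else +oo)) => j.
have mj := measurable_coordinate j.
by apply: measurable_fun_ifT => //; [exact: measurable_fun_ltr|exact/measurable_EFinP].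
Qed.

Lemma measurable_blockage_dist_neg :
  measurable_fun setT (fun b : seq_space R => blockage_dist_neg b).
Proof.
rewrite (_ : (fun b : seq_space R => _) = fun b => einfs
  (fun j => if (b j < 0)%R then (- b j)%:E else +oo) 0%N); last first.
  by apply/funext => b; exact: blockage_dist_negE.
apply: (@measurable_fun_einfs _ (seq_space R) R setT
  (fun j (b : seq_space R) => if (b j < 0)%R then (- b j)%:E else +oo)) => j.
have mj := measurable_coordinate j.
apply: measurable_fun_ifT => //; first exact: measurable_fun_ltr.
by apply/measurable_EFinP; exact: measurable_funN.
Qed.

End network_measurability.

(** * Interference kernel and the integrals of the two formulas *)

Section interference_kernel.
Context (R : realType) (lL lN : R -> R) (s x : R).
Hypotheses (plL : is_path_loss lL) (plN : is_path_loss lN) (s0 : (0 < s)%R).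
Local Notation leb := (@lebesgue_measure R).
Local Notation pl := (path_loss lL lN).

Lemma path_loss_ge0 v y : (0 <= y)%R -> (0 <= pl v y)%R.
Proof. by case: plL => + _ _; case: plN => + _ _; case: v => /= h1 h2; [exact: h2|exact: h1]. Qed.

(** Both sides equal [s l / (1 + s l)]; at [l = 0] the convention agrees with [ln 1 = 0]. *)
Lemma laplace_kernelE (l : R) : (0 <= l)%R ->
  laplace_kernel s l = (1 - expR (- ln (1 + s * l)))%R.
Proof.
move=> l0; have sl0 : (0 <= s * l)%R by rewrite mulr_ge0// ltW.
have sl1 : (0 < 1 + s * l)%R by rewrite ltr_pwDl.
rewrite expRN lnK ?posrE// /laplace_kernel; case: eqP => [->|/eqP ln0].
  by rewrite mulr0 addr0 invr1 subrr.
have sl : (0 < s * l)%R by rewrite mulr_gt0// lt0r ln0.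
have sn0 : s != 0%R by rewrite gt_eqF.
field.
have sl1' : (0 < s * l + 1)%R by rewrite addrC.
by rewrite ?ln0 ?sn0 ?(gt_eqF sl1) ?(gt_eqF sl1') //.
Qed.

Lemma laplace_kernel_ge0 (l : R) : (0 <= l)%R -> (0 <= laplace_kernel s l)%R.
Proof.
move=> l0; rewrite laplace_kernelE// subr_ge0 -[leRHS]expR0 ler_expR oppr_le0 ln_ge0//.
by rewrite lerDl mulr_ge0// ltW.
Qed.

Definition excluded (t : link_type) (q q' : \bar R) (y : R) : bool :=
  ~~ (exclusion_radius lL lN (bs_type q q' y) t x < `|y|%:E).

Definition interference_exponent t q q' y : \bar R :=
  if excluded t q q' y then +oo else (ln (1 + s * pl (bs_type q q' y) `|y|))%:E.

Definition exclusion_exponent t q q' y : \bar R := if excluded t q q' y then +oo else 0.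

Definition interference_density t q q' y : \bar R :=
  if excluded t q q' y then 0 else (laplace_kernel s (pl (bs_type q q' y) `|y|))%:E.

Lemma exclusion_exponent_ge0 t q q' y : 0 <= exclusion_exponent t q q' y.
Proof. by rewrite /exclusion_exponent; case: ifP. Qed.

Lemma interference_density_ge0 t q q' y : 0 <= interference_density t q q' y.
Proof.
rewrite /interference_density; case: ifP => // _.
by rewrite lee_fin laplace_kernel_ge0// path_loss_ge0.
Qed.

(** Inside the exclusion zone both exponents are [+oo] and contribute 1; outside, only the
    interference contributes. The additive form survives a zone of infinite length, where a
    difference of integrals would not. *)
Lemma onem_interference_exponent t q q' y :
  1 - expeR (- interference_exponent t q q' y) =
  (1 - expeR (- exclusion_exponent t q q' y)) + interference_density t q q' y.
Proof.
rewrite /interference_exponent /exclusion_exponent /interference_density.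
case: ifP => _; first by rewrite adde0.
by rewrite oppe0 expeR0 subee// add0e laplace_kernelE ?path_loss_ge0.
Qed.

Lemma measurable_interference_density_comp (l : R -> R) d (T : measurableType d) (V : T -> R) :
  is_path_loss l -> measurable_fun setT V ->
  measurable_fun setT (fun w => laplace_kernel s (l (Num.max (V w) 0)%R)).
Proof.
move=> pl_l mV; have [l0 _ _] := pl_l.
have -> : (fun w => laplace_kernel s (l (Num.max (V w) 0)%R)) =
    (fun w => (1 - expR (- ln (1 + s * l (Num.max (V w) 0))))%R).
  by apply/funext => w; rewrite laplace_kernelE// l0// le_max lexx orbT.
have ml := is_path_loss_measurable pl_l mV.
apply: measurable_funB => //; apply: measurableT_comp; first exact: measurable_expR.
apply: measurable_funN; apply: measurableT_comp; first exact: measurable_ln.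
by apply: measurable_funD => //; exact: measurable_funM.
Qed.

Section measurability.
Variables (q q' : \bar R) (t : link_type).

Lemma measurable_excluded : measurable_fun setT (excluded t q q').
Proof.
apply: measurable_neg.
exact: (@measurable_exclusion _ _ _ (cst q) (cst q') (fun y : R => y)).
Qed.

Lemma measurable_exclusion_exponent : measurable_fun setT (exclusion_exponent t q q').
Proof. by apply: measurable_fun_ifT => //; exact: measurable_excluded. Qed.

Lemma measurable_interference_density : measurable_fun setT (interference_density t q q').
Proof.
apply: measurable_fun_ifT; [exact: measurable_excluded|exact: measurable_cst|].
have mpl : measurable_fun setT (fun y => pl (bs_type q q' y) `|y|%R).
  exact: (@measurable_path_loss_bs_type _ _ _ (cst q) (cst q') (fun y : R => y)).
apply/measurable_EFinP.
have -> : (fun y => laplace_kernel s (pl (bs_type q q' y) `|y|%R)) =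
    (fun y => (1 - expR (- ln (1 + s * pl (bs_type q q' y) `|y|)))%R).
  by apply/funext => y; rewrite laplace_kernelE// path_loss_ge0.
apply: measurable_funB => //; apply: measurableT_comp; first exact: measurable_expR.
apply: measurable_funN; apply: measurableT_comp; first exact: measurable_ln.
by apply: measurable_funD => //; exact: measurable_funM.
Qed.

End measurability.

Section pieces.
Variable lambda : R.
Hypotheses (lambda_gt0 : (0 < lambda)%R) (x_gt0 : (0 < x)%R).
Hypothesis exclusion_lt : forall y : R, (0 < y)%R ->
  (exclusion_radius lL lN NLoS LoS y < y%:E)%E /\ (y%:E < exclusion_radius lL lN LoS NLoS y)%E.

Local Notation QQ := (\bar R * \bar R)%type.
Local Notation eN := (exclusion_radius lL lN NLoS LoS x).
Local Notation eL := (exclusion_radius lL lN LoS NLoS x).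

(** One shape for all the integrals of both formulas, with the domain and the indicator merged in
    [b]. Keeping [p] as a variable gives joint measurability, and so measurability of the integral
    in [(q, q')]. *)
Let piece (l : R -> R) (b : QQ -> R -> bool) (p : QQ) (y : R) : \bar R :=
  if b p y then (laplace_kernel s (l (Num.max y 0)%R))%:E else 0.

Let eN_ge0 : 0 <= eN.
Proof. by apply: le_ereal_inf_tmp => _ [y /= [y0 _] <-]; rewrite lee_fin. Qed.

Let eN_lt : eN < x%:E. Proof. exact: (exclusion_lt x_gt0).1. Qed.

Let eL_gt : x%:E < eL. Proof. exact: (exclusion_lt x_gt0).2. Qed.

Let piece_ge0 l b p y : is_path_loss l -> 0 <= piece l b p y.
Proof.
move=> [l0 _ _]; rewrite /piece; case: ifP => // _.
by rewrite lee_fin laplace_kernel_ge0// l0// le_max lexx orbT.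
Qed.

Let mV : measurable_fun setT (fun u : QQ * measurableTypeR R => u.2 : R).
Proof. exact: (@measurable_snd _ _ QQ (measurableTypeR R)). Qed.

Let mp1 : measurable_fun setT (fun u : QQ * measurableTypeR R => u.1.1).
Proof.
apply: (measurableT_comp (@measurable_fst _ _ (\bar R) (\bar R))).
exact: (@measurable_fst _ _ QQ (measurableTypeR R)).
Qed.

Let mp2 : measurable_fun setT (fun u : QQ * measurableTypeR R => u.1.2).
Proof.
apply: (measurableT_comp (@measurable_snd _ _ (\bar R) (\bar R))).
exact: (@measurable_fst _ _ QQ (measurableTypeR R)).
Qed.

Let mVE : measurable_fun setT (fun u : QQ * measurableTypeR R => (u.2 : R)%:E).
Proof. exact/measurable_EFinP. Qed.

Let mpiece l b : is_path_loss l ->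
  measurable_fun setT (fun u : QQ * measurableTypeR R => b u.1 u.2) ->
  measurable_fun setT (fun u : QQ * measurableTypeR R => piece l b u.1 u.2).
Proof.
move=> pl_l mb; apply: measurable_fun_ifT => //; apply/measurable_EFinP.
exact: measurable_interference_density_comp.
Qed.

Let measurable_integral_piece l b : is_path_loss l ->
  measurable_fun setT (fun u : QQ * measurableTypeR R => b u.1 u.2) ->
  measurable_fun setT (fun p => \int[leb]_y piece l b p y).
Proof.
move=> pl_l mb.
apply: (@measurable_fun_fubini_tonelli_F _ _ _ _ _ leb (fun u => piece l b u.1 u.2)).
  exact: mpiece.
by move=> u; exact: piece_ge0.
Qed.

Let mpiece1 l b p : is_path_loss l ->
  measurable_fun setT (fun u : QQ * measurableTypeR R => b u.1 u.2) ->
  measurable_fun setT (fun y : measurableTypeR R => piece l b p y).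
Proof.
move=> pl_l mb; exact: (measurable_fun_pair2 p (mpiece pl_l mb)).
Qed.

(* The domains of the integrals in [laplace_LoS] ([b1] to [b4]) and in
   [laplace_NLoS] ([c1] to [c3]); a pair [p] stands for [(q, q')]. *)
Let b1 (p : QQ) (y : R) := p.1 < y%:E.
Let b2 (p : QQ) (y : R) := (eN < y%:E) && (p.2 < y%:E).
Let b3 (p : QQ) (y : R) := (x < y)%R && (y%:E < p.1).
Let b4 (p : QQ) (y : R) := (x < y)%R && (y%:E < p.2).
Let c1 (p : QQ) (y : R) := (x < y)%R.
Let c2 (p : QQ) (y : R) := (x < y)%R && (p.2 < y%:E).
Let c3 (p : QQ) (y : R) := (eL < y%:E) && (y%:E < p.2).

Let mb1 : measurable_fun setT (fun u : QQ * measurableTypeR R => b1 u.1 u.2).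
Proof. exact: measurable_fun_lte. Qed.
Let mb2 : measurable_fun setT (fun u : QQ * measurableTypeR R => b2 u.1 u.2).
Proof. by apply: measurable_and; exact: measurable_fun_lte. Qed.
Let mb3 : measurable_fun setT (fun u : QQ * measurableTypeR R => b3 u.1 u.2).
Proof. by apply: measurable_and; [exact: measurable_fun_ltr|exact: measurable_fun_lte]. Qed.
Let mb4 : measurable_fun setT (fun u : QQ * measurableTypeR R => b4 u.1 u.2).
Proof. by apply: measurable_and; [exact: measurable_fun_ltr|exact: measurable_fun_lte]. Qed.
Let mc1 : measurable_fun setT (fun u : QQ * measurableTypeR R => c1 u.1 u.2).
Proof. exact: measurable_fun_ltr. Qed.
Let mc2 : measurable_fun setT (fun u : QQ * measurableTypeR R => c2 u.1 u.2).
Proof. by apply: measurable_and; [exact: measurable_fun_ltr|exact: measurable_fun_lte]. Qed.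
Let mc3 : measurable_fun setT (fun u : QQ * measurableTypeR R => c3 u.1 u.2).
Proof. by apply: measurable_and; exact: measurable_fun_lte. Qed.

Let integral_piece (l : R -> R) (D : set R) (b : QQ -> R -> bool) (B : R -> bool) p :
  (forall y, D y -> 0 <= y)%R -> (forall y, b p y <-> D y /\ B y) ->
  \int[leb]_(y in D) ((B y)%:R * laplace_kernel s (l y))%:E = \int[leb]_y piece l b p y.
Proof.
move=> D0 bE; rewrite integral_mkcond; apply: eq_integral => y _.
rewrite patchE /piece; case: ifPn => [/set_mem Dy|/negP Dy].
  rewrite max_l ?D0//; have [By|By] := boolP (B y).
    by rewrite mul1r (_ : b p y = true)//; apply/bE.
  by rewrite mul0r ifN//; apply: contra By => /bE[].
by rewrite ifN//; apply/negP => /bE[Dy' _]; apply: Dy; rewrite inE.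
Qed.

Lemma laplace_LoSE q q' : 0 <= q -> 0 <= q' -> laplace_LoS lL lN lambda s x q q' =
  expeR (- (lambda%:E * (\int[leb]_y piece lN b1 (q, q') y + \int[leb]_y piece lN b2 (q, q') y +
     \int[leb]_y piece lL b3 (q, q') y + \int[leb]_y piece lL b4 (q, q') y))).
Proof.
move=> q0 q'0; rewrite /laplace_LoS; congr (expeR (- (_ * (_ + _ + _ + _)))).
- rewrite -(@integral_piece lN [set y | q < y%:E] b1 xpredT).
  + by apply: eq_integral => y _; rewrite mul1r.
  + by move=> y /= qy; rewrite -lee_fin (le_trans q0)// ltW.
  + by move=> y; split => [h|[]].
- apply: integral_piece => [y /= ey|y]; first by rewrite -lee_fin (le_trans eN_ge0)// ltW.
  by split => [/andP//|[? ?]]; exact/andP.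
- rewrite -(@integral_piece lL [set y | (x < y)%R /\ y%:E < q] b3 xpredT).
  + by apply: eq_integral => y _; rewrite mul1r.
  + by move=> y /= [xy _]; rewrite (le_trans (ltW x_gt0))// ltW.
  + by move=> y; split => [/andP[]//|[[? ?] _]]; exact/andP.
- apply: integral_piece => [y /= xy|y]; first by rewrite (le_trans (ltW x_gt0))// ltW.
  by split => [/andP//|[? ?]]; exact/andP.
Qed.

Lemma laplace_NLoSE q q' : 0 <= q -> 0 <= q' -> laplace_NLoS lL lN lambda s x q q' =
  expeR (- (lambda%:E * (\int[leb]_y piece lN c1 (q, q') y + \int[leb]_y piece lN c2 (q, q') y +
     \int[leb]_y piece lL c3 (q, q') y))).
Proof.
move=> q0 q'0; rewrite /laplace_NLoS; congr (expeR (- (_ * (_ + _ + _)))).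
- rewrite -(@integral_piece lN [set y | (x < y)%R] c1 xpredT).
  + by apply: eq_integral => y _; rewrite mul1r.
  + by move=> y /= xy; rewrite (le_trans (ltW x_gt0))// ltW.
  + by move=> y; split => [h|[]].
- apply: integral_piece => [y /= xy|y]; first by rewrite (le_trans (ltW x_gt0))// ltW.
  by split => [/andP//|[? ?]]; exact/andP.
- apply: integral_piece => [y /= ey|y].
    by rewrite -lee_fin ltW// (lt_trans _ ey)// (lt_trans _ eL_gt).
  by split => [/andP//|[? ?]]; exact/andP.
Qed.

Local Notation quadrant := [set p : QQ | 0 <= p.1 /\ 0 <= p.2].

Lemma measurable_laplace_LoS :
  measurable_fun quadrant (fun p => laplace_LoS lL lN lambda s x p.1 p.2).
Proof.
apply: (eq_measurable_fun (fun p => expeR (- (lambda%:E * (\int[leb]_y piece lN b1 p y +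
   \int[leb]_y piece lN b2 p y + \int[leb]_y piece lL b3 p y + \int[leb]_y piece lL b4 p y))))).
  by move=> [q q'] /set_mem[/= q0 q'0]; rewrite laplace_LoSE.
apply: measurable_funTS; apply: measurableT_comp; first exact: measurable_expeR.
apply: measurableT_comp => //; apply: measurable_funeM.
apply: emeasurable_funD; last exact: (measurable_integral_piece plL mb4).
apply: emeasurable_funD; last exact: (measurable_integral_piece plL mb3).
apply: emeasurable_funD; last exact: (measurable_integral_piece plN mb2).
exact: (measurable_integral_piece plN mb1).
Qed.

Lemma measurable_laplace_NLoS :
  measurable_fun quadrant (fun p => laplace_NLoS lL lN lambda s x p.1 p.2).
Proof.
apply: (eq_measurable_fun (fun p => expeR (- (lambda%:E * (\int[leb]_y piece lN c1 p y +
   \int[leb]_y piece lN c2 p y + \int[leb]_y piece lL c3 p y))))).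
  by move=> [q q'] /set_mem[/= q0 q'0]; rewrite laplace_NLoSE.
apply: measurable_funTS; apply: measurableT_comp; first exact: measurable_expeR.
apply: measurableT_comp => //; apply: measurable_funeM.
apply: emeasurable_funD; last exact: (measurable_integral_piece plL mc3).
apply: emeasurable_funD; last exact: (measurable_integral_piece plN mc2).
exact: (measurable_integral_piece plN mc1).
Qed.

(** At 0, [q] and [- q'] the strict inequalities of [bs_type] and those of the integration domains
    may disagree. When a distance is [+oo], [fine] returns 0, which does no harm: a real number
    never equals [+oo]. *)
Let null_boundary (q q' : \bar R) : exists N : set R, [/\ measurable N, leb N = 0 &
  forall y, ~ N y -> [/\ y != 0%R, y%:E != q & (- y)%:E != q']].
Proof.
exists ([set 0%R] `|` [set fine q] `|` [set (- fine q')%R]).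
have m1 (c : R) : measurable [set c] by exact: measurable_set1.
split.
- by apply: measurableU => //; exact: measurableU.
- apply: null_set_setU; [exact: measurableU|exact: m1| |exact: lebesgue_measure_set1].
  by apply: null_set_setU; [exact: m1|exact: m1| |]; exact: lebesgue_measure_set1.
- move=> y Ny; split.
  + by apply/eqP => y0; apply: Ny; left; left.
  + by apply/eqP => yq; apply: Ny; left; right; rewrite -yq.
  + by apply/eqP => yq; apply: Ny; right; rewrite /= -yq/= opprK.
Qed.

(** The terms with [q'] describe stations on the negative half-line through their distance.
    Reflecting them back allows a pointwise comparison with the density on the line. *)
Let integral_reflect l b p : is_path_loss l ->
  measurable_fun setT (fun u : QQ * measurableTypeR R => b u.1 u.2) ->
  \int[leb]_y piece l b p (- y)%R = \int[leb]_y piece l b p y.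
Proof.
move=> pl_l mb; apply: (@ge0_integral_lebesgueN R (fun y => piece l b p y)).
  exact: mpiece1.
by move=> y; exact: piece_ge0.
Qed.

Let mreflect l b p : is_path_loss l ->
  measurable_fun setT (fun u : QQ * measurableTypeR R => b u.1 u.2) ->
  measurable_fun setT (fun y : measurableTypeR R => piece l b p (- y)%R).
Proof.
move=> pl_l mb; apply: (measurableT_comp (mpiece1 p pl_l mb)).
have : measurable_fun setT (fun y : R => - y)%R by exact: measurable_funN.
by [].
Qed.

Lemma integral_interference_density_LoS q q' : 0 <= q -> 0 <= q' -> bs_type q q' x = LoS ->
  \int[leb]_y interference_density LoS q q' y =
  \int[leb]_y piece lN b1 (q, q') y + \int[leb]_y piece lN b2 (q, q') y +
     \int[leb]_y piece lL b3 (q, q') y + \int[leb]_y piece lL b4 (q, q') y.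
Proof.
move=> q0 q'0 xL.
have [N [mN N0 NE]] := null_boundary q q'.
have m1 := mpiece1 (q, q') plN mb1; have m2 := mreflect (q, q') plN mb2.
have m3 := mpiece1 (q, q') plL mb3; have m4 := mreflect (q, q') plL mb4.
rewrite -(@integral_reflect lN b2)// -(@integral_reflect lL b4)//.
rewrite -!ge0_integralD//; last first.
all: try by move=> y _; rewrite ?adde_ge0 ?piece_ge0.
all: try by repeat first [exact: m1|exact: m2|exact: m3|exact: m4|apply: emeasurable_funD].
apply: (@ge0_eq_integral_off_null _ (measurableTypeR R) R leb N) => //.
- by move=> y; exact: interference_density_ge0.
- by move=> y; rewrite !adde_ge0// piece_ge0.
move=> y /NE[y0 yq yq'].
have xq : x%:E < q.
  by move: xL; rewrite /bs_type x_gt0 (lt_gtF x_gt0)/= orbF; case: ifP.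
have [yneg|ypos|/eqP] := ltgtP y 0%R; last by rewrite (negbTE y0).
- have u0 : (0 < - y)%R by rewrite oppr_gt0.
  have Nqy : (q < y%:E) = false.
    by apply/negbTE; rewrite -leNgt (le_trans _ q0)// lee_fin ltW.
  have Nxy : (x < y)%R = false by apply/negbTE; rewrite -leNgt (le_trans (ltW yneg))// ltW.
  rewrite /interference_density /excluded /piece /b1 /b2 /b3 /b4 /= Nqy Nxy/= add0e adde0.
  rewrite /bs_type (lt_gtF yneg) yneg ltr0_norm//= max_l ?(ltW u0)//.
  have [uq'|uq'|uq'] := ltgtP (- y)%:E q'; last by rewrite uq' eqxx in yq'.
  + by rewrite andbF andbT add0e if_neg.
  + by rewrite andbF andbT adde0 if_neg.
- have u0 : (- y < 0)%R by rewrite oppr_lt0.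
  have Neu : (eN < (- y)%:E) = false.
    by apply/negbTE; rewrite -leNgt (le_trans _ eN_ge0)// lee_fin ltW.
  have Nxu : (x < - y)%R = false by apply/negbTE; rewrite -leNgt (le_trans (ltW u0))// ltW.
  rewrite /interference_density /excluded /piece /b1 /b2 /b3 /b4 /= Neu Nxu/= !adde0.
  rewrite /bs_type ypos (lt_gtF ypos) gtr0_norm//= orbF max_l ?(ltW ypos)//.
  have [qy|qy|qy] := ltgtP y%:E q; last by rewrite qy eqxx in yq.
  + by rewrite andbT add0e if_neg.
  (* A blocked station on the positive side satisfies [y > q > x > eN], so its exclusion condition
     is automatic. This is why that integral starts at [q]. *)
  + have -> : eN < y%:E by rewrite (lt_trans eN_lt)// (lt_trans xq).
    by rewrite andbF adde0.
Qed.

Lemma integral_interference_density_NLoS q q' : 0 <= q -> 0 <= q' -> bs_type q q' x = NLoS ->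
  \int[leb]_y interference_density NLoS q q' y =
  \int[leb]_y piece lN c1 (q, q') y + \int[leb]_y piece lN c2 (q, q') y +
     \int[leb]_y piece lL c3 (q, q') y.
Proof.
move=> q0 q'0 xL.
have [N [mN N0 NE]] := null_boundary q q'.
have m1 := mpiece1 (q, q') plN mc1; have m2 := mreflect (q, q') plN mc2.
have m3 := mreflect (q, q') plL mc3.
rewrite -(@integral_reflect lN c2)// -(@integral_reflect lL c3)//.
rewrite -!ge0_integralD//; last first.
all: try by move=> y _; rewrite ?adde_ge0 ?piece_ge0.
all: try by repeat first [exact: m1|exact: m2|exact: m3|apply: emeasurable_funD].
apply: (@ge0_eq_integral_off_null _ (measurableTypeR R) R leb N) => //.
- by move=> y; exact: interference_density_ge0.
- by move=> y; rewrite !adde_ge0// piece_ge0.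
move=> y /NE[y0 yq yq'].
have qx : q <= x%:E.
  by move: xL; rewrite /bs_type x_gt0 (lt_gtF x_gt0)/= orbF leNgt; case: ifP.
have [yneg|ypos|/eqP] := ltgtP y 0%R; last by rewrite (negbTE y0).
- have u0 : (0 < - y)%R by rewrite oppr_gt0.
  have Nxy : (x < y)%R = false by apply/negbTE; rewrite -leNgt (le_trans (ltW yneg))// ltW.
  rewrite /interference_density /excluded /piece /c1 /c2 /c3 /= Nxy/= add0e.
  rewrite /bs_type (lt_gtF yneg) yneg ltr0_norm//= max_l ?(ltW u0)//.
  have [uq'|uq'|uq'] := ltgtP (- y)%:E q'; last by rewrite uq' eqxx in yq'.
  + by rewrite andbF andbT add0e if_neg.
  + by rewrite andbF andbT adde0 if_neg.
- have u0 : (- y < 0)%R by rewrite oppr_lt0.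
  have Neu : (eL < (- y)%:E) = false.
    by apply/negbTE; rewrite -leNgt ltW// (lt_trans _ eL_gt)// lte_fin (lt_trans u0).
  have Nxu : (x < - y)%R = false by apply/negbTE; rewrite -leNgt (le_trans (ltW u0))// ltW.
  rewrite /interference_density /excluded /piece /c1 /c2 /c3 /= Neu Nxu/= !adde0.
  rewrite /bs_type ypos (lt_gtF ypos) gtr0_norm//= orbF max_l ?(ltW ypos)//.
  have [qy|qy|qy] := ltgtP y%:E q; last by rewrite qy eqxx in yq.
  (* A visible station on the positive side satisfies [y < q <= x < eL], so it is always excluded.
     This is why the second formula has no LoS integral on that side. *)
  + have yx : y%:E < x%:E by exact: lt_le_trans qy qx.
    have -> : (eL < y%:E) = false by apply/negbTE; rewrite -leNgt ltW// (lt_trans yx).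
    by have -> : (x < y)%R = false by apply/negbTE; rewrite -leNgt ltW.
  + by rewrite if_neg.
Qed.

Let laplace_factor t q q' :
  expeR (- (lambda%:E * \int[leb]_y (1 - expeR (- interference_exponent t q q' y)))) =
  expeR (- (lambda%:E * \int[leb]_y interference_density t q q' y)) *
  expeR (- (lambda%:E * \int[leb]_y (1 - expeR (- exclusion_exponent t q q' y)))).
Proof.
under eq_integral do rewrite onem_interference_exponent.
have e0 y : 0 <= 1 - expeR (- exclusion_exponent t q q' y).
  by apply: onem_expeRN_ge0; exact: exclusion_exponent_ge0.
have d0 := interference_density_ge0 t q q'.
have me : measurable_fun setT (fun y : measurableTypeR R => 1 - expeR (- exclusion_exponent t q q' y)).
  by apply: measurable_onem_expeRN; exact: measurable_exclusion_exponent.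
have md : measurable_fun setT (fun y : measurableTypeR R => interference_density t q q' y).
  exact: measurable_interference_density.
rewrite ge0_integralD// ge0_muleDr ?integral_ge0// -expeRD addeC.
have a0 (a : \bar R) : 0 <= a -> 0 <= lambda%:E * a.
  by move=> a0; rewrite mule_ge0// lee_fin ltW.
by rewrite oppeD// ge0_adde_def// inE a0// integral_ge0.
Qed.

Lemma laplace_LoS_factor q q' : 0 <= q -> 0 <= q' -> bs_type q q' x = LoS ->
  expeR (- (lambda%:E * \int[leb]_y (1 - expeR (- interference_exponent LoS q q' y)))) =
  laplace_LoS lL lN lambda s x q q' *
  expeR (- (lambda%:E * \int[leb]_y (1 - expeR (- exclusion_exponent LoS q q' y)))).
Proof.
by move=> q0 q'0 xL; rewrite laplace_factor laplace_LoSE// integral_interference_density_LoS.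
Qed.

Lemma laplace_NLoS_factor q q' : 0 <= q -> 0 <= q' -> bs_type q q' x = NLoS ->
  expeR (- (lambda%:E * \int[leb]_y (1 - expeR (- interference_exponent NLoS q q' y)))) =
  laplace_NLoS lL lN lambda s x q q' *
  expeR (- (lambda%:E * \int[leb]_y (1 - expeR (- exclusion_exponent NLoS q q' y)))).
Proof.
by move=> q0 q'0 xN; rewrite laplace_factor laplace_NLoSE// integral_interference_density_NLoS.
Qed.

End pieces.
End interference_kernel.

(** * Conditional Laplace transform *)

Section serving.
Context (R : realType) (lL lN : R -> R) (s x : R).

Definition is_serving (t : link_type) (q q' : \bar R) (k : nat) (c : nat -> R) : bool :=
  `[< serving_event lL lN t x q q' k (fun j => c j - c k + x)%R >].

Lemma serving_eventP t q q' k (c : nat -> R) :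
  serving_event lL lN t x q q' k (fun j => c j - c k + x)%R <->
  bs_type q q' x = t /\ forall j, j != k -> ~~ excluded lL lN x t q q' (c j - c k + x)%R.
Proof.
rewrite /serving_event subrr add0r; split => -[xt h]; split => // j jk.
  by rewrite /excluded negbK; exact: h.
by have := h j jk; rewrite /excluded negbK.
Qed.

(* The serving indicator is absorbed into the exponent as [+oo] on the
   exclusion zone. *)
Lemma is_serving_expeR t q q' k (c : nat -> R) (v : R -> \bar R) : (forall y, 0 <= v y) ->
  (is_serving t q q' k c)%:R%:E * expeR (- \sum_(0 <= j <oo | j != k) v (c j - c k + x)%R) =
  `[< bs_type q q' x = t >]%:R%:E * expeR (- \sum_(0 <= j <oo | j != k)
     (if excluded lL lN x t q q' (c j - c k + x)%R then +oo else v (c j - c k + x)%R)) :> \bar R.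
Proof.
move=> v0; rewrite /is_serving.
have [xt|xt] := asboolP (bs_type q q' x = t); last first.
  by rewrite asboolF ?mul0e// => /serving_eventP[].
have [[j jk ej]|noe] := pselect (exists2 j, j != k & excluded lL lN x t q q' (c j - c k + x)%R).
  rewrite asboolF ?mul0e; last by move=> /serving_eventP[_ /(_ _ jk)]; rewrite ej.
  rewrite (@nneseries_pinfty _ _ _ j) ?mule0//; last by rewrite ej.
  by move=> i _; case: ifP.
have ne j : j != k -> excluded lL lN x t q q' (c j - c k + x)%R = false.
  by move=> jk; apply/negbTE/negP => ej; apply: noe; exists j.
rewrite asboolT; last by apply/serving_eventP; split => // j /ne ->.
congr (_ * expeR (- _)); apply: eq_eseriesr => j /ne -> //.
Qed.

End serving.

Section palm_serving.
Context d (T : measurableType d) (R : realType) (P : probability T R).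
Variables (lambda : R) (X : nat -> {RV P >-> R}) (lL lN : R -> R) (x : R).
Hypotheses (lambda_gt0 : (0 < lambda)%R) (PPP_X : homogeneous_PPP P lambda X).
Local Notation leb := (@lebesgue_measure R).

(** Taking for [v] the logarithmic exponent left by the fading gives the Laplace transform on the
    serving event; taking [v = 0] gives the weight of that event. *)
Lemma palm_laplace_serving t q q' (v : R -> \bar R) :
  measurable_fun setT v -> (forall y, 0 <= v y) ->
  \int[P]_w \sum_(0 <= k <oo) ((\1_(`[0%R, 1%R]%classic : set R) (X k w))%:E *
    ((is_serving lL lN x t q q' k (fun j => X j w))%:R%:E *
     expeR (- \sum_(0 <= j <oo | j != k) v (X j w - X k w + x)%R))) =
  `[< bs_type q q' x = t >]%:R%:E * (lambda%:E * expeR (- (lambda%:E * \int[leb]_y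
     (1 - expeR (- (if excluded lL lN x t q q' y then +oo else v y)))))).
Proof.
move=> mv v0.
pose phi y := if excluded lL lN x t q q' y then +oo else v y.
have phi0 y : 0 <= phi y by rewrite /phi; case: ifP.
have mphi : measurable_fun setT phi.
  by apply: measurable_fun_ifT => //; exact: measurable_excluded.
rewrite -(palm_laplace_shift lambda_gt0 PPP_X x mphi phi0) /palm_laplace.
have mI : measurable (`[0%R, 1%R]%classic : set R) by exact: measurable_itv.
have mshift : measurable_fun setT
    (fun p : measurableTypeR R * measurableTypeR R => phi (p.2 - p.1 + x)%R).
  have mm : measurable_fun setT
      (fun p : measurableTypeR R * measurableTypeR R => (p.2 - p.1 + x)%R).
    apply: measurable_funD => //.
    exact: (@measurable_funB _ _ _ setT (snd : _ -> measurableTypeR R) fst).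
  exact: (measurableT_comp mphi mm).
have term0 w k : 0 <= (\1_(`[0%R, 1%R]%classic : set R) (X k w))%:E *
    expeR (- \sum_(0 <= j <oo | j != k) phi (X j w - X k w + x)%R).
  by rewrite mule_ge0 ?expeR_ge0// lee_fin.
rewrite -ge0_integralZl//; last 2 first.
- apply: ge0_emeasurable_sum => [k w _ _|k _]; first exact: term0.
  exact: (palm_term_measurable (P := P) X k mI mshift).
- by move=> w _; apply: nneseries_ge0 => k _ _; exact: term0.
apply: eq_integral => w _; rewrite -nneseriesMl//.
by apply: eq_eseriesr => k _; rewrite is_serving_expeR// muleCA.
Qed.

End palm_serving.

Section conditional_laplace.
Context d (T : measurableType d) (R : realType) (P : probability T R).
Variables (lambda : R) (X Y H : nat -> {RV P >-> R}) (lL lN : R -> R) (x s : R).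
Hypotheses (lambda_gt0 : (0 < lambda)%R) (s_gt0 : (0 < s)%R).
Hypotheses (PPP_X : homogeneous_PPP P lambda X) (exp_H : iid_exponential_mean1 P H).
Hypothesis indep_XYH : independent_sequences3 P X Y H.
Hypotheses (plL : is_path_loss lL) (plN : is_path_loss lN).
Local Notation leb := (@lebesgue_measure R).
Local Notation S := (seq_space R).
Local Notation U := (S * (S * S))%type.
Local Notation pl := (path_loss lL lN).
Local Notation dpos := blockage_dist_pos.
Local Notation dneg := blockage_dist_neg.

Let mb : measurable_fun setT (fun u : U => u.1).
Proof. exact: measurable_fst. Qed.

Let mc : measurable_fun setT (fun u : U => u.2.1).
Proof. by apply: (measurableT_comp (@measurable_fst _ _ S S)); exact: measurable_snd. Qed.

Let mh : measurable_fun setT (fun u : U => u.2.2).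
Proof. by apply: (measurableT_comp (@measurable_snd _ _ S S)); exact: measurable_snd. Qed.

Let mcj j : measurable_fun setT (fun u : U => u.2.1 j : R).
Proof. exact: (measurableT_comp (measurable_coordinate j) mc). Qed.

Let mhj j : measurable_fun setT (fun u : U => u.2.2 j : R).
Proof. exact: (measurableT_comp (measurable_coordinate j) mh). Qed.

Let mdpos : measurable_fun setT (fun u : U => dpos u.1).
Proof. exact: (measurableT_comp (@measurable_blockage_dist_pos R) mb). Qed.

Let mdneg : measurable_fun setT (fun u : U => dneg u.1).
Proof. exact: (measurableT_comp (@measurable_blockage_dist_neg R) mb). Qed.

Let mshift j k : measurable_fun setT (fun u : U => (u.2.1 j - u.2.1 k + x)%R).
Proof. by apply: measurable_funD => //; exact: measurable_funB. Qed.

Let mbool (b : U -> bool) : measurable_fun setT b ->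
  measurable_fun setT (fun u => (b u)%:R%:E : \bar R).
Proof.
move=> mb'; rewrite (_ : (fun u => _) = fun u => if b u then 1 else 0 : \bar R); last first.
  by apply/funext => u; case: (b u).
exact: measurable_fun_ifT.
Qed.

(** The serving event is a condition on infinitely many points. Its indicator is expressed, through
    [is_serving_expeR] with [v = 0], by the exponential of a series, which is measurable term by
    term. *)
Let measurable_is_serving t k : measurable_fun setT
  (fun u : U => (is_serving lL lN x t (dpos u.1) (dneg u.1) k u.2.1)%:R%:E : \bar R).
Proof.
rewrite (_ : (fun u : U => _) = fun u => `[< bs_type (dpos u.1) (dneg u.1) x = t >]%:R%:E *
    expeR (- \sum_(0 <= j <oo | j != k)
     (if excluded lL lN x t (dpos u.1) (dneg u.1) (u.2.1 j - u.2.1 k + x)%R then +oo else 0))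
    :> \bar R); last first.
  apply/funext => u; rewrite -(@is_serving_expeR _ _ _ _ _ _ _ _ _ (fun=> 0))//.
  by rewrite eseries0// oppe0 expeR0 mule1.
apply: emeasurable_funM.
  apply: mbool; rewrite (_ : (fun u => _) = fun u => if is_los (dpos u.1) (dneg u.1) x
      then `[< LoS = t >] else `[< NLoS = t >]); last first.
    by apply/funext => u; rewrite bs_typeE; case: (is_los _ _ _).
  apply: measurable_fun_ifT => //.
  exact: (@measurable_is_los _ _ _ _ _ (cst x)).
apply: measurableT_comp; first exact: measurable_expeR.
apply: measurableT_comp => //.
apply: ge0_emeasurable_sum => [j u _ _|j _]; first by case: ifP.
apply: measurable_fun_ifT => //; apply: measurable_neg.
exact: (@measurable_exclusion _ _ _ _ _ (fun u : U => u.2.1 j - u.2.1 k + x)%R).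
Qed.

Let measurable_blockage_set (C : set (\bar R * \bar R)) : measurable C ->
  measurable_fun setT (fun u : U => `[< C (dpos u.1, dneg u.1) >]%:R%:E : \bar R).
Proof.
move=> mC; apply/measurable_EFinP.
have m1 : measurable_fun setT (fun u : U => (dpos u.1, dneg u.1)).
  exact: measurable_fun_pair.
apply: (eq_measurable_fun (fun u : U => \1_C (dpos u.1, dneg u.1) : R)).
  by move=> u _; rewrite indicE -[in LHS](asboolb (_ \in _)) in_setE.
have mi : measurable_fun setT (\1_C : _ -> R) by exact: measurable_indic.
exact: (measurableT_comp mi m1).
Qed.

(** Common shape of the two sides of the defining identity of the conditional expectation, as a
    function of the three sequences: [F] is the fading factor on one side and [g] on the other. *)
Let weighted (F : nat -> U -> \bar R) (t : link_type) (C : set (\bar R * \bar R)) (u : U) : \bar R :=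
  \sum_(0 <= k <oo) ((\1_(`[0%R, 1%R]%classic : set R) (u.2.1 k))%:E *
    (F k u * ((is_serving lL lN x t (dpos u.1) (dneg u.1) k u.2.1)%:R%:E *
       `[< C (dpos u.1, dneg u.1) >]%:R%:E))).

Let weighted_ge0 F t C u : (forall k u, 0 <= F k u) -> 0 <= weighted F t C u.
Proof.
move=> F0; apply: nneseries_ge0 => k _ _.
by rewrite !mule_ge0// lee_fin.
Qed.

Let measurable_weighted F t C : (forall k u, 0 <= F k u) ->
  (forall k, measurable_fun setT (F k)) -> measurable C ->
  measurable_fun setT (weighted F t C).
Proof.
move=> F0 mF mC; apply: ge0_emeasurable_sum => [k u _ _|k _].
  by rewrite !mule_ge0// lee_fin.
apply: emeasurable_funM.
  apply/measurable_EFinP.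
  have mI : measurable (`[0%R, 1%R]%classic : set R) by exact: measurable_itv.
  exact: (measurable_indic_comp mI (mcj k)).
by apply: emeasurable_funM => //; apply: emeasurable_funM => //; exact: measurable_blockage_set.
Qed.

(* The fading is only almost surely nonnegative; [Num.max _ 0] makes the
   exponent nonnegative everywhere. *)
Let fading (k : nat) (u : U) : \bar R :=
  expeR (- (s%:E * \sum_(0 <= j <oo | j != k) (Num.max (u.2.2 j) 0 *
    pl (bs_type (dpos u.1) (dneg u.1) (u.2.1 j - u.2.1 k + x)) `|u.2.1 j - u.2.1 k + x|)%:E)).

Let measurable_fading k : measurable_fun setT (fading k).
Proof.
apply: measurableT_comp; first exact: measurable_expeR.
apply: measurableT_comp => //; apply: measurable_funeM.
apply: ge0_emeasurable_sum => [j u _ _|j _].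
  by rewrite lee_fin mulr_ge0 ?path_loss_ge0// le_max lexx orbT.
apply/measurable_EFinP; apply: measurable_funM; first exact: measurable_maxr.
exact: (@measurable_path_loss_bs_type _ _ _ _ _ (fun u : U => u.2.1 j - u.2.1 k + x)%R).
Qed.


Let integral_fading (b c : S) k :
  \int[P]_w fading k (b, (c, fun i => H i w)) =
  expeR (- \sum_(0 <= j <oo | j != k)
    (ln (1 + s * pl (bs_type (dpos b) (dneg b) (c j - c k + x)) `|c j - c k + x|))%:E).
Proof.
pose l j := pl (bs_type (dpos b) (dneg b) (c j - c k + x)) `|c j - c k + x|%R.
have l0 j : (0 <= l j)%R by exact: path_loss_ge0.
by rewrite -(@laplace_exponential_series _ _ _ _ H exp_H s l (fun j => j != k) (ltW s_gt0) l0).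
Qed.

Let measurable_section (F : U -> \bar R) (b c : S) : measurable_fun setT F ->
  measurable_fun setT (fun w => F (b, (c, fun i => H i w))).
Proof.
move=> mF; apply: (measurableT_comp mF).
apply: measurable_fun_pair; first exact: measurable_cst.
apply: measurable_fun_pair; first exact: measurable_cst.
by apply: measurable_seq => i; exact: measurable_funPT.
Qed.

Let integral_weighted_fading t C (b : S) :
  \int[P]_w1 \int[P]_w3 weighted fading t C (b, (fun i => X i w1, fun i => H i w3)) =
  `[< C (dpos b, dneg b) >]%:R%:E * (`[< bs_type (dpos b) (dneg b) x = t >]%:R%:E *
    (lambda%:E * expeR (- (lambda%:E * \int[leb]_y
      (1 - expeR (- interference_exponent lL lN s x t (dpos b) (dneg b) y)))))).
Proof.
pose v y : \bar R := (ln (1 + s * pl (bs_type (dpos b) (dneg b) y) `|y|))%:E.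
have v0 y : 0 <= v y.
  by rewrite lee_fin ln_ge0// lerDl mulr_ge0 ?path_loss_ge0// ltW.
have mv : measurable_fun setT v.
  apply/measurable_EFinP; apply: measurableT_comp; first exact: measurable_ln.
  apply: measurable_funD => //; apply: measurable_funM => //.
  exact: (@measurable_path_loss_bs_type _ _ _ (cst (dpos b)) (cst (dneg b)) (fun y : R => y)).
rewrite -(@palm_laplace_serving _ _ _ P _ X lL lN x lambda_gt0 PPP_X t (dpos b) (dneg b) v mv v0).
have [Cb|Cb] := boolP `[< C (dpos b, dneg b) >]; last first.
  rewrite mul0e integral0_eq// => w _; apply: integral0_eq => w3 _.
  rewrite /weighted eseries0// => k _ _.
  by rewrite (negbTE Cb) !mule0.
rewrite mul1e; apply: eq_integral => w _.
pose a k : \bar R := (\1_(`[0%R, 1%R]%classic : set R) (X k w))%:E.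
pose i k : \bar R := (is_serving lL lN x t (dpos b) (dneg b) k (fun j => X j w))%:R%:E.
have a0 k : 0 <= a k by rewrite lee_fin.
have i0 k : 0 <= i k by rewrite lee_fin.
have f0 k w3 : 0 <= fading k (b, (fun i => X i w, fun i => H i w3)) by exact: expeR_ge0.
have mf k := measurable_section b (fun i => X i w) (measurable_fading k).
transitivity (\int[P]_w3 \sum_(0 <= k <oo)
    (a k * i k * fading k (b, (fun i => X i w, fun i => H i w3)))).
  apply: eq_integral => w3 _; apply: eq_eseriesr => k _.
  by rewrite Cb mule1 -muleA; congr (_ * _); exact: muleC.
rewrite integral_nneseries; last 3 first.
- exact: measurableT.
- by move=> k; apply: emeasurable_funM; [exact: measurable_cst|exact: mf].
- by move=> k w3 _; apply: mule_ge0; [exact: mule_ge0|exact: f0].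
apply: eq_eseriesr => k _.
rewrite ge0_integralZl; last 4 first.
- exact: measurableT.
- exact: mf.
- by move=> w3 _; exact: f0.
- exact: mule_ge0.
by rewrite integral_fading muleA.
Qed.

Let integral_weighted_cst (g : \bar R -> \bar R -> \bar R) t C (b : S) :
  0 <= g (dpos b) (dneg b) ->
  \int[P]_w1 \int[P]_w3 weighted (fun _ u => g (dpos u.1) (dneg u.1)) t C
    (b, (fun i => X i w1, fun i => H i w3)) =
  `[< C (dpos b, dneg b) >]%:R%:E * (`[< bs_type (dpos b) (dneg b) x = t >]%:R%:E *
    (lambda%:E * (g (dpos b) (dneg b) * expeR (- (lambda%:E * \int[leb]_y
      (1 - expeR (- exclusion_exponent lL lN x t (dpos b) (dneg b) y))))))).
Proof.
move=> g0.
pose v (y : R) : \bar R := 0.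
have v0 y : 0 <= v y by [].
have mv : measurable_fun setT v by exact: measurable_cst.
have [Cb|Cb] := boolP `[< C (dpos b, dneg b) >]; last first.
  rewrite mul0e integral0_eq// => w _; apply: integral0_eq => w3 _.
  rewrite /weighted eseries0// => k _ _.
  by rewrite (negbTE Cb) !mule0.
pose F := weighted (fun _ _ => 1) t setT.
have F0 u : 0 <= F u by exact: weighted_ge0.
(* With constant weight 1 the fading coordinate has no influence, so the zero sequence is put in its
   place and the integral over the fading becomes that of a constant. *)
have mF : measurable_fun setT (fun w => F (b, (fun i => X i w, fun=> 0%R))).
  have mF : measurable_fun setT F by apply: measurable_weighted => // k; exact: measurable_cst.
  apply: (measurableT_comp mF).
  apply: measurable_fun_pair; first exact: measurable_cst.
  apply: measurable_fun_pair; last exact: measurable_cst.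
  by apply: measurable_seq => i; exact: measurable_funPT.
transitivity (\int[P]_w (g (dpos b) (dneg b) * F (b, (fun i => X i w, fun=> 0%R)))).
  apply: eq_integral => w _.
  transitivity (\int[P]_w3 (cst (g (dpos b) (dneg b) * F (b, (fun i => X i w, fun=> 0%R))) w3)).
    apply: eq_integral => w3 _; rewrite /cst /F /weighted -nneseriesMl//.
    by apply: eq_eseriesr => k _ /=; rewrite Cb asboolT// !mule1 mul1e muleCA.
  transitivity (g (dpos b) (dneg b) * F (b, (fun i => X i w, fun=> 0%R)) * P setT).
    exact: (integral_cst P (@measurableT _ T)).
  by rewrite probability_setT mule1.
rewrite ge0_integralZl//.
transitivity (g (dpos b) (dneg b) * (`[< bs_type (dpos b) (dneg b) x = t >]%:R%:E *
    (lambda%:E * expeR (- (lambda%:E * \int[leb]_y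
      (1 - expeR (- exclusion_exponent lL lN x t (dpos b) (dneg b) y))))))); last first.
  rewrite mul1e muleCA; congr (_ * _); exact: muleCA.
congr (_ * _).
rewrite -(@palm_laplace_serving _ _ _ P _ X lL lN x lambda_gt0 PPP_X t (dpos b) (dneg b) v mv v0).
apply: eq_integral => w _; apply: eq_eseriesr => k _ /=.
by rewrite asboolT// mule1 mul1e eseries0// oppe0 expeR0 mule1.
Qed.

Let serving_indic t C w k :
  (\1_[set w' | serving_event lL lN t x (dpos (fun j => Y j w')) (dneg (fun j => Y j w')) k
      (fun j => X j w - X k w + x)%R /\
      C (dpos (fun j => Y j w'), dneg (fun j => Y j w'))] w)%:E =
  (is_serving lL lN x t (dpos (fun j => Y j w)) (dneg (fun j => Y j w)) k (fun j => X j w))%:R%:E *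
    `[< C (dpos (fun j => Y j w), dneg (fun j => Y j w)) >]%:R%:E :> \bar R.
Proof.
by rewrite indicE -[in LHS](asboolb (_ \in _)) in_setE asbool_and -EFinM -natrM mulnb.
Qed.

(** With the blockages fixed, integrating out the fading and the stations leaves the indicator of
    [C] as a common factor. The identity for all [C] thus reduces to one for each [(q, q')], stated
    as a product because the exclusion factor on its right-hand side may be 0. *)
Lemma cond_laplace_interferenceP (t : link_type) (g : \bar R -> \bar R -> \bar R) :
  measurable_fun [set p : \bar R * \bar R | 0 <= p.1 /\ 0 <= p.2] (fun p => g p.1 p.2) ->
  (forall q q', 0 <= q -> 0 <= q' -> 0 <= g q q') ->
  (forall q q', 0 <= q -> 0 <= q' -> bs_type q q' x = t ->
    expeR (- (lambda%:E * \int[leb]_y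
      (1 - expeR (- interference_exponent lL lN s x t q q' y)))) =
    g q q' * expeR (- (lambda%:E * \int[leb]_y
      (1 - expeR (- exclusion_exponent lL lN x t q q' y))))) ->
  is_cond_laplace_interference P lambda X Y H lL lN t x s g.
Proof.
move=> mg g0 gE; split => // C mC; rewrite /palm_expectation; congr (_ * _).
pose joint w : U := ((fun i => Y i w) : S, ((fun i => X i w) : S, (fun i => H i w) : S)).
pose G (k : nat) (u : U) := g (dpos u.1) (dneg u.1).
have d0 (b : S) : 0 <= dpos b /\ 0 <= dneg b.
  by split; [exact: blockage_dist_pos_ge0|exact: blockage_dist_neg_ge0].
have G0 k u : 0 <= G k u.
  exact: (g0 _ _ (blockage_dist_pos_ge0 u.1) (blockage_dist_neg_ge0 u.1)).
have f0 k u : 0 <= fading k u by exact: expeR_ge0.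
have mG k : measurable_fun setT (G k).
  (* [g] is known to be measurable on the quadrant only, where the two blockage distances take their
     values. *)
  have mQ : measurable [set p : \bar R * \bar R | 0 <= p.1 /\ 0 <= p.2].
    rewrite (_ : [set p | _] = `[0, +oo[%classic `*` `[0, +oo[%classic); last first.
      by apply/seteqP; split => -[a b]/=; rewrite !in_itv/= !andbT.
    by apply: measurableX; exact: emeasurable_itv.
  apply: (measurable_comp mQ _ mg (g := fun u : U => (dpos u.1, dneg u.1))).
    by move=> _ [u _ <-]; exact: d0.
  exact: measurable_fun_pair.
have [N [mN N0 NH]] := exponential_lt0_null exp_H.
transitivity (\int[P]_w weighted fading t C (joint w)).
  apply: (ge0_eq_integral_off_null mN N0).
  - move=> w; apply: nneseries_ge0 => k _ _.
    by rewrite !mule_ge0 ?expeR_ge0// lee_fin.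
  - by move=> w; exact: weighted_ge0.
  move=> w Nw; apply: eq_eseriesr => k _; rewrite serving_indic.
  congr (_ * (expeR (- (_ * _)) * _)); apply: eq_eseriesr => j _ /=.
  by rewrite max_l//; exact: NH.
transitivity (\int[P]_w weighted G t C (joint w)); last first.
  by apply: eq_integral => w _; apply: eq_eseriesr => k _; rewrite serving_indic.
rewrite (independent_sequences_integral indep_XYH (F := weighted fading t C)); last 2 first.
- exact: measurable_weighted.
- by move=> u; exact: weighted_ge0.
rewrite (independent_sequences_integral indep_XYH (F := weighted G t C)); last 2 first.
- exact: measurable_weighted.
- by move=> u; exact: weighted_ge0.
apply: eq_integral => w _.
have [q0 q'0] := d0 (fun i => Y i w).
rewrite integral_weighted_fading// integral_weighted_cst; last exact: g0.
congr (_ * _).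
have [xt|_] := asboolP (bs_type (dpos (fun i => Y i w)) (dneg (fun i => Y i w)) x = t).
  by rewrite gE.
by rewrite !mul0e.
Qed.

End conditional_laplace.

Local Close Scope ereal_scope.

Theorem lemma3 (d : measure_display) (T : measurableType d) (R : realType)
  (P : probability T R) (lambda mu : R)
  (X Y H : nat -> {RV P >-> R}) (lL lN : R -> R)
  (lambda_gt0 : 0 < lambda) (mu_gt0 : 0 < mu)
  (PPP_X : homogeneous_PPP P lambda X)
  (PPP_Y : homogeneous_PPP P mu Y)
  (exp_H : iid_exponential_mean1 P H)
  (indep_XYH : independent_sequences3 P X Y H)
  (path_loss_L : is_path_loss lL) (path_loss_N : is_path_loss lN)
  (lN_le_lL : forall y : R, 0 <= y -> lN y <= lL y)
  (exclusion_lt : forall y : R, 0 < y ->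
     (exclusion_radius lL lN NLoS LoS y < y%:E)%E /\
     (y%:E < exclusion_radius lL lN LoS NLoS y)%E)
  (x s : R) (x_gt0 : 0 < x) (s_gt0 : 0 < s) :
  is_cond_laplace_interference P lambda X Y H lL lN LoS x s
    (laplace_LoS lL lN lambda s x) /\
  is_cond_laplace_interference P lambda X Y H lL lN NLoS x s
    (laplace_NLoS lL lN lambda s x).
Proof.
split; apply: cond_laplace_interferenceP => //.
- exact: measurable_laplace_LoS.
- by move=> q q' _ _; exact: expeR_ge0.
- by move=> q q' q0 q'0; exact: laplace_LoS_factor.
- exact: measurable_laplace_NLoS.
- by move=> q q' _ _; exact: expeR_ge0.
- by move=> q q' q0 q'0; exact: laplace_NLoS_factor.
Qed.
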